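(* Let $N,n$ be positive integers and let $f_j\in M_{k_j}(\Gamma_0(N),\chi_j)$ for $j=1,\dots,n$. Define $$Z\binom{f_1,\dots,f_n}{s_1,\dots,s_n}:=N^{\frac{s_1+\dots+s_n}{2}}\,I_{i\infty}^0\binom{f_1,\dots,f_n}{s_1,\dots,s_n}.$$ Then, as meromorphic functions of $(s_1,\dots,s_n)\in\mathbb{C}^n$, $$Z\binom{f_1,\dots,f_n}{s_1,\dots,s_n}=(-1)^{s_1+\dots+s_n}\,Z\binom{\tilde f_n,\dots,\tilde f_1}{k_n-s_n,\dots,k_1-s_1},$$ where $\tilde f_j:=f_j|[\omega_N]_{k_j}$, i.e. $\tilde f_j(z)=N^{-k_j/2}z^{-k_j}f_j(-1/(Nz))$, and $(-1)^{s}:=e^{\pi i s}$.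
   Context: $M_k(\Gamma_0(N),\chi)$ is the space of holomorphic modular forms of weight $k$ and character $\chi$ for $\Gamma_0(N)$; $\mathbb{H}$ is the upper half-plane; $z^s$ for $z\in\mathbb{H}$ is the principal branch; $\omega_N=\begin{pmatrix}0&-1\\N&0\end{pmatrix}$. Iterated integrals: $$I_a^b\binom{f_1,\dots,f_n}{s_1,\dots,s_n}:=\int_a^b f_1(z_1)z_1^{s_1}\frac{dz_1}{z_1}\int_a^{z_1}f_2(z_2)z_2^{s_2}\frac{dz_2}{z_2}\cdots\int_a^{z_{n-1}}f_n(z_n)z_n^{s_n}\frac{dz_n}{z_n},$$ where the endpoints may be $i\infty$ or $0$ (approached along the imaginary axis). The modular iterated integral $I_{i\infty}^0$ is understood via meromorphic continuation as follows. $I_{i\infty}^{i/\sqrt N}\binom{f_1,\dots,f_m}{s_1,\dots,s_m}$ converges for $\mathrm{Re}(s_m)<0,\ \mathrm{Re}(s_m+s_{m-1})<0,\dots,\mathrm{Re}(s_m+\dots+s_1)<0$ and extends meromorphically to $\mathbb{C}^m$; $I_{i/\sqrt N}^{0}\binom{f_1,\dots,f_m}{s_1,\dots,s_m}$ converges for $\mathrm{Re}(s_1)>k_1,\ \mathrm{Re}(s_1+s_2)>k_1+k_2,\dots$ and extends meromorphically to $\mathbb{C}^m$; and $$I_{i\infty}^0\binom{f_1,\dots,f_n}{s_1,\dots,s_n}=\sum_{j=0}^n I_{i/\sqrt N}^0\binom{f_1,\dots,f_j}{s_1,\dots,s_j}\,I_{i\infty}^{i/\sqrt N}\binom{f_{j+1},\dots,f_n}{s_{j+1},\dots,s_n}$$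 (empty integrals equal $1$). *)

(* Defs.v *)
From Stdlib Require Export Reals ZArith List.
From Stdlib Require Import ClassicalEpsilon Lra Lia.
From Coquelicot Require Export Coquelicot.
Export ListNotations.

Open Scope R_scope.

Definition Cexp (z : C) : C := (exp (Re z) * cos (Im z), exp (Re z) * sin (Im z)).

(* Only used for [0 < Im z], where the principal argument lies in (0, PI) and
   is [acos (Re z / |z|)]. *)
Definition Clog (z : C) : C := (ln (Cmod z), acos (Re z / Cmod z)).

Definition Cpower (z s : C) : C := Cexp (s * Clog z).

Definition Cpowz (z : C) (k : Z) : C :=
  match k with
  | Z0 => 1
  | Zpos p => Cpow z (Pos.to_nat p)
  | Zneg p => / Cpow z (Pos.to_nat p)
  end.

Definition Csum (l : list C) : C := fold_right Cplus 0%C l.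

Definition Zsum (l : list Z) : Z := fold_right Z.add 0%Z l.

Definition in_H (z : C) : Prop := 0 < Im z.

(* f|[g]_k for g = (a b; c d) of positive determinant, normalised by
   det(g)^(k/2). *)
Definition slash (k : Z) (a b c d : Z) (f : C -> C) (z : C) : C :=
  (RtoC (Rpower (IZR (a * d - b * c)) (IZR k / 2)) *
   Cpowz (IZR c * z + IZR d) (- k) *
   f ((IZR a * z + IZR b) / (IZR c * z + IZR d)))%C.

Definition dirichlet_character (N : nat) (chi : Z -> C) : Prop :=
  (forall d, chi (d + Z.of_nat N)%Z = chi d) /\
  (forall d e, chi (d * e)%Z = (chi d * chi e)%C) /\
  (forall d, chi d <> 0%C <-> Z.gcd d (Z.of_nat N) = 1%Z).

(* Holomorphy at the cusps: for every g in SL_2(Z), f|[g]_k is invariant under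
   z |-> z + N, and is required to have a Fourier expansion in
   q_N = exp(2 pi i z / N) without negative exponents. *)
Definition modular_form (N : nat) (k : Z) (chi : Z -> C) (f : C -> C) : Prop :=
  (forall z, in_H z -> ex_derive (K := C_AbsRing) (V := C_NormedModule) f z) /\
  (forall a b c d : Z, (a * d - b * c = 1)%Z -> (Z.of_nat N | c)%Z ->
     forall z, in_H z -> slash k a b c d f z = (chi d * f z)%C) /\
  (forall a b c d : Z, (a * d - b * c = 1)%Z ->
     exists q : nat -> C, forall z, in_H z ->
       is_series (K := C_AbsRing) (V := C_NormedModule)
         (fun m : nat => (q m * Cexp (2 * PI * Ci * INR m * z / INR N))%C)
         (slash k a b c d f z)).

(* f|[omega_N]_k with omega_N = (0 -1; N 0). *)
Definition tilde (N : nat) (k : Z) (f : C -> C) : C -> C :=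
  slash k 0 (-1) (Z.of_nat N) 0 f.

Lemma Cpowz_RM (x : R) (z : C) (k : Z) : 0 < x -> z <> 0%C ->
  Cpowz (x * z) k = (RtoC (Rpower x (IZR k)) * Cpowz z k)%C.
Proof.
intros hx hz.
assert (hx0 : RtoC x <> 0%C) by (intros E; apply RtoC_inj in E; lra).
assert (hp : forall p, IZR (Zpos p) = INR (Pos.to_nat p)).
{ intros p; rewrite INR_IZR_INZ, positive_nat_Z; reflexivity. }
destruct k as [|p|p]; cbn [Cpowz].
- rewrite Rpower_O by exact hx. now rewrite Cmult_1_l.
- rewrite hp, Rpower_pow by exact hx.
  now rewrite Cpow_mult_l, RtoC_pow.
- change (Zneg p) with (- Zpos p)%Z.
  rewrite opp_IZR, Rpower_Ropp, hp, Rpower_pow by exact hx.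
  rewrite RtoC_inv, RtoC_pow by (apply pow_nonzero; lra).
  rewrite Cpow_mult_l. field.
  split; apply Cpow_nz; assumption.
Qed.

Lemma tildeE (N : nat) (k : Z) (f : C -> C) (z : C) :
  (0 < N)%nat -> in_H z ->
  tilde N k f z =
  (RtoC (Rpower (INR N) (- IZR k / 2)) * Cpowz z (- k) *
   f (- (1) / (INR N * z)))%C.
Proof.
intros hN hz.
assert (hx : 0 < INR N) by (apply lt_0_INR; exact hN).
assert (hz0 : z <> 0%C).
{ intros E; unfold in_H in hz; rewrite E in hz; simpl in hz; lra. }
unfold tilde, slash.
replace (0 * 0 - -1 * Z.of_nat N)%Z with (Z.of_nat N) by lia.
rewrite <- INR_IZR_INZ.
replace (INR N * z + 0%R)%C with (INR N * z)%C by ring.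
replace (0%R * z + (-1)%R)%C with (- (1))%C
  by (apply injective_projections; simpl; lra).
rewrite Cpowz_RM by assumption.
rewrite Cmult_assoc, <- RtoC_mult, <- Rpower_plus.
do 4 f_equal.
rewrite opp_IZR; lra.
Qed.

(* A point of C^n is a list of length n; values on lists of another length are
   irrelevant. *)

Definition polydisc (p : list C) (r : R) (q : list C) : Prop :=
  Forall2 (fun z w : C => Cmod (w - z)%C < r) p q.

(* On an open set, continuity together with holomorphy in each variable
   separately is joint holomorphy (Osgood). *)
Definition holomorphic_on (U : list C -> Prop) (F : list C -> C) : Prop :=
  forall p, U p ->
    (forall eps, 0 < eps -> exists delta, 0 < delta /\
       forall q, polydisc p delta q -> Cmod (F q - F p)%C < eps) /\
    (forall u z v, p = u ++ z :: v ->
       ex_derive (K := C_AbsRing) (V := C_NormedModule)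
         (fun w : C => F (u ++ w :: v)) z).

(* Locally a quotient g/h of holomorphic functions; the values of F on the thin
   set where h = 0 are arbitrary. *)
Definition meromorphic (n : nat) (F : list C -> C) : Prop :=
  forall p, length p = n ->
    exists (r : R) (g h : list C -> C),
      0 < r /\
      holomorphic_on (polydisc p r) g /\
      holomorphic_on (polydisc p r) h /\
      (exists q, polydisc p r q /\ h q <> 0%C) /\
      (forall q, polydisc p r q -> h q <> 0%C -> F q = (g q / h q)%C).

Definition open_dense (n : nat) (U : list C -> Prop) : Prop :=
  (forall p, length p = n -> U p ->
     exists r, 0 < r /\ forall q, polydisc p r q -> U q) /\
  (forall p r, length p = n -> 0 < r -> exists q, polydisc p r q /\ U q).

Definition meromorphic_eq (n : nat) (F G : list C -> C) : Prop :=
  meromorphic n F /\ meromorphic n G /\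
  exists U, open_dense n U /\
    forall s, length s = n -> U s -> F s = G s.

Definition is_mero_ext (n : nat) (D : list C -> Prop) (F0 F : list C -> C) :
  Prop :=
  meromorphic n F /\ (forall s, length s = n -> D s -> F s = F0 s).

(* The meromorphic continuation to C^n of a function F0 given on D, and 0 by
   convention when there is none. When D is open and nonempty it is unique up
   to [meromorphic_eq]. *)
Definition mero_ext (n : nat) (D : list C -> Prop) (F0 : list C -> C) :
  list C -> C :=
  match excluded_middle_informative (exists F, is_mero_ext n D F0 F) with
  | left H => proj1_sig (constructive_indefinite_description _ H)
  | right _ => fun _ => 0%C
  end.

(* The endpoints are filters on the coordinate t of z = i t: [at_point t] for
   the point i t, [Rbar_locally p_infty] for i oo, [at_right 0] for 0. *)
Fixpoint iter_int (A : (R -> Prop) -> Prop) (l : list ((C -> C) * C))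
  (B : (R -> Prop) -> Prop) : C :=
  match l with
  | [] => 1%C
  | (f, s) :: l' =>
      RInt_gen (V := C_R_CompleteNormedModule)
        (fun t : R =>
           let z := (Ci * t)%C in
           (f z * Cpower z s / z * Ci * iter_int A l' (at_point t))%C)
        A B
  end.

(* The weights k_j accompany the f_j because the domain of convergence at the
   endpoint 0 depends on them. *)
Definition forms : Type := list (Z * (C -> C)).

(* Meromorphic continuation of I_{i oo}^{i / sqrt N}. *)
Definition I_upper (N : nat) (l : forms) : list C -> C :=
  mero_ext (length l)
    (fun s => forall j, (j < length l)%nat -> Re (Csum (skipn j s)) < 0)
    (fun s => iter_int (Rbar_locally p_infty) (combine (map snd l) s)
                (at_point (/ sqrt (INR N)))).

(* Meromorphic continuation of I_{i / sqrt N}^0. *)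
Definition I_lower (N : nat) (l : forms) : list C -> C :=
  mero_ext (length l)
    (fun s => forall j, (1 <= j <= length l)%nat ->
       IZR (Zsum (firstn j (map fst l))) < Re (Csum (firstn j s)))
    (fun s => iter_int (at_point (/ sqrt (INR N))) (combine (map snd l) s)
                (at_right 0)).

(* I_{i oo}^0, with the path cut at i / sqrt N. *)
Definition I_full (N : nat) (l : forms) (s : list C) : C :=
  Csum (map (fun j => (I_lower N (firstn j l) (firstn j s) *
                       I_upper N (skipn j l) (skipn j s))%C)
            (seq 0 (S (length l)))).

Definition modular_Z (N : nat) (l : forms) (s : list C) : C :=
  (Cexp (Csum s / 2 * ln (INR N)) * I_full N l s)%C.

(* Main.v *)
(** Cutting the integral at the fixed point i/sqrt N of z |-> -1/(N z), the
    substitution by this involution exchanges the two halves of the path. On its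
    domain of convergence each lower integral thus equals an explicit exponential
    times an upper integral of the tilded forms in the reverse order. The reversal
    needs no Fubini theorem: the sum over all ways of cutting the iterated integral
    at a height x has zero derivative in x, equals one side at the base point and
    tends to the other side at infinity.

    Existence of the meromorphic continuations is not needed, since they are
    transported by reflection; their uniqueness is an identity theorem in several
    variables, reduced coordinatewise to a disc. In one variable it follows from
    Goursat's theorem on rectangles: if g(w) = f(q + e^w) vanishes for Re w < a and is
    holomorphic for Re w < b, then the integral of g(x + it) times the conjugate of
    g(y + it) over a period depends on x + y only, so g vanishes for
    Re w < (a + b) / 2. *)

Require Import Defs.
From Stdlib Require Import Lra Lia Classical ClassicalEpsilon FunctionalExtensionality.

(** * Limits and complex differentiability *)

Notation tends f F l := (filterlim (f : _ -> C) F (@locally C_UniformSpace l)).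
Notation locC := (@locally C_UniformSpace).
Notation is_Rder := (@is_derive R_AbsRing C_R_NormedModule).

(** [mero_ext] picks some continuation by description, so equal initial functions determine it only
    off a thin set; hence the need for an identity theorem. The sign comes from the branch of z^s.
    On the imaginary axis log (i t) = ln t + pi i / 2, and the logarithms of two points exchanged by
    the involution add up to pi i - ln N. Each s_j thus contributes exp((pi i - ln N) s_j): one part
    is (-1)^(s_j), the other, N^(-s_j), turns the normalising N^(s_j/2) into N^(-s_j/2). The tilde
    applied twice is (-1)^k f, so the two halves of the path are not quite symmetric. The reversal
    is therefore stated for abstract pairs of functions, then used for (f, tilde f) on the lower
    half and for (tilde f, f), with an extra exp(-pi i k), on the upper half. The factors of the two
    halves multiply to one that is the same for every cut, which lets it leave the sum over the
    cuts. *)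

Lemma locally_CE (z : C) (P : C -> Prop) :
  locC z P <-> exists d, 0 < d /\ forall w, Cmod (w - z)%C < d -> P w.
Proof.
split.
- intros H. destruct (proj1 (locally_C z P) H) as [d Hd].
  exists (pos d). split; [apply cond_pos|]. intros w Hw. now apply Hd.
- intros [d [Hd HP]]. apply (locally_C z P).
  exists (mkposreal d Hd). intros w Hw. now apply HP.
Qed.

Section Limits.
Context {T : Type} (F : (T -> Prop) -> Prop) {FF : Filter F}.

Lemma tendsE (f : T -> C) (l : C) :
  tends f F l <-> forall eps, 0 < eps -> F (fun x => Cmod (f x - l)%C < eps).
Proof.
split.
- intros H eps He. apply (H (fun w => Cmod (w - l)%C < eps)).
  apply locally_CE. now exists eps.
- intros H P HP. apply locally_CE in HP. destruct HP as [d [Hd HP]].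
  unfold filtermap. generalize (H d Hd). apply filter_imp. intros x. apply HP.
Qed.

Lemma tends_const (c : C) : tends (fun _ => c) F c.
Proof. apply filterlim_const. Qed.

Lemma tends_plus (f g : T -> C) (a b : C) :
  tends f F a -> tends g F b -> tends (fun x => f x + g x)%C F (a + b)%C.
Proof.
intros Hf Hg. apply tendsE. intros eps He.
assert (He2 : 0 < eps / 2) by lra.
generalize (filter_and _ _ (proj1 (tendsE _ _) Hf _ He2) (proj1 (tendsE _ _) Hg _ He2)).
apply filter_imp. intros x [H1 H2].
replace (f x + g x - (a + b))%C with ((f x - a) + (g x - b))%C by ring.
generalize (Cmod_triangle (f x - a) (g x - b)). lra.
Qed.

Lemma tends_mult (f g : T -> C) (a b : C) :
  tends f F a -> tends g F b -> tends (fun x => f x * g x)%C F (a * b)%C.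
Proof.
intros Hf Hg. apply tendsE. intros eps He.
assert (Ha := Cmod_ge_0 a). assert (Hb := Cmod_ge_0 b).
set (M := Cmod a + Cmod b + 1).
assert (HM : 0 < M) by (unfold M; lra).
set (d := Rmin 1 (eps / M / 2)).
assert (Hd : 0 < d).
{ apply Rmin_glb_lt; [lra|]. repeat apply Rdiv_lt_0_compat; lra. }
assert (Hd1 : d <= 1) by apply Rmin_l.
assert (HdM : d * M <= eps / 2).
{ apply Rle_trans with (eps / M / 2 * M).
  - apply Rmult_le_compat_r; [lra|apply Rmin_r].
  - right. field. lra. }
generalize (filter_and _ _ (proj1 (tendsE _ _) Hf _ Hd) (proj1 (tendsE _ _) Hg _ Hd)).
apply filter_imp. intros x [H1 H2].
replace (f x * g x - a * b)%C
  with ((f x - a) * (g x - b) + (a * (g x - b) + (f x - a) * b))%C by ring.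
generalize (Cmod_triangle ((f x - a) * (g x - b)) (a * (g x - b) + (f x - a) * b)).
generalize (Cmod_triangle (a * (g x - b)) ((f x - a) * b)).
rewrite !Cmod_mult.
assert (H3 := Cmod_ge_0 (f x - a)). assert (H4 := Cmod_ge_0 (g x - b)).
assert (Cmod (f x - a) * Cmod (g x - b) <= d * 1) by (apply Rmult_le_compat; lra).
assert (Cmod a * Cmod (g x - b) <= Cmod a * d) by (apply Rmult_le_compat_l; lra).
assert (Cmod (f x - a) * Cmod b <= d * Cmod b) by (apply Rmult_le_compat_r; lra).
unfold M in HdM. nra.
Qed.

Lemma tends_opp (f : T -> C) (a : C) :
  tends f F a -> tends (fun x => - f x)%C F (- a)%C.
Proof.
intros Hf. apply tendsE. intros eps He.
generalize (proj1 (tendsE _ _) Hf _ He). apply filter_imp. intros x.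
rewrite <- Cmod_opp. now replace (- (f x - a))%C with (- f x - - a)%C by ring.
Qed.

Lemma tends_minus (f g : T -> C) (a b : C) :
  tends f F a -> tends g F b -> tends (fun x => f x - g x)%C F (a - b)%C.
Proof. intros Hf Hg. apply tends_plus; [easy|now apply tends_opp]. Qed.

Lemma tends_conj (f : T -> C) (a : C) :
  tends f F a -> tends (fun x => Cconj (f x)) F (Cconj a).
Proof.
intros Hf. apply tendsE. intros eps He.
generalize (proj1 (tendsE _ _) Hf _ He). apply filter_imp. intros x.
now rewrite <- Cminus_conj, Cmod_conj.
Qed.

Lemma tends_pair (f g : T -> R) (a b : R) :
  filterlim f F (locally a) -> filterlim g F (locally b) ->
  tends (fun x => (f x, g x)) F (a, b).
Proof.
intros Hf Hg. intros P [d HP]. unfold filtermap.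
assert (H1 : F (fun x => ball a d (f x))) by exact (Hf _ (locally_ball a d)).
assert (H2 : F (fun x => ball b d (g x))) by exact (Hg _ (locally_ball b d)).
generalize (filter_and _ _ H1 H2). clear H1 H2. apply filter_imp. intros x [H1 H2]. exact (HP (f x, g x) (conj H1 H2)).
Qed.

Lemma tends_fst (f : T -> C) (a : C) :
  tends f F a -> filterlim (fun x => fst (f x)) F (locally (fst a)).
Proof.
intros Hf P [d HP]. unfold filtermap.
assert (H1 : F (fun x => ball (M := C_UniformSpace) a d (f x)))
  by exact (Hf _ (locally_ball a d)).
revert H1. apply filter_imp. intros x [H _]. exact (HP _ H).
Qed.

Lemma tends_RtoC (f : T -> R) (a : R) :
  filterlim f F (locally a) -> tends (fun x => RtoC (f x)) F (RtoC a).
Proof. intros Hf. apply tends_pair; [easy|apply filterlim_const]. Qed.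

End Limits.

Lemma Cexp_plus (a b : C) : Cexp (a + b) = (Cexp a * Cexp b)%C.
Proof.
unfold Cexp, Re, Im. simpl. rewrite exp_plus, cos_plus, sin_plus.
apply injective_projections; simpl; ring.
Qed.

Lemma Cexp_0 : Cexp 0 = 1%C.
Proof.
unfold Cexp, Re, Im. simpl. rewrite exp_0, cos_0, sin_0.
apply injective_projections; simpl; ring.
Qed.

Lemma Cexp_nz (a : C) : Cexp a <> 0%C.
Proof.
intros H. assert (E := Cexp_plus a (- a)).
replace (a + - a)%C with (RtoC 0) in E by ring.
rewrite Cexp_0, H, Cmult_0_l in E. now apply C1_nz.
Qed.

Lemma Cexp_opp (a : C) : Cexp (- a) = (/ Cexp a)%C.
Proof.
assert (E := Cexp_plus a (- a)).
replace (a + - a)%C with (RtoC 0) in E by ring. rewrite Cexp_0 in E.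
assert (H := Cexp_nz a).
transitivity (/ Cexp a * (Cexp a * Cexp (- a)))%C.
- field. easy.
- rewrite <- E. ring.
Qed.

Lemma Cmod_Cexp (a : C) : Cmod (Cexp a) = exp (Re a).
Proof.
unfold Cmod, Cexp. simpl.
replace (_ + _) with (exp (Re a) * exp (Re a) * (Rsqr (sin (Im a)) + Rsqr (cos (Im a))))
  by (unfold Rsqr; ring).
rewrite sin2_cos2, Rmult_1_r. apply sqrt_square. left. apply exp_pos.
Qed.

Lemma Cexp_RtoC (x : R) : Cexp (RtoC x) = RtoC (exp x).
Proof.
unfold Cexp, Re, Im. simpl. rewrite cos_0, sin_0.
apply injective_projections; simpl; ring.
Qed.

Lemma Cexp_INR (n : nat) (a : C) : Cexp (INR n * a) = Cpow (Cexp a) n.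
Proof.
induction n as [|n IH].
- simpl. rewrite Cmult_0_l. apply Cexp_0.
- rewrite S_INR, RtoC_plus, Cmult_plus_distr_r, Cexp_plus, IH, Cpow_S, Cmult_1_l.
  ring.
Qed.

Lemma Cmod_le_abs (z : C) : Cmod z <= Rabs (fst z) + Rabs (snd z).
Proof.
assert (H1 := Rabs_pos (fst z)). assert (H2 := Rabs_pos (snd z)).
unfold Cmod. apply Rsqr_incr_0_var; [|lra].
rewrite Rsqr_sqrt by (apply Rplus_le_le_0_compat; apply pow2_ge_0).
unfold Rsqr. rewrite <- (pow2_abs (fst z)), <- (pow2_abs (snd z)). nra.
Qed.

Lemma abs_fst_le (z : C) : Rabs (fst z) <= Cmod z.
Proof. eapply Rle_trans; [|apply Rmax_Cmod]. apply Rmax_l. Qed.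

Lemma abs_snd_le (z : C) : Rabs (snd z) <= Cmod z.
Proof. eapply Rle_trans; [|apply Rmax_Cmod]. apply Rmax_r. Qed.

(* Caratheodory's form of complex differentiability, stable under algebraic
   operations without any quotient. *)
Definition Cdiff (f : C -> C) (z : C) : Prop :=
  exists phi : C -> C,
    (forall w, f w = f z + phi w * (w - z))%C /\ tends phi (locC z) (phi z).

Lemma Cdiff_slope (f : C -> C) (z l : C) :
  (forall eps, 0 < eps ->
     locC z (fun w => Cmod (f w - f z - l * (w - z))%C <= eps * Cmod (w - z)%C)) ->
  Cdiff f z.
Proof.
intros H.
exists (fun w => if Ceq_dec w z then l else (f w - f z) / (w - z))%C. split.
- intros w. destruct (Ceq_dec w z) as [->|Hw]; [ring|].
  field. now apply Cminus_eq_contra.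
- apply tendsE; [apply locally_filter|]. intros eps He.
  generalize (H (eps / 2) ltac:(lra)). apply filter_imp. intros w Hw.
  destruct (Ceq_dec z z) as [_|]; [|easy].
  destruct (Ceq_dec w z) as [->|Hn].
  + replace (l - l)%C with (RtoC 0) by ring. now rewrite Cmod_0.
  + assert (Hn' : (w - z)%C <> 0%C) by now apply Cminus_eq_contra.
    replace ((f w - f z) / (w - z) - l)%C
      with ((f w - f z - l * (w - z)) / (w - z))%C by (field; easy).
    rewrite Cmod_div by easy.
    apply Rle_lt_trans with (eps / 2); [|lra].
    apply Rmult_le_reg_r with (Cmod (w - z)%C); [now apply Cmod_gt_0|].
    unfold Rdiv at 1. rewrite Rmult_assoc, Rinv_l, Rmult_1_r; [easy|].
    apply Rgt_not_eq. now apply Cmod_gt_0.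
Qed.

Lemma ex_derive_Cdiff (f : C -> C) (z : C) :
  ex_derive (K := C_AbsRing) (V := C_NormedModule) f z <-> Cdiff f z.
Proof.
split.
- intros [l [_ Hl]]. apply (Cdiff_slope f z l). intros eps He.
  assert (Hz := Hl z (fun P H => H) (mkposreal eps He)). simpl in Hz.
  apply (locally_C z). revert Hz. apply filter_imp. intros w Hw.
  change (Cmod (f w - f z - (w - z) * l)%C <= eps * Cmod (w - z)%C) in Hw.
  now replace (f w - f z - l * (w - z))%C with (f w - f z - (w - z) * l)%C by ring.
- intros [phi [E Hphi]]. exists (phi z). split.
  + apply is_linear_scal_l.
  + intros x Hx. apply (is_filter_lim_locally_unique (V := AbsRing_NormedModule C_AbsRing)) in Hx.
    subst x. intros eps.
    apply (tendsE _ phi (phi z)) with (eps := pos eps) in Hphi; [|apply cond_pos].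
    apply (locally_C z) in Hphi.
    revert Hphi. apply filter_imp. intros w Hw.
    change (Cmod (f w - f z - (w - z) * phi z)%C <= eps * Cmod (w - z)%C).
    replace (f w - f z - (w - z) * phi z)%C with ((phi w - phi z) * (w - z))%C
      by (rewrite (E w); ring).
    rewrite Cmod_mult. apply Rmult_le_compat_r; [apply Cmod_ge_0|lra].
Qed.

Lemma Cdiff_slope_ex (f : C -> C) (z : C) : Cdiff f z ->
  exists l, forall eps, 0 < eps ->
    locC z (fun w => Cmod (f w - f z - l * (w - z))%C <= eps * Cmod (w - z)%C).
Proof.
intros [phi [E Hphi]]. exists (phi z). intros eps He.
apply (tendsE _ phi (phi z)) with (eps := eps) in Hphi; [|easy].
revert Hphi. apply filter_imp. intros w Hw.
replace (f w - f z - phi z * (w - z))%C with ((phi w - phi z) * (w - z))%C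
  by (rewrite (E w); ring).
rewrite Cmod_mult. apply Rmult_le_compat_r; [apply Cmod_ge_0|lra].
Qed.

Lemma tends_id (z : C) : tends (fun w => w) (locC z) z.
Proof. apply filterlim_id. Qed.

Lemma Cdiff_cont (f : C -> C) (z : C) : Cdiff f z -> tends f (locC z) (f z).
Proof.
intros [phi [E Hphi]].
assert (H : tends (fun w => f z + phi w * (w - z))%C (locC z) (f z + phi z * (z - z))%C).
{ apply tends_plus; [apply locally_filter|apply tends_const; apply locally_filter|].
  apply tends_mult; [apply locally_filter|easy|].
  apply tends_minus;
    [apply locally_filter|apply tends_id|apply tends_const; apply locally_filter]. }
rewrite <- E in H. revert H. apply filterlim_ext. intros w. now rewrite <- E.
Qed.

Lemma Cdiff_const (c z : C) : Cdiff (fun _ => c) z.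
Proof.
exists (fun _ => 0%C). split; [intros w; ring|apply tends_const; apply locally_filter].
Qed.

Lemma Cdiff_id (z : C) : Cdiff (fun w => w) z.
Proof.
exists (fun _ => 1%C). split; [intros w; ring|apply tends_const; apply locally_filter].
Qed.

Lemma Cdiff_plus (f g : C -> C) (z : C) :
  Cdiff f z -> Cdiff g z -> Cdiff (fun w => f w + g w)%C z.
Proof.
intros [phi [Ef Hf]] [psi [Eg Hg]]. exists (fun w => phi w + psi w)%C. split.
- intros w. rewrite (Ef w), (Eg w). ring.
- apply tends_plus; [apply locally_filter|easy|easy].
Qed.

Lemma Cdiff_mult (f g : C -> C) (z : C) :
  Cdiff f z -> Cdiff g z -> Cdiff (fun w => f w * g w)%C z.
Proof.
intros Hf' Hg'. destruct (Hf') as [phi [Ef Hf]], Hg' as [psi [Eg Hg]].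
exists (fun w => f w * psi w + phi w * g z)%C. split.
- intros w. rewrite (Ef w), (Eg w). ring.
- apply tends_plus; [apply locally_filter| |]; apply tends_mult;
    try apply locally_filter; try easy.
  + now apply Cdiff_cont.
  + apply tends_const. apply locally_filter.
Qed.

Lemma Cdiff_comp (f g : C -> C) (z : C) :
  Cdiff f z -> Cdiff g (f z) -> Cdiff (fun w => g (f w)) z.
Proof.
intros Hf' [psi [Eg Hg]]. destruct (Hf') as [phi [Ef Hf]].
exists (fun w => psi (f w) * phi w)%C. split.
- intros w. rewrite (Eg (f w)). rewrite (Ef w) at 2. ring.
- apply tends_mult; [apply locally_filter| |easy].
  apply (filterlim_comp _ _ _ f psi _ (locC (f z))); [now apply Cdiff_cont|easy].
Qed.

Lemma Cdiff_ext_loc (f g : C -> C) (z : C) :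
  locC z (fun w => f w = g w) -> Cdiff f z -> Cdiff g z.
Proof.
intros Hfg Hf. destruct (Cdiff_slope_ex f z Hf) as [l Hl].
apply (Cdiff_slope g z l). intros eps He.
assert (Ez : f z = g z) by now apply locally_singleton in Hfg.
generalize (filter_and _ _ Hfg (Hl eps He)). apply filter_imp.
intros w [E H]. now rewrite <- E, <- Ez.
Qed.

Lemma Cdiff_ext (f g : C -> C) (z : C) :
  (forall w, f w = g w) -> Cdiff f z -> Cdiff g z.
Proof. intros H. apply Cdiff_ext_loc. now apply filter_forall. Qed.

Lemma Cdiff_opp (f : C -> C) (z : C) : Cdiff f z -> Cdiff (fun w => - f w)%C z.
Proof.
intros H. apply Cdiff_ext with (fun w => (- (1)) * f w)%C; [intros w; ring|].
apply Cdiff_mult; [apply Cdiff_const|easy].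
Qed.

Lemma Cdiff_minus (f g : C -> C) (z : C) :
  Cdiff f z -> Cdiff g z -> Cdiff (fun w => f w - g w)%C z.
Proof. intros Hf Hg. apply Cdiff_plus; [easy|now apply Cdiff_opp]. Qed.

Lemma Cdiff_conj (f : C -> C) (z : C) :
  Cdiff f (Cconj z) -> Cdiff (fun w => Cconj (f (Cconj w))) z.
Proof.
intros [phi [Ef Hf]]. exists (fun w => Cconj (phi (Cconj w))). split.
- intros w. rewrite (Ef (Cconj w)), Cplus_conj, Cmult_conj, Cminus_conj, !Cconj_conj.
  easy.
- apply tends_conj; [apply locally_filter|].
  apply (filterlim_comp _ _ _ Cconj phi _ (locC (Cconj z))); [|easy].
  apply tends_conj; [apply locally_filter|apply tends_id].
Qed.

Lemma slope_R (f : R -> R) (x l eps : R) : derivable_pt_lim f x l -> 0 < eps ->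
  exists d, 0 < d /\ forall h, Rabs h < d ->
    Rabs (f (x + h) - f x - l * h) <= eps * Rabs h.
Proof.
intros H He. destruct (H eps He) as [d Hd]. exists d. split; [apply cond_pos|].
intros h Hh. destruct (Req_dec h 0) as [->|Hn].
- rewrite Rplus_0_r, Rmult_0_r. replace (_ - _ - _) with 0 by ring.
  rewrite Rabs_R0. lra.
- replace (f (x + h) - f x - l * h) with (((f (x + h) - f x) / h - l) * h) by (field; easy).
  rewrite Rabs_mult. apply Rmult_le_compat_r; [apply Rabs_pos|].
  left. now apply Hd.
Qed.

(** The expansion at 0 is assembled from the real derivatives of exp, cos and sin; the functional
    equation carries it to every z. *)
Lemma Cdiff_Cexp (z : C) : Cdiff Cexp z.
Proof.
assert (H0 : Cdiff Cexp 0%C).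
{ apply (Cdiff_slope Cexp 0%C 1%C). intros eps He.
  (* With m = |w|, the remainder is a sum of five terms bounded by e m, 2 e m, e m, 4 e m and e m,
     and 9 / 16 < 1. *)
  set (e := Rmin 1 (eps / 16)).
  assert (He0 : 0 < e) by (apply Rmin_glb_lt; lra).
  assert (He1 : e <= 1) by apply Rmin_l.
  assert (He2 : e <= eps / 16) by apply Rmin_r.
  destruct (slope_R exp 0 _ e (derivable_pt_lim_exp 0) He0) as [d1 [Hd1 H1]].
  destruct (slope_R cos 0 _ e (derivable_pt_lim_cos 0) He0) as [d2 [Hd2 H2]].
  destruct (slope_R sin 0 _ e (derivable_pt_lim_sin 0) He0) as [d3 [Hd3 H3]].
  apply locally_CE. exists (Rmin e (Rmin d1 (Rmin d2 d3))). split.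
  { repeat apply Rmin_glb_lt; lra. }
  intros w Hw. replace (w - 0)%C with w in Hw |- * by ring.
  rewrite Cexp_0. destruct w as [x y].
  assert (Hx := abs_fst_le (x, y)). assert (Hy := abs_snd_le (x, y)).
  simpl in Hx, Hy. set (m := Cmod (x, y)) in *.
  assert (m < e) by (eapply Rlt_le_trans; [exact Hw|apply Rmin_l]).
  assert (Hw1 : m < Rmin d1 (Rmin d2 d3)) by (eapply Rlt_le_trans; [exact Hw|apply Rmin_r]).
  assert (m < d1) by (eapply Rlt_le_trans; [exact Hw1|apply Rmin_l]).
  assert (Hw2 : m < Rmin d2 d3) by (eapply Rlt_le_trans; [exact Hw1|apply Rmin_r]).
  assert (m < d2) by (eapply Rlt_le_trans; [exact Hw2|apply Rmin_l]).
  assert (m < d3) by (eapply Rlt_le_trans; [exact Hw2|apply Rmin_r]).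
  specialize (H1 x ltac:(lra)). specialize (H2 y ltac:(lra)). specialize (H3 y ltac:(lra)).
  rewrite Rplus_0_l, exp_0 in H1. rewrite Rplus_0_l, cos_0, sin_0 in H2.
  rewrite Rplus_0_l, sin_0, cos_0 in H3.
  replace (exp x - 1 - 1 * x) with (exp x - 1 - x) in H1 by ring.
  replace (cos y - 1 - - 0 * y) with (cos y - 1) in H2 by ring.
  replace (sin y - 0 - 1 * y) with (sin y - y) in H3 by ring.
  assert (Hm : 0 <= m) by apply Cmod_ge_0.
  assert (P1 := Rabs_pos x). assert (P2 := Rabs_pos y).
  assert (Hex : Rabs (exp x - 1) <= 2 * m).
  { replace (exp x - 1) with ((exp x - 1 - x) + x) by ring.
    eapply Rle_trans; [apply Rabs_triang|]. nra. }
  assert (Hsy : Rabs (sin y) <= 2 * m).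
  { replace (sin y) with ((sin y - y) + y) by ring.
    eapply Rle_trans; [apply Rabs_triang|]. nra. }
  eapply Rle_trans; [apply Cmod_le_abs|].
  unfold Cexp, Re, Im. simpl.
  replace (exp x * cos y + - (1) + - (1 * x - 0 * y))
    with ((exp x - 1 - x) + ((exp x - 1) * (cos y - 1) + (cos y - 1))) by ring.
  replace (exp x * sin y + - 0 + - (1 * y + 0 * x))
    with ((exp x - 1) * sin y + (sin y - y)) by ring.
  assert (A1 := Rabs_triang (exp x - 1 - x) ((exp x - 1) * (cos y - 1) + (cos y - 1))).
  assert (A2 := Rabs_triang ((exp x - 1) * (cos y - 1)) (cos y - 1)).
  assert (A3 := Rabs_triang ((exp x - 1) * sin y) (sin y - y)).
  rewrite Rabs_mult in A2, A3.
  assert (B1 : Rabs (exp x - 1) * Rabs (cos y - 1) <= 2 * (e * m)).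
  { apply Rmult_le_compat; try apply Rabs_pos; nra. }
  assert (B2 : Rabs (exp x - 1) * Rabs (sin y) <= (2 * e) * (2 * m)).
  { apply Rmult_le_compat; try apply Rabs_pos; lra. }
  assert (B3 : e * Rabs x <= e * m) by nra.
  assert (B4 : e * Rabs y <= e * m) by nra.
  assert (B5 : e * m <= eps / 16 * m) by nra.
  assert (0 <= eps * m) by nra.
  lra. }
apply Cdiff_ext with (fun w => Cexp z * Cexp (w - z))%C.
{ intros w. rewrite <- Cexp_plus. f_equal. ring. }
apply Cdiff_mult; [apply Cdiff_const|].
apply (Cdiff_comp (fun w => w - z)%C Cexp).
- apply Cdiff_minus; [apply Cdiff_id|apply Cdiff_const].
- now replace (z - z)%C with (RtoC 0) by ring.
Qed.

(** * Goursat's theorem *)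

Notation CInt := (@RInt C_R_CompleteNormedModule).
Notation is_CInt := (@is_RInt C_R_NormedModule).
Notation ex_CInt := (@ex_RInt C_R_NormedModule).

Lemma norm_C (z : C) : @norm R_AbsRing C_R_NormedModule z = Cmod z.
Proof.
change (sqrt (Rabs (fst z) ^ 2 + Rabs (snd z) ^ 2) = Cmod z).
now rewrite !pow2_abs.
Qed.

Lemma ex_CInt_cont (f : R -> C) (a b : R) :
  (forall x, Rmin a b <= x <= Rmax a b -> tends f (locally x) (f x)) -> ex_CInt f a b.
Proof. apply (@ex_RInt_continuous C_R_CompleteNormedModule). Qed.

Lemma CInt_correct (f : R -> C) (a b : R) : ex_CInt f a b -> is_CInt f a b (CInt f a b).
Proof. apply (@RInt_correct C_R_CompleteNormedModule). Qed.

Lemma is_CInt_unique (f : R -> C) (a b : R) (l : C) : is_CInt f a b l -> CInt f a b = l.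
Proof. apply (@is_RInt_unique C_R_CompleteNormedModule). Qed.

Lemma is_CInt_pair (f : R -> C) (a b : R) (l : C) :
  is_RInt (fun x => fst (f x)) a b (fst l) ->
  is_RInt (fun x => snd (f x)) a b (snd l) -> is_CInt f a b l.
Proof.
intros H1 H2. destruct l as [l1 l2].
exact (@is_RInt_fct_extend_pair R_NormedModule R_NormedModule f a b l1 l2 H1 H2).
Qed.

Lemma is_CInt_minus (f g : R -> C) (a b : R) (k l : C) :
  is_CInt f a b k -> is_CInt g a b l -> is_CInt (fun x => f x - g x)%C a b (k - l)%C.
Proof. apply (@is_RInt_minus C_R_NormedModule). Qed.

Lemma CInt_Chasles (f : R -> C) (a b c : R) : ex_CInt f a b -> ex_CInt f b c ->
  (CInt f a b + CInt f b c)%C = CInt f a c.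
Proof. apply (@RInt_Chasles C_R_CompleteNormedModule). Qed.

Lemma CInt_bound_const (f : R -> C) (a b M : R) (l : C) : a <= b ->
  (forall x, a <= x <= b -> Cmod (f x) <= M) -> is_CInt f a b l ->
  Cmod l <= M * (b - a).
Proof.
intros Hab HM Hl. rewrite <- norm_C.
apply (norm_RInt_le f (fun _ => M) a b l (M * (b - a)) Hab); [|easy|].
- intros x Hx. rewrite norm_C. now apply HM.
- rewrite Rmult_comm. apply (is_RInt_const (V := R_NormedModule) a b M).
Qed.

Lemma is_CInt_affine (A B : C) (a b : R) :
  is_CInt (fun x => A + x * B)%C a b
    ((b - a)%R * A + ((b * b - a * a) / 2)%R * B)%C.
Proof.
assert (H : forall p q : R,
  is_RInt (fun x => p + x * q) a b ((b - a) * p + (b * b - a * a) / 2 * q)).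
{ intros p q.
  replace ((b - a) * p + (b * b - a * a) / 2 * q)
    with (minus (b * p + b * b / 2 * q) (a * p + a * a / 2 * q))
    by (unfold minus, plus, opp; simpl; field).
  apply (is_RInt_derive (fun x => x * p + x * x / 2 * q)).
  - intros x _. auto_derive; [easy|field].
  - intros x _. apply (ex_derive_continuous (fun x => p + x * q)). auto_derive. easy. }
apply is_CInt_pair; simpl.
- replace (_ + _) with ((b - a) * fst A + (b * b - a * a) / 2 * fst B) by ring.
  eapply is_RInt_ext; [|apply H]. intros x _. simpl. ring.
- replace (_ + _) with ((b - a) * snd A + (b * b - a * a) / 2 * snd B) by ring.
  eapply is_RInt_ext; [|apply H]. intros x _. simpl. ring.
Qed.

Lemma nested_point (a L : nat -> R) :
  (forall n, 0 <= L n) -> (forall n, a n <= a (S n)) ->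
  (forall n, a (S n) + L (S n) <= a n + L n) ->
  exists x, forall n, a n <= x <= a n + L n.
Proof.
intros HL Ha Hb.
assert (Inc : forall n m, a n <= a (n + m)%nat).
{ intros n m. induction m as [|m IH]; [rewrite Nat.add_0_r; lra|].
  rewrite Nat.add_succ_r. eapply Rle_trans; [exact IH|apply Ha]. }
assert (Dec : forall n m, a (n + m)%nat + L (n + m)%nat <= a n + L n).
{ intros n m. induction m as [|m IH]; [rewrite Nat.add_0_r; lra|].
  rewrite Nat.add_succ_r. eapply Rle_trans; [apply Hb|exact IH]. }
assert (Cross : forall n m, a m <= a n + L n).
{ intros n m. apply Rle_trans with (a (n + m)%nat).
  - rewrite Nat.add_comm. apply Inc.
  - generalize (Dec n m) (HL (n + m)%nat). lra. }
destruct (completeness (fun x => exists n, x = a n)) as [x [Hx1 Hx2]].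
- exists (a 0%nat + L 0%nat). intros x [n ->]. apply Cross.
- exists (a 0%nat). now exists 0%nat.
- exists x. intros n. split.
  + apply Hx1. now exists n.
  + apply Hx2. intros y [m ->]. apply Cross.
Qed.

Definition hor (G : C -> C) (y a b : R) : C := CInt (fun x => G (x, y)) a b.
Definition ver (G : C -> C) (x c d : R) : C := CInt (fun y => G (x, y)) c d.

(** Counterclockwise contour integral of G dz; on the vertical sides dz = i dy. *)
Definition boundary_int (G : C -> C) (a b c d : R) : C :=
  (hor G c a b - hor G d a b + Ci * (ver G b c d - ver G a c d))%C.

Definition rect (a b c d : R) (z : C) : Prop := a <= fst z <= b /\ c <= snd z <= d.

Lemma tends_hor (G : C -> C) (x y : R) :
  tends G (locC (x, y)) (G (x, y)) -> tends (fun t => G (t, y)) (locally x) (G (x, y)).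
Proof.
intros H. eapply filterlim_comp; [|exact H].
apply tends_pair; [apply locally_filter|apply filterlim_id|apply filterlim_const].
Qed.

Lemma tends_ver (G : C -> C) (x y : R) :
  tends G (locC (x, y)) (G (x, y)) -> tends (fun t => G (x, t)) (locally y) (G (x, y)).
Proof.
intros H. eapply filterlim_comp; [|exact H].
apply tends_pair; [apply locally_filter|apply filterlim_const|apply filterlim_id].
Qed.

Lemma hor_correct (G : C -> C) (y a b : R) : a <= b ->
  (forall x, a <= x <= b -> tends G (locC (x, y)) (G (x, y))) ->
  is_CInt (fun x => G (x, y)) a b (hor G y a b).
Proof.
intros Hab H. apply CInt_correct, ex_CInt_cont. intros x Hx.
rewrite Rmin_left, Rmax_right in Hx by easy. now apply tends_hor, H.
Qed.

Lemma ver_correct (G : C -> C) (x c d : R) : c <= d ->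
  (forall y, c <= y <= d -> tends G (locC (x, y)) (G (x, y))) ->
  is_CInt (fun y => G (x, y)) c d (ver G x c d).
Proof.
intros Hab H. apply CInt_correct, ex_CInt_cont. intros y Hy.
rewrite Rmin_left, Rmax_right in Hy by easy. now apply tends_ver, H.
Qed.

(** The inner edges cancel, so one of the four quarters carries at least a fourth of the modulus.
    Sides written as 2 h and 2 k make the bisection exact. *)
Lemma boundary_int_quarter (G : C -> C) (a h c k : R) : 0 <= h -> 0 <= k ->
  (forall z, rect a (a + 2 * h) c (c + 2 * k) z -> tends G (locC z) (G z)) ->
  exists a' c', a <= a' <= a + h /\ c <= c' <= c + k /\
    Cmod (boundary_int G a (a + 2 * h) c (c + 2 * k)) <=
    4 * Cmod (boundary_int G a' (a' + h) c' (c' + k)).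
Proof.
intros Hh Hk HG.
assert (Hor : forall y, c <= y <= c + 2 * k ->
  (hor G y a (a + h) + hor G y (a + h) (a + h + h))%C = hor G y a (a + 2 * h)).
{ intros y Hy. replace (a + 2 * h) with (a + h + h) by ring.
  apply CInt_Chasles; eexists; apply hor_correct; try lra;
    intros x Hx; apply HG; split; simpl; lra. }
assert (Ver : forall x, a <= x <= a + 2 * h ->
  (ver G x c (c + k) + ver G x (c + k) (c + k + k))%C = ver G x c (c + 2 * k)).
{ intros y Hy. replace (c + 2 * k) with (c + k + k) by ring.
  apply CInt_Chasles; eexists; apply ver_correct; try lra;
    intros x Hx; apply HG; split; simpl; lra. }
set (J1 := boundary_int G a (a + h) c (c + k)).
set (J2 := boundary_int G (a + h) (a + h + h) c (c + k)).
set (J3 := boundary_int G a (a + h) (c + k) (c + k + k)).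
set (J4 := boundary_int G (a + h) (a + h + h) (c + k) (c + k + k)).
assert (E : boundary_int G a (a + 2 * h) c (c + 2 * k) = (J1 + J2 + (J3 + J4))%C).
{ unfold J1, J2, J3, J4, boundary_int. rewrite <- !Hor, <- !Ver by lra.
  replace (a + 2 * h) with (a + h + h) by ring.
  replace (c + 2 * k) with (c + k + k) by ring. ring. }
rewrite E.
assert (T1 := Cmod_triangle (J1 + J2) (J3 + J4)).
assert (T2 := Cmod_triangle J1 J2). assert (T3 := Cmod_triangle J3 J4).
set (M := Cmod (J1 + J2 + (J3 + J4))) in *.
destruct (Rle_lt_dec M (4 * Cmod J1)) as [H1|H1];
  [exists a, c; repeat split; try lra; easy|].
destruct (Rle_lt_dec M (4 * Cmod J2)) as [H2|H2];
  [exists (a + h), c; repeat split; try lra; easy|].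
destruct (Rle_lt_dec M (4 * Cmod J3)) as [H3|H3];
  [exists a, (c + k); repeat split; try lra; easy|].
exists (a + h), (c + k); repeat split; try lra. fold J4. lra.
Qed.

(** The one explicit computation behind Goursat's theorem, where the first-order expansion of G at
    the limit point is subtracted. *)
Lemma boundary_int_affine (A B : C) (a b c d : R) : a <= b -> c <= d ->
  boundary_int (fun z => A + B * z)%C a b c d = 0%C.
Proof.
intros Hab Hcd.
assert (Hor : forall y, hor (fun z => A + B * z)%C y a b =
  ((b - a)%R * (A + B * (Ci * y)) + ((b * b - a * a) / 2)%R * B)%C).
{ intros y. apply is_CInt_unique. eapply is_RInt_ext; [|apply is_CInt_affine].
  intros x _. apply injective_projections; simpl; ring. }
assert (Ver : forall x, ver (fun z => A + B * z)%C x c d =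
  ((d - c)%R * (A + B * x) + ((d * d - c * c) / 2)%R * (B * Ci))%C).
{ intros x. apply is_CInt_unique. eapply is_RInt_ext; [|apply is_CInt_affine].
  intros y _. apply injective_projections; simpl; ring. }
unfold boundary_int. rewrite !Hor, !Ver.
apply injective_projections; simpl; field.
Qed.

Lemma boundary_int_bound (G : C -> C) (a b c d M : R) : a <= b -> c <= d ->
  (forall z, rect a b c d z -> tends G (locC z) (G z) /\ Cmod (G z) <= M) ->
  Cmod (boundary_int G a b c d) <= 2 * M * ((b - a) + (d - c)).
Proof.
intros Hab Hcd H.
assert (Hor : forall y, c <= y <= d -> Cmod (hor G y a b) <= M * (b - a)).
{ intros y Hy. eapply CInt_bound_const; [easy| |apply hor_correct; [easy|]];
    intros x Hx; apply H; split; simpl; lra. }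
assert (Ver : forall x, a <= x <= b -> Cmod (ver G x c d) <= M * (d - c)).
{ intros x Hx. eapply CInt_bound_const; [easy| |apply ver_correct; [easy|]];
    intros y Hy; apply H; split; simpl; lra. }
unfold boundary_int.
assert (T1 := Cmod_triangle (hor G c a b - hor G d a b) (Ci * (ver G b c d - ver G a c d))).
assert (T2 := Cmod_triangle (hor G c a b) (- hor G d a b)).
assert (T3 := Cmod_triangle (ver G b c d) (- ver G a c d)).
rewrite Cmod_opp in T2, T3. rewrite Cmod_mult, Cmod_Ci, Rmult_1_l in T1.
generalize (Hor c ltac:(lra)) (Hor d ltac:(lra)) (Ver a ltac:(lra)) (Ver b ltac:(lra)).
unfold Cminus in *. lra.
Qed.

Lemma boundary_int_minus (F G : C -> C) (a b c d : R) : a <= b -> c <= d ->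
  (forall z, rect a b c d z -> tends F (locC z) (F z) /\ tends G (locC z) (G z)) ->
  boundary_int (fun z => F z - G z)%C a b c d =
  (boundary_int F a b c d - boundary_int G a b c d)%C.
Proof.
intros Hab Hcd H.
assert (Hor : forall y, c <= y <= d ->
  hor (fun z => F z - G z)%C y a b = (hor F y a b - hor G y a b)%C).
{ intros y Hy. apply is_CInt_unique, is_CInt_minus; apply hor_correct; try easy;
    intros x Hx; apply H; split; simpl; lra. }
assert (Ver : forall x, a <= x <= b ->
  ver (fun z => F z - G z)%C x c d = (ver F x c d - ver G x c d)%C).
{ intros y Hy. apply is_CInt_unique, is_CInt_minus; apply ver_correct; try easy;
    intros x Hx; apply H; split; simpl; lra. }
unfold boundary_int. rewrite !Hor, !Ver by lra. ring.
Qed.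

Lemma Cmod_rect_dist (a h c k : R) (z w : C) :
  rect a (a + h) c (c + k) z -> rect a (a + h) c (c + k) w -> Cmod (w - z) <= h + k.
Proof.
intros [H1 H2] [H3 H4]. eapply Rle_trans; [apply Cmod_le_abs|].
apply Rplus_le_compat; simpl; apply Rabs_le; lra.
Qed.

Theorem goursat_rectangle (G : C -> C) (a b c d : R) : a <= b -> c <= d ->
  (forall z, rect a b c d z -> Cdiff G z) -> boundary_int G a b c d = 0%C.
Proof.
intros Hab Hcd HG. set (h := b - a). set (k := d - c).
set (hn := fun n : nat => h / 2 ^ n). set (kn := fun n : nat => k / 2 ^ n).
assert (P2 : forall n : nat, 0 < 2 ^ n) by (intros n; apply pow_lt; lra).
assert (Hhn : forall n, 0 <= hn n).
{ intros n. apply Rmult_le_pos; [unfold h; lra|]. left. now apply Rinv_0_lt_compat. }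
assert (Hkn : forall n, 0 <= kn n).
{ intros n. apply Rmult_le_pos; [unfold k; lra|]. left. now apply Rinv_0_lt_compat. }
assert (Hh2 : forall n, hn n = 2 * hn (S n)).
{ intros n. unfold hn. simpl. field. apply Rgt_not_eq, P2. }
assert (Hk2 : forall n, kn n = 2 * kn (S n)).
{ intros n. unfold kn. simpl. field. apply Rgt_not_eq, P2. }
set (J := fun (n : nat) (p : R * R) =>
  Cmod (boundary_int G (fst p) (fst p + hn n) (snd p) (snd p + kn n))).
set (inside := fun (n : nat) (p : R * R) =>
  a <= fst p /\ fst p + hn n <= b /\ c <= snd p /\ snd p + kn n <= d).
set (next := fun (n : nat) (p q : R * R) =>
  fst p <= fst q <= fst p + hn (S n) /\ snd p <= snd q <= snd p + kn (S n) /\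
  J n p <= 4 * J (S n) q).
assert (Step : forall n p, inside n p -> exists q, next n p q).
{ intros n p [I1 [I2 [I3 I4]]].
  destruct (boundary_int_quarter G (fst p) (hn (S n)) (snd p) (kn (S n)))
    as [a' [c' H]]; [easy|easy| |].
  - intros z [Z1 Z2]. rewrite <- Hh2 in Z1. rewrite <- Hk2 in Z2.
    apply Cdiff_cont, HG. split; lra.
  - rewrite <- Hh2, <- Hk2 in H. exists (a', c'). exact H. }
(* [epsilon] makes the choice of a quarter total; that the choice satisfies [next] is proved by
   induction together with [inside]. *)
set (st := fix st (n : nat) : R * R := match n with
  | O => (a, c)
  | S m => epsilon (inhabits (a, c)) (next m (st m))
  end).
assert (Hst : forall n, inside n (st n) /\ next n (st n) (st (S n))).
{ assert (Hin : forall n, inside n (st n)).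
  { induction n as [|n IH].
    - unfold inside, hn, kn, h, k. simpl. lra.
    - destruct (epsilon_spec (inhabits (a, c)) _ (Step n _ IH)) as [H1 [H2 _]].
      fold (st (S n)) in H1, H2. destruct IH as [I1 [I2 [I3 I4]]].
      rewrite Hh2 in I2. rewrite Hk2 in I4. unfold inside.
      change (epsilon (inhabits (a, c)) (next n (st n))) with (st (S n)) in *. lra. }
  intros n. split; [easy|].
  exact (epsilon_spec (inhabits (a, c)) _ (Step n _ (Hin n))). }
destruct (nested_point (fun n => fst (st n)) hn) as [x Hx]; [easy| | |].
{ intros n. apply Hst. }
{ intros n. destruct (Hst n) as [_ [H _]]. rewrite (Hh2 n). lra. }
destruct (nested_point (fun n => snd (st n)) kn) as [y Hy]; [easy| | |].
{ intros n. apply Hst. }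
{ intros n. destruct (Hst n) as [_ [_ [H _]]]. rewrite (Hk2 n). lra. }
set (z := (x, y)).
assert (Hz : Cdiff G z).
{ apply HG. generalize (Hx 0%nat) (Hy 0%nat). destruct (Hst 0%nat) as [[I1 [I2 [I3 I4]]] _].
  unfold rect, z. simpl fst at 4. simpl snd at 4. simpl. simpl in I1, I2, I3, I4. lra. }
assert (HJ : forall n, J 0%nat (a, c) <= 4 ^ n * J n (st n)).
{ induction n as [|n IH]; [simpl; lra|].
  destruct (Hst n) as [_ [_ [_ H]]]. eapply Rle_trans; [exact IH|].
  replace (4 ^ S n * J (S n) (st (S n))) with (4 ^ n * (4 * J (S n) (st (S n)))) by (simpl; ring).
  apply Rmult_le_compat_l; [apply pow_le; lra|exact H]. }
(* The factor 4^n is offset by the perimeter and the diameter, both proportional to 2^(-n); eps from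
   the expansion at z is all that remains. *)
assert (Small : forall eps, 0 < eps -> J 0%nat (a, c) <= 2 * eps * ((h + k) * (h + k))).
{ intros eps He. destruct (Cdiff_slope_ex G z Hz) as [l Hl].
  specialize (Hl eps He). apply locally_CE in Hl. destruct Hl as [dl [Hdl Hl]].
  assert (Hn : exists n : nat, (h + k) / 2 ^ n < dl).
  { destruct (pow_lt_1_zero (/ 2)) with (y := dl / (h + k + 1)) as [n Hn].
    - rewrite Rabs_pos_eq; lra.
    - apply Rdiv_lt_0_compat; unfold h, k; lra.
    - exists n. specialize (Hn n (le_n n)). rewrite pow_inv, Rabs_pos_eq in Hn.
      2: left; now apply Rinv_0_lt_compat.
      assert (Hhk : 0 <= h + k) by (unfold h, k; lra).
      apply Rle_lt_trans with ((h + k + 1) * / 2 ^ n).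
      + apply Rmult_le_compat_r; [left; now apply Rinv_0_lt_compat|lra].
      + apply Rmult_lt_compat_l with (r := h + k + 1) in Hn; [|lra].
        replace ((h + k + 1) * (dl / (h + k + 1))) with dl in Hn by (field; lra). exact Hn. }
  destruct Hn as [n Hn].
  assert (Hs : hn n + kn n = (h + k) / 2 ^ n) by (unfold hn, kn; field; apply Rgt_not_eq, P2).
  assert (Hin : rect (fst (st n)) (fst (st n) + hn n) (snd (st n)) (snd (st n) + kn n) z).
  { split; [apply Hx|apply Hy]. }
  assert (Cont : forall w,
    rect (fst (st n)) (fst (st n) + hn n) (snd (st n)) (snd (st n) + kn n) w ->
    tends G (locC w) (G w)).
  { intros w [W1 W2]. apply Cdiff_cont, HG.
    destruct (Hst n) as [[I1 [I2 [I3 I4]]] _]. split; lra. }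
  (* A + l w is the first-order expansion of G at z; on the n-th rectangle it differs from G by at
     most eps |w - z|. *)
  set (A := (G z - l * z)%C).
  assert (ContA : forall w, tends (fun w => A + l * w)%C (locC w) (A + l * w)%C).
  { intros w. apply (Cdiff_cont (fun w => A + l * w)%C).
    apply Cdiff_plus; [apply Cdiff_const|].
    apply Cdiff_mult; [apply Cdiff_const|apply Cdiff_id]. }
  assert (B : J n (st n) <= 2 * (eps * (hn n + kn n)) * (hn n + kn n)).
  { unfold J.
    replace (boundary_int G (fst (st n)) (fst (st n) + hn n) (snd (st n)) (snd (st n) + kn n))
      with (boundary_int (fun w => G w - (A + l * w))%C
             (fst (st n)) (fst (st n) + hn n) (snd (st n)) (snd (st n) + kn n)).
    2:{ generalize (Hhn n) (Hkn n). intros.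
        rewrite boundary_int_minus, boundary_int_affine; try lra; [ring|].
        intros w Hw. split; [now apply Cont|apply ContA]. }
    replace (hn n + kn n) with ((fst (st n) + hn n - fst (st n)) + (snd (st n) + kn n - snd (st n)))
      at 2 by ring.
    generalize (Hhn n) (Hkn n). intros.
    apply boundary_int_bound; try lra. intros w Hw. split.
    - apply tends_minus; [apply locally_filter|now apply Cont|apply ContA].
    - assert (D := Cmod_rect_dist _ _ _ _ _ _ Hin Hw).
      replace (G w - (A + l * w))%C with (G w - G z - l * (w - z))%C by (unfold A; ring).
      eapply Rle_trans; [apply Hl; lra|]. apply Rmult_le_compat_l; lra. }
  rewrite Hs in B. eapply Rle_trans; [apply (HJ n)|].
  replace (2 * eps * ((h + k) * (h + k)))
    with (4 ^ n * (2 * (eps * ((h + k) / 2 ^ n)) * ((h + k) / 2 ^ n))).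
  - apply Rmult_le_compat_l; [apply pow_le; lra|exact B].
  - replace (4 ^ n) with (2 ^ n * 2 ^ n) by (rewrite <- Rpow_mult_distr; f_equal; lra).
    field. apply Rgt_not_eq, P2. }
assert (E : J 0%nat (a, c) = Cmod (boundary_int G a b c d)).
{ unfold J, hn, kn, h, k. simpl. do 2 f_equal; field. }
rewrite E in Small. apply Cmod_eq_0. apply Rle_antisym; [|apply Cmod_ge_0].
apply Rnot_lt_le. intros Hpos.
set (Q := (h + k) * (h + k)) in *.
assert (HQ : 0 <= Q) by apply Rle_0_sqr.
(* With X the modulus of the integral, this eps yields 4 (Q + 1) X <= 2 Q X, impossible for X >
   0. *)
specialize (Small (Cmod (boundary_int G a b c d) / (4 * (Q + 1))) ltac:(apply Rdiv_lt_0_compat; lra)).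
set (X := Cmod (boundary_int G a b c d)) in *.
apply Rmult_le_compat_r with (r := 4 * (Q + 1)) in Small; [|lra].
replace (2 * (X / (4 * (Q + 1))) * Q * (4 * (Q + 1))) with (2 * X * Q) in Small by (field; lra).
assert (0 <= X * Q) by (apply Rmult_le_pos; lra). lra.
Qed.

(** * The identity theorem on a disc *)

(** Both pieces of the integral being nonnegative, the one from t - r to v vanishes for v near t,
    and its derivative at t is h t. *)
Lemma RInt_zero_point (h : R -> R) (t r : R) : 0 < r ->
  (forall x, continuous h x) -> (forall x, 0 <= h x) ->
  RInt h (t - r) (t + r) = 0 -> h t = 0.
Proof.
intros Hr Hc Hp HI.
assert (Ex : forall u v, ex_RInt h u v).
{ intros u v. apply (@ex_RInt_continuous R_CompleteNormedModule). intros x _. apply Hc. }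
assert (Hz : locally t (fun v => RInt h (t - r) v = 0)).
{ exists (mkposreal r Hr). intros v Hv.
  change (Rabs (v - t) < r) in Hv. apply Rabs_def2 in Hv.
  assert (E := RInt_Chasles h (t - r) v (t + r) (Ex _ _) (Ex _ _)).
  change (RInt h (t - r) v + RInt h v (t + r) = RInt h (t - r) (t + r)) in E.
  assert (0 <= RInt h (t - r) v) by (apply RInt_ge_0; [lra|apply Ex|easy]).
  assert (0 <= RInt h v (t + r)) by (apply RInt_ge_0; [lra|apply Ex|easy]).
  lra. }
assert (D := is_derive_RInt h (RInt h (t - r)) (t - r) t
  ltac:(apply filter_forall; intros v; apply (@RInt_correct R_CompleteNormedModule), Ex) (Hc t)).
assert (D0 : is_derive (fun _ : R => 0) t (h t)).
{ eapply is_derive_ext_loc; [|exact D]. exact Hz. }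
apply is_derive_unique in D0. now rewrite Derive_const in D0.
Qed.

(* The correlation [B x y] of [g] along the vertical lines of abscissae x and y
   is the integral of a holomorphic function of abscissa x once x + y is fixed,
   so that it depends on x + y only. *)
Lemma periodic_halfplane_zero (g : C -> C) (a b : R) :
  (forall z, fst z < b -> Cdiff g z) ->
  (forall x y, g (x, y + 2 * PI) = g (x, y)) ->
  (forall z, fst z < a -> g z = 0%C) ->
  forall z, fst z < (a + b) / 2 -> g z = 0%C.
Proof.
intros Hg Hper Hz [x y] Hx. simpl in Hx.
destruct (Rlt_le_dec x a) as [Hxa|Hxa]; [now apply Hz|].
(* The double conjugation makes H holomorphic, and H (u, v) is g (u, v) times the conjugate of g (2
   x - u, v), so the two abscissae always add up to 2 x. The width s takes u to x + s < b, whose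
   mirror abscissa x - s < a lies where g vanishes. *)
set (s := (b - a) / 2). set (H := fun w => (g w * Cconj (g (Cconj ((2 * x)%R - w))))%C).
assert (HE : forall u v, H (u, v) = (g (u, v) * Cconj (g ((2 * x - u)%R, v)))%C).
{ intros u v. unfold H. do 3 f_equal. apply injective_projections; simpl; ring. }
assert (HH : forall w, x <= fst w <= x + s -> Cdiff H w).
{ intros w Hw. unfold s in Hw. apply Cdiff_mult; [apply Hg; lra|].
  apply (Cdiff_comp (fun w => (2 * x)%R - w)%C (fun w => Cconj (g (Cconj w)))).
  - apply Cdiff_minus; [apply Cdiff_const|apply Cdiff_id].
  - apply Cdiff_conj, Hg. simpl. lra. }
assert (G0 := goursat_rectangle H x (x + s) (y - PI) (y + PI)
  ltac:(unfold s; lra) ltac:(generalize PI_RGT_0; lra) (fun w Hw => HH w (proj1 Hw))).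
(* Periodicity cancels the horizontal sides and H is 0 on the right side, so the integral over the
   left side vanishes as well; there H is |g|^2. *)
assert (V0 : ver H x (y - PI) (y + PI) = 0%C).
{ assert (Eh : hor H (y - PI) x (x + s) = hor H (y + PI) x (x + s)).
  { unfold hor. f_equal. apply functional_extensionality. intros u.
    rewrite !HE. replace (y + PI) with (y - PI + 2 * PI) by ring. now rewrite !Hper. }
  assert (Ev : ver H (x + s) (y - PI) (y + PI) = 0%C).
  { apply is_CInt_unique. eapply is_RInt_ext.
    2:{ replace (RtoC 0) with (scal (V := C_R_NormedModule) (y + PI - (y - PI)) (RtoC 0)).
        - apply (is_RInt_const (V := C_R_NormedModule) _ _ (RtoC 0)).
        - apply (scal_zero_r (V := C_R_NormedModule)). }
    intros v _. rewrite HE, (Hz (2 * x - (x + s), v)); [|simpl; unfold s; lra].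
    apply injective_projections; simpl; ring. }
  unfold boundary_int in G0. rewrite Eh, Ev in G0.
  replace (_ + _)%C with ((- Ci) * ver H x (y - PI) (y + PI))%C in G0 by ring.
  assert (E : ver H x (y - PI) (y + PI) = (Ci * (- Ci * ver H x (y - PI) (y + PI)))%C).
  { apply injective_projections; simpl; ring. }
  rewrite E, G0. ring. }
set (h := fun v => Cmod (g (x, v)) * Cmod (g (x, v))).
assert (Eh : forall v, H (x, v) = RtoC (h v)).
{ intros v. rewrite HE. replace (2 * x - x) with x by ring.
  rewrite <- Cmod2_conj. unfold h. f_equal. ring. }
assert (Hc : forall v, tends (fun v => H (x, v)) (locally v) (H (x, v))).
{ intros v. apply tends_ver, Cdiff_cont, HH. simpl. unfold s. lra. }
assert (Hch : forall v, continuous h v).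
{ intros v. assert (E := tends_fst _ _ _ (Hc v)). rewrite Eh in E. change (fst (RtoC (h v))) with (h v) in E.
  revert E. apply filterlim_ext. intros u. now rewrite Eh. }
assert (H0 : h y = 0).
{ apply (RInt_zero_point h y PI PI_RGT_0 Hch).
  - intros v. unfold h. generalize (Cmod_ge_0 (g (x, v))). nra.
  - apply is_RInt_unique.
    assert (I : is_CInt (fun v => H (x, v)) (y - PI) (y + PI) (RtoC 0)).
    { rewrite <- V0. apply CInt_correct, ex_CInt_cont. intros v _. apply Hc. }
    apply (is_RInt_fct_extend_fst (U := R_NormedModule) (V := R_NormedModule)) in I.
    eapply is_RInt_ext; [|exact I]. intros v _. cbv beta. now rewrite Eh. }
apply Cmod_eq_0. unfold h in H0. apply Rmult_integral in H0. now destruct H0.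
Qed.

Lemma Cexp_polar (z : C) : z <> 0%C -> exists t, z = Cexp (ln (Cmod z), t).
Proof.
intros Hz. assert (Hm : 0 < Cmod z) by now apply Cmod_gt_0.
assert (E : fst z * fst z + snd z * snd z = Cmod z * Cmod z).
{ unfold Cmod. rewrite sqrt_sqrt; [ring|].
  apply Rplus_le_le_0_compat; apply pow2_ge_0. }
set (u := fst z / Cmod z). set (v := snd z / Cmod z).
assert (Euv : u * u + v * v = 1).
{ unfold u, v.
  replace (_ + _) with ((fst z * fst z + snd z * snd z) / (Cmod z * Cmod z)) by (field; lra).
  rewrite E. field. lra. }
assert (Hu : -1 <= u <= 1) by (split; nra).
assert (Hs : sqrt (1 - Rsqr u) = Rabs v).
{ replace (1 - Rsqr u) with (Rsqr v) by (unfold Rsqr; lra). apply sqrt_Rsqr_abs. }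
assert (Eu : fst z = Cmod z * u) by (unfold u; field; lra).
assert (Ev : snd z = Cmod z * v) by (unfold v; field; lra).
destruct (Rle_lt_dec 0 v) as [Hv|Hv].
- exists (acos u). unfold Cexp, Re, Im. simpl. rewrite exp_ln by easy.
  rewrite cos_acos, sin_acos, Hs, Rabs_pos_eq by easy.
  apply injective_projections; easy.
- exists (- acos u). unfold Cexp, Re, Im. simpl. rewrite exp_ln by easy.
  rewrite cos_neg, sin_neg, cos_acos, sin_acos, Hs, Rabs_left by easy.
  apply injective_projections; simpl; [easy|]. rewrite Ev. ring.
Qed.

(** In the coordinate ln |z - q| the half-plane lemma reaches the midpoint of ln e and ln R, that
    is, the geometric mean of e and R; comparing squares avoids a root. The centre q, which has no
    logarithm, is treated apart. *)
Lemma concentric_zero_step (f : C -> C) (q : C) (e R : R) : 0 < e -> e <= R ->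
  (forall z, Cmod (z - q) < R -> Cdiff f z) ->
  (forall z, Cmod (z - q) < e -> f z = 0%C) ->
  forall z, Cmod (z - q) * Cmod (z - q) < e * R -> f z = 0%C.
Proof.
intros He HeR Hf Hz z Hzq.
destruct (Ceq_dec z q) as [->|Hn].
{ apply Hz. replace (q - q)%C with (RtoC 0) by ring. now rewrite Cmod_0. }
assert (Hn' : (z - q)%C <> 0%C) by now apply Cminus_eq_contra.
assert (Hm : 0 < Cmod (z - q)) by now apply Cmod_gt_0.
destruct (Cexp_polar _ Hn') as [t Ht].
set (w := (ln (Cmod (z - q)), t)). fold w in Ht.
set (g := fun u => f (q + Cexp u)%C).
assert (Hd : forall u r, 0 < r -> fst u < ln r -> Cmod (q + Cexp u - q) < r).
{ intros u r Hr Hu. replace (q + Cexp u - q)%C with (Cexp u) by ring.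
  rewrite Cmod_Cexp. rewrite <- (exp_ln r) by easy. now apply exp_increasing. }
replace (f z) with (g w) by (unfold g; f_equal; rewrite <- Ht; ring).
apply (periodic_halfplane_zero g (ln e) (ln R)).
- intros u Hu. apply (Cdiff_comp (fun u => q + Cexp u)%C f).
  + apply Cdiff_plus; [apply Cdiff_const|apply Cdiff_Cexp].
  + apply Hf, Hd; lra.
- intros x y. unfold g, Cexp, Re, Im. simpl.
  rewrite cos_plus, sin_plus, cos_2PI, sin_2PI. do 2 f_equal.
  apply injective_projections; simpl; ring.
- intros u Hu. apply Hz, Hd; lra.
- unfold w. simpl. rewrite <- ln_mult by lra.
  assert (ln (Cmod (z - q) * Cmod (z - q)) < ln (e * R)) by (apply ln_increasing; nra).
  rewrite ln_mult in H by lra. lra.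
Qed.

(** Let m be the supremum of the radii up to which f vanishes. If m < R, the preceding step reaches
    sqrt (m R) > m. *)
Lemma concentric_zero (f : C -> C) (q : C) (e R : R) : 0 < e -> e <= R ->
  (forall z, Cmod (z - q) < R -> Cdiff f z) ->
  (forall z, Cmod (z - q) < e -> f z = 0%C) ->
  forall z, Cmod (z - q) < R -> f z = 0%C.
Proof.
intros He HeR Hf Hz.
set (E := fun r => r <= R /\ forall z, Cmod (z - q) < r -> f z = 0%C).
destruct (completeness E) as [m [Hm1 Hm2]].
{ exists R. now intros r [Hr _]. }
{ now exists e. }
assert (Hem : e <= m) by now apply Hm1.
assert (HmR : m <= R) by (apply Hm2; now intros r [Hr _]).
assert (Hzm : forall z, Cmod (z - q) < m -> f z = 0%C).
{ intros z Hzq. apply NNPP. intros Hn. apply (Rlt_not_le _ _ Hzq). apply Hm2.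
  intros r [_ Hr]. apply Rnot_lt_le. intros Hlt. now apply Hn, Hr. }
assert (m = R) as ->; [|exact Hzm].
apply Rle_antisym; [easy|]. apply Rnot_lt_le. intros Hlt.
assert (Hs : E (sqrt (m * R))).
{ split.
  - rewrite <- (sqrt_square R) at 2 by lra. apply sqrt_le_1_alt. nra.
  - intros z Hzq. apply (concentric_zero_step f q m R); try easy; [lra|].
    assert (0 <= m * R) by nra.
    rewrite <- (sqrt_sqrt (m * R)) by easy.
    apply Rmult_le_0_lt_compat; try apply Cmod_ge_0; easy. }
apply Hm1 in Hs. apply (Rle_not_lt _ _ Hs).
rewrite <- (sqrt_square m) at 1 by lra. apply sqrt_lt_1; nra.
Qed.

Lemma Cmod_dist_triangle (x y z : C) : Cmod (x - z) <= Cmod (x - y) + Cmod (y - z).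
Proof. replace (x - z)%C with ((x - y) + (y - z))%C by ring. apply Cmod_triangle. Qed.

(** A chain of discs of equal radius along the segment from q to any x carries the vanishing along;
    the concentric case enlarges it at each centre. *)
Lemma disc_identity (f : C -> C) (p q : C) (r e : R) : 0 < e -> Cmod (q - p) < r ->
  (forall z, Cmod (z - p) < r -> Cdiff f z) ->
  (forall z, Cmod (z - q) < e -> f z = 0%C) ->
  forall z, Cmod (z - p) < r -> f z = 0%C.
Proof.
intros He Hq Hf Hz x Hx.
(* The distance to the boundary circle is concave along the segment, so the smaller of its two end
   values serves for every centre. *)
set (R0 := Rmin (r - Cmod (q - p)) (r - Cmod (x - p))).
assert (HR0 : 0 < R0) by (apply Rmin_glb_lt; lra).
assert (HR1 : R0 <= r - Cmod (q - p)) by apply Rmin_l.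
assert (HR2 : R0 <= r - Cmod (x - p)) by apply Rmin_r.
set (c := fun t : R => (q + t * (x - q))%C).
assert (Hc : forall t, 0 <= t <= 1 -> forall z, Cmod (z - c t) < R0 -> Cmod (z - p) < r).
{ intros t Ht z Hzc.
  assert (T := Cmod_dist_triangle z (c t) p).
  assert (T2 : Cmod (c t - p) <= (1 - t) * Cmod (q - p) + t * Cmod (x - p)).
  { unfold c. replace (q + t * (x - q) - p)%C with ((1 - t)%R * (q - p) + t * (x - p))%C
      by (rewrite RtoC_minus; ring).
    eapply Rle_trans; [apply Cmod_triangle|].
    rewrite !Cmod_mult, !Cmod_R, !Rabs_pos_eq by lra. lra. }
  nra. }
(* With K + 1 steps consecutive centres are less than R0 / 2 apart, so the disc of radius R0 / 2 at
   the new centre lies in the previous disc of radius R0. *)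
destruct (INR_unbounded (2 * Cmod (x - q) / R0)) as [K HK].
assert (HKd : Cmod (x - q) < INR (S K) * (R0 / 2)).
{ assert (HK' : 2 * Cmod (x - q) / R0 < INR (S K)) by (rewrite S_INR; lra).
  apply Rmult_lt_compat_r with (r := R0 / 2) in HK'; [|lra].
  replace (2 * Cmod (x - q) / R0 * (R0 / 2)) with (Cmod (x - q)) in HK' by (field; lra).
  easy. }
assert (HS : 0 < INR (S K)) by (apply lt_0_INR; lia).
assert (Hi : forall i, (i <= S K)%nat ->
  forall z, Cmod (z - c (INR i / INR (S K))) < R0 -> f z = 0%C).
{ induction i as [|i IH]; intros Hi.
  - replace (c (INR 0 / INR (S K))) with q.
    2:{ unfold c. simpl INR at 1. replace (0 / INR (S K)) with 0 by (field; lra). ring. }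
    apply (concentric_zero f q (Rmin e R0) R0).
    + now apply Rmin_glb_lt.
    + apply Rmin_r.
    + intros z Hzq. apply Hf. apply (Hc 0); [lra|].
      replace (c 0) with q by (unfold c; ring). easy.
    + intros z Hzq. apply Hz. eapply Rlt_le_trans; [exact Hzq|apply Rmin_l].
  - assert (Ht : 0 <= INR (S i) / INR (S K) <= 1).
    { split; [apply Rmult_le_pos; [apply pos_INR|left; now apply Rinv_0_lt_compat]|].
      apply Rmult_le_reg_r with (INR (S K)); [easy|].
      unfold Rdiv. rewrite Rmult_assoc, Rinv_l, Rmult_1_r, Rmult_1_l by lra.
      now apply le_INR. }
    apply (concentric_zero f _ (R0 / 2) R0); [lra|lra| |].
    + intros z Hzq. apply Hf. now apply (Hc _ Ht).
    + intros z Hzq. apply (IH ltac:(lia)).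
      eapply Rle_lt_trans; [apply (Cmod_dist_triangle z (c (INR (S i) / INR (S K))))|].
      assert (Cmod (c (INR (S i) / INR (S K)) - c (INR i / INR (S K))) < R0 / 2); [|lra].
      unfold c.
      replace (_ - _)%C with ((INR (S i) / INR (S K) - INR i / INR (S K))%R * (x - q))%C
        by (rewrite RtoC_minus; ring).
      rewrite S_INR at 1.
      replace ((INR i + 1) / INR (S K) - INR i / INR (S K)) with (/ INR (S K)) by (field; lra).
      rewrite Cmod_mult, Cmod_R, Rabs_pos_eq by (left; now apply Rinv_0_lt_compat).
      apply Rmult_lt_reg_l with (INR (S K)); [easy|].
      rewrite <- Rmult_assoc, Rinv_r, Rmult_1_l by lra. easy. }
apply (Hi (S K) (le_n _)).
replace (INR (S K) / INR (S K)) with 1 by (field; lra).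
unfold c. replace (x - (q + 1%R * (x - q)))%C with (RtoC 0) by ring. now rewrite Cmod_0.
Qed.

(** * Meromorphic functions of several variables *)

Lemma polydisc_length (p q : list C) (r : R) : polydisc p r q -> length q = length p.
Proof. intros H. symmetry. eapply Forall2_length, H. Qed.

Lemma polydisc_center (p : list C) (r : R) : 0 < r -> polydisc p r p.
Proof.
intros Hr. induction p as [|z p IH]; constructor; [|exact IH].
replace (z - z)%C with (RtoC 0) by ring. now rewrite Cmod_0.
Qed.

Lemma polydisc_mono (p q : list C) (r r' : R) : r <= r' -> polydisc p r q -> polydisc p r' q.
Proof. intros Hr. apply Forall2_impl. intros; lra. Qed.

Lemma polydisc_open (p q : list C) (r : R) : polydisc p r q ->
  exists d, 0 < d /\ forall x, polydisc q d x -> polydisc p r x.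
Proof.
intros H. induction H as [|z w p q Hzw H [d [Hd IH]]].
- exists 1. split; [lra|]. intros x Hx. inversion Hx. constructor.
- exists (Rmin d (r - Cmod (w - z))). split; [apply Rmin_glb_lt; lra|].
  intros x Hx. inversion Hx; subst. constructor.
  + eapply Rle_lt_trans; [apply (Cmod_dist_triangle _ w)|].
    generalize (Rmin_r d (r - Cmod (w - z))). lra.
  + apply IH. eapply polydisc_mono; [apply Rmin_l|eassumption].
Qed.

(** [polydisc] forces equal lengths, so this is the neighbourhood filter of p inside its own C^n; as
    a [Filter] it inherits the limit lemmas stated for general filters. *)
Definition near_list (p : list C) (P : list C -> Prop) : Prop :=
  exists d, 0 < d /\ forall q, polydisc p d q -> P q.

Global Instance near_list_filter (p : list C) : Filter (near_list p).
Proof.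
constructor.
- exists 1. split; [lra|easy].
- intros P Q [d [Hd HP]] [d' [Hd' HQ]]. exists (Rmin d d').
  split; [now apply Rmin_glb_lt|]. intros q Hq. split.
  + apply HP. eapply polydisc_mono; [apply Rmin_l|exact Hq].
  + apply HQ. eapply polydisc_mono; [apply Rmin_r|exact Hq].
- intros P Q HPQ [d [Hd HP]]. exists d. split; [easy|]. intros q Hq. now apply HPQ, HP.
Qed.

Lemma near_list_polydisc (p q : list C) (r : R) : polydisc p r q ->
  near_list q (polydisc p r).
Proof. apply polydisc_open. Qed.

Lemma near_list_self (p : list C) (P : list C -> Prop) : near_list p P -> P p.
Proof. intros [d [Hd H]]. now apply H, polydisc_center. Qed.

Lemma near_list_near (p : list C) (P : list C -> Prop) :
  near_list p P -> near_list p (fun q => near_list q P).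
Proof.
intros [d [Hd H]]. exists d. split; [easy|]. intros q Hq.
generalize (near_list_polydisc _ _ _ Hq). apply filter_imp. exact H.
Qed.

Lemma near_list_ball (p : list C) (r : R) : 0 < r -> near_list p (polydisc p r).
Proof. intros Hr. now exists r. Qed.

Lemma holomorphic_onE (U : list C -> Prop) (F : list C -> C) :
  holomorphic_on U F <->
  forall p, U p -> tends F (near_list p) (F p) /\
    forall u z v, p = u ++ z :: v -> Cdiff (fun w => F (u ++ w :: v)) z.
Proof.
split; intros H p Hp; destruct (H p Hp) as [H1 H2]; split.
- apply tendsE; [apply near_list_filter|exact H1].
- intros u z v E. now apply ex_derive_Cdiff, H2.
- intros eps He. apply (proj1 (tendsE _ F (F p)) H1 eps He).
- intros u z v E. now apply ex_derive_Cdiff, H2.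
Qed.

Lemma holomorphic_on_sub (U V : list C -> Prop) (F : list C -> C) :
  (forall p, V p -> U p) -> holomorphic_on U F -> holomorphic_on V F.
Proof. intros HUV H p Hp. now apply H, HUV. Qed.

Lemma holomorphic_on_mult (U : list C -> Prop) (F G : list C -> C) :
  holomorphic_on U F -> holomorphic_on U G -> holomorphic_on U (fun p => F p * G p)%C.
Proof.
rewrite !holomorphic_onE. intros HF HG p Hp.
destruct (HF p Hp) as [F1 F2], (HG p Hp) as [G1 G2]. split.
- now apply tends_mult; [apply near_list_filter| |].
- intros u z v E. apply Cdiff_mult; [now apply F2|now apply G2].
Qed.

Lemma holomorphic_on_plus (U : list C -> Prop) (F G : list C -> C) :
  holomorphic_on U F -> holomorphic_on U G -> holomorphic_on U (fun p => F p + G p)%C.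
Proof.
rewrite !holomorphic_onE. intros HF HG p Hp.
destruct (HF p Hp) as [F1 F2], (HG p Hp) as [G1 G2]. split.
- now apply tends_plus; [apply near_list_filter| |].
- intros u z v E. apply Cdiff_plus; [now apply F2|now apply G2].
Qed.

Lemma holomorphic_on_const (U : list C -> Prop) (c : C) : holomorphic_on U (fun _ => c).
Proof.
apply holomorphic_onE. intros p _. split.
- apply tends_const, near_list_filter.
- intros u z v _. apply Cdiff_const.
Qed.

Lemma holomorphic_on_minus (U : list C -> Prop) (F G : list C -> C) :
  holomorphic_on U F -> holomorphic_on U G -> holomorphic_on U (fun p => F p - G p)%C.
Proof.
intros HF HG.
replace (fun p => F p - G p)%C with (fun p => F p + (- (1)) * G p)%C
  by (apply functional_extensionality; intros p; ring).
apply holomorphic_on_plus; [easy|].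
apply holomorphic_on_mult; [apply holomorphic_on_const|easy].
Qed.

(** The variables are freed one at a time. For tails near that of q, the disc case in the first
    variable extends the vanishing to first coordinate x0; with x0 frozen, induction treats the
    rest. [HD] records separate differentiability because it passes to slices. *)
Lemma polydisc_identity (F : list C -> C) (p q : list C) (r e : R) :
  holomorphic_on (polydisc p r) F -> polydisc p r q -> 0 < e ->
  (forall x, polydisc q e x -> polydisc p r x -> F x = 0%C) ->
  forall x, polydisc p r x -> F x = 0%C.
Proof.
intros HF. rewrite holomorphic_onE in HF.
assert (HD : forall u z v, polydisc p r (u ++ z :: v) -> Cdiff (fun w => F (u ++ w :: v)) z).
{ intros u z v H. now apply (HF _ H). }
clear HF. revert F q HD. induction p as [|z0 p IH]; intros F q HD Hq He HZ x Hx.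
- inversion Hx; subst. inversion Hq; subst. apply HZ; constructor.
- inversion Hx as [|? x0 ? x' Hx0 Hx']; subst.
  inversion Hq as [|? q0 ? q' Hq0 Hq']; subst.
  apply (IH (fun v => F (x0 :: v)) q'); try easy.
  + intros u z v H. apply (HD (x0 :: u) z v). now constructor.
  + intros v Hv1 Hv2.
    apply (disc_identity (fun w => F (w :: v)) z0 q0 r (Rmin e (r - Cmod (q0 - z0))));
      try easy.
    * apply Rmin_glb_lt; lra.
    * intros w Hw. apply (HD [] w v). now constructor.
    * intros w Hw. apply HZ; constructor; try easy.
      -- eapply Rlt_le_trans; [exact Hw|apply Rmin_l].
      -- eapply Rle_lt_trans; [apply (Cmod_dist_triangle _ q0)|].
         generalize (Rmin_r e (r - Cmod (q0 - z0))). lra.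
Qed.

(** Were h zero on the neighbourhood P of q, it would vanish on the whole polydisc. P is a predicate
    so that open conditions on the witness can be added freely. *)
Lemma holomorphic_nonzero_dense (h : list C -> C) (p q : list C) (r : R)
  (P : list C -> Prop) :
  holomorphic_on (polydisc p r) h -> (exists x, polydisc p r x /\ h x <> 0%C) ->
  polydisc p r q -> near_list q P -> exists x, polydisc p r x /\ P x /\ h x <> 0%C.
Proof.
intros Hh [x [Hx Hx0]] Hq [e [He HP]]. apply NNPP. intros Hn. apply Hx0.
apply (polydisc_identity h p q r e Hh Hq He); [|exact Hx].
intros y Hy1 Hy2. apply NNPP. intros Hy. apply Hn. exists y. auto.
Qed.

Lemma holomorphic_nonzero_open (h : list C -> C) (U : list C -> Prop) (q : list C) :
  holomorphic_on U h -> U q -> h q <> 0%C -> near_list q (fun x => h x <> 0%C).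
Proof.
intros Hh Hq Hn. rewrite holomorphic_onE in Hh. destruct (Hh q Hq) as [H _].
assert (Hm : 0 < Cmod (h q)) by now apply Cmod_gt_0.
generalize (proj1 (tendsE _ h (h q)) H _ Hm). apply filter_imp.
intros x Hx E. rewrite E in Hx.
replace (0 - h q)%C with (- h q)%C in Hx by ring. rewrite Cmod_opp in Hx. lra.
Qed.

(** Holomorphic functions on a polydisc form an integral domain: h2 is nonzero somewhere in the open
    set where h1 is. *)
Lemma holomorphic_mult_nonzero (h1 h2 : list C -> C) (p : list C) (r : R) :
  holomorphic_on (polydisc p r) h1 -> (exists x, polydisc p r x /\ h1 x <> 0%C) ->
  holomorphic_on (polydisc p r) h2 -> (exists x, polydisc p r x /\ h2 x <> 0%C) ->
  exists x, polydisc p r x /\ (h1 x * h2 x)%C <> 0%C.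
Proof.
intros H1 [x [Hx Hx1]] H2 E2.
destruct (holomorphic_nonzero_dense h2 p x r _ H2 E2 Hx
  (holomorphic_nonzero_open _ _ _ H1 Hx Hx1)) as [y [Hy [Hy1 Hy2]]].
exists y. split; [easy|now apply Cmult_neq_0].
Qed.

Lemma meromorphic_pair (n : nat) (F1 F2 : list C -> C) (p : list C) :
  meromorphic n F1 -> meromorphic n F2 -> length p = n ->
  exists r g1 h1 g2 h2, 0 < r /\
    holomorphic_on (polydisc p r) g1 /\ holomorphic_on (polydisc p r) h1 /\
    holomorphic_on (polydisc p r) g2 /\ holomorphic_on (polydisc p r) h2 /\
    (exists x, polydisc p r x /\ (h1 x * h2 x)%C <> 0%C) /\
    (forall q, polydisc p r q -> (h1 q * h2 q)%C <> 0%C ->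
       h1 q <> 0%C /\ h2 q <> 0%C /\ F1 q = (g1 q / h1 q)%C /\ F2 q = (g2 q / h2 q)%C).
Proof.
intros M1 M2 Hp.
destruct (M1 p Hp) as [r1 [g1 [h1 [Hr1 [Hg1 [Hh1 [E1 V1]]]]]]].
destruct (M2 p Hp) as [r2 [g2 [h2 [Hr2 [Hg2 [Hh2 [E2 V2]]]]]]].
set (r := Rmin r1 r2).
assert (Hr : 0 < r) by now apply Rmin_glb_lt.
assert (S1 : forall q, polydisc p r q -> polydisc p r1 q).
{ intros q. apply polydisc_mono, Rmin_l. }
assert (S2 : forall q, polydisc p r q -> polydisc p r2 q).
{ intros q. apply polydisc_mono, Rmin_r. }
(* The given point where h1 is nonzero may lie outside the smaller polydisc; density supplies one
   inside. The same is done for h2. *)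
destruct (holomorphic_nonzero_dense h1 p p r1 (polydisc p r) Hh1 E1) as [x1 [_ [Hx1 Hn1]]];
  [now apply polydisc_center|now apply near_list_ball|].
destruct (holomorphic_nonzero_dense h2 p p r2 (polydisc p r) Hh2 E2) as [x2 [_ [Hx2 Hn2]]];
  [now apply polydisc_center|now apply near_list_ball|].
exists r, g1, h1, g2, h2. split; [easy|].
split; [exact (holomorphic_on_sub _ _ _ S1 Hg1)|].
split; [exact (holomorphic_on_sub _ _ _ S1 Hh1)|].
split; [exact (holomorphic_on_sub _ _ _ S2 Hg2)|].
split; [exact (holomorphic_on_sub _ _ _ S2 Hh2)|]. split.
- apply (holomorphic_mult_nonzero h1 h2 p r).
  + exact (holomorphic_on_sub _ _ _ S1 Hh1).
  + now exists x1.
  + exact (holomorphic_on_sub _ _ _ S2 Hh2).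
  + now exists x2.
- intros q Hq Hn.
  assert (N1 : h1 q <> 0%C) by (intros E; apply Hn; rewrite E; ring).
  assert (N2 : h2 q <> 0%C) by (intros E; apply Hn; rewrite E; ring).
  repeat split; auto.
Qed.

Lemma meromorphic_plus (n : nat) (F1 F2 : list C -> C) :
  meromorphic n F1 -> meromorphic n F2 -> meromorphic n (fun s => F1 s + F2 s)%C.
Proof.
intros M1 M2 p Hp.
destruct (meromorphic_pair n F1 F2 p M1 M2 Hp)
  as [r [g1 [h1 [g2 [h2 [Hr [G1 [H1 [G2 [H2 [E V]]]]]]]]]]].
exists r, (fun q => g1 q * h2 q + g2 q * h1 q)%C, (fun q => h1 q * h2 q)%C.
split; [easy|]. split; [now apply holomorphic_on_plus; apply holomorphic_on_mult|].
split; [now apply holomorphic_on_mult|]. split; [easy|].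
intros q Hq Hn. destruct (V q Hq Hn) as [N1 [N2 [-> ->]]]. field. easy.
Qed.

Lemma meromorphic_mult (n : nat) (F1 F2 : list C -> C) :
  meromorphic n F1 -> meromorphic n F2 -> meromorphic n (fun s => F1 s * F2 s)%C.
Proof.
intros M1 M2 p Hp.
destruct (meromorphic_pair n F1 F2 p M1 M2 Hp)
  as [r [g1 [h1 [g2 [h2 [Hr [G1 [H1 [G2 [H2 [E V]]]]]]]]]]].
exists r, (fun q => g1 q * g2 q)%C, (fun q => h1 q * h2 q)%C.
split; [easy|]. split; [now apply holomorphic_on_mult|].
split; [now apply holomorphic_on_mult|]. split; [easy|].
intros q Hq Hn. destruct (V q Hq Hn) as [N1 [N2 [-> ->]]]. field. easy.
Qed.

Lemma meromorphic_ext (n : nat) (F G : list C -> C) :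
  (forall s, length s = n -> F s = G s) -> meromorphic n F -> meromorphic n G.
Proof.
intros E M p Hp. destruct (M p Hp) as [r [g [h [Hr [Hg [Hh [En V]]]]]]].
exists r, g, h. repeat (split; [easy|]). intros q Hq Hn. rewrite <- E; [now apply V|].
now rewrite (polydisc_length _ _ _ Hq).
Qed.

Lemma meromorphic_holo (n : nat) (F : list C -> C) :
  holomorphic_on (fun _ => True) F -> meromorphic n F.
Proof.
intros H p Hp. exists 1, F, (fun _ => RtoC 1). split; [lra|].
split; [now apply holomorphic_on_sub with (fun _ => True)|].
split; [apply holomorphic_on_const|]. split.
- exists p. split; [apply polydisc_center; lra|apply C1_nz].
- intros q _ _. field.
Qed.

Lemma meromorphic_const (n : nat) (c : C) : meromorphic n (fun _ => c).
Proof. apply meromorphic_holo, holomorphic_on_const. Qed.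

(* [T] is onto on each polydisc, and each coordinate of its argument affects at
   most one coordinate of its value: the latter spares Osgood's theorem when
   pulling back separate holomorphy. *)
Definition coordinate_map (n m : nat) (T : list C -> list C) : Prop :=
  (forall s, length s = n -> length (T s) = m) /\
  (forall p q r, length p = n -> polydisc p r q -> polydisc (T p) r (T q)) /\
  (forall p q r, length p = n -> 0 < r -> polydisc (T p) r q ->
     exists q', polydisc p r q' /\ T q' = q) /\
  (forall u z v, length (u ++ z :: v) = n ->
     (forall w, T (u ++ w :: v) = T (u ++ z :: v)) \/
     exists u' v' al, Cdiff al z /\ forall w, T (u ++ w :: v) = u' ++ al w :: v').

Lemma meromorphic_pullback (n m : nat) (T : list C -> list C) (F : list C -> C) :
  coordinate_map n m T -> meromorphic m F -> meromorphic n (fun s => F (T s)).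
Proof.
intros [HL [HP [HS HC]]] M p Hp. destruct (M (T p) (HL p Hp)) as [r [g [h [Hr [Hg [Hh [En V]]]]]]].
assert (Hol : forall g, holomorphic_on (polydisc (T p) r) g ->
  holomorphic_on (polydisc p r) (fun s => g (T s))).
{ clear g h Hg Hh En V. intros g Hg. rewrite holomorphic_onE in *. intros q Hq.
  assert (Hq' := HP _ _ _ Hp Hq). destruct (Hg _ Hq') as [G1 G2]. split.
  - intros P HP'. destruct (G1 P HP') as [d [Hd D]]. exists d. split; [easy|].
    intros y Hy. apply D. apply HP; [|easy]. now rewrite (polydisc_length _ _ _ Hq).
  - intros u z v ->. assert (Hl : length (u ++ z :: v) = n)
      by now rewrite (polydisc_length _ _ _ Hq).
    destruct (HC u z v Hl) as [Hw|[u' [v' [al [Ha Hw]]]]].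
    + apply Cdiff_ext with (fun _ => g (T (u ++ z :: v)));
        [intros w; f_equal; symmetry; apply Hw|apply Cdiff_const].
    + apply Cdiff_ext with (fun w => g (u' ++ al w :: v')); [intros w; now rewrite Hw|].
      apply (Cdiff_comp al (fun w => g (u' ++ w :: v'))); [easy|].
      apply G2. apply Hw. }
exists r, (fun s => g (T s)), (fun s => h (T s)).
split; [easy|]. split; [now apply Hol|]. split; [now apply Hol|]. split.
(* Surjectivity of T on the polydisc keeps the pulled-back denominator from vanishing
   identically. *)
- destruct En as [x [Hx Hn]]. destruct (HS p x r Hp Hr Hx) as [y [Hy E]].
  exists y. now rewrite E.
- intros q Hq Hn. apply V; [|easy]. now apply HP.
Qed.

Lemma Forall2_firstn {A B} (P : A -> B -> Prop) (j : nat) (l : list A) (m : list B) :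
  Forall2 P l m -> Forall2 P (firstn j l) (firstn j m).
Proof.
intros H. revert j. induction H; intros [|j]; simpl; constructor; auto.
Qed.

Lemma Forall2_skipn {A B} (P : A -> B -> Prop) (j : nat) (l : list A) (m : list B) :
  Forall2 P l m -> Forall2 P (skipn j l) (skipn j m).
Proof.
intros H. revert j. induction H; intros [|j]; simpl; auto.
Qed.

Lemma coordinate_firstn (n j : nat) : (j <= n)%nat -> coordinate_map n j (firstn j).
Proof.
intros Hj. split; [|split; [|split]].
- intros s <-. rewrite length_firstn. lia.
- intros p q r _. apply Forall2_firstn.
- intros p q r Hp Hr Hq. exists (q ++ skipn j p). split.
  + rewrite <- (firstn_skipn j p) at 1. apply Forall2_app; [easy|now apply polydisc_center].
  + apply polydisc_length in Hq. rewrite length_firstn in Hq.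
    rewrite firstn_app, firstn_all2 by lia.
    replace (j - length q)%nat with 0%nat by lia. simpl. apply app_nil_r.
- intros u z v _. destruct (Nat.le_gt_cases j (length u)) as [H|H].
  + left. intros w. rewrite !firstn_app. replace (j - length u)%nat with 0%nat by lia.
    easy.
  + right. exists u, (firstn (j - length u - 1) v), (fun w => w).
    split; [apply Cdiff_id|]. intros w. rewrite firstn_app, firstn_all2 by lia.
    f_equal. replace (j - length u)%nat with (S (j - length u - 1)) by lia. simpl.
    now rewrite Nat.sub_0_r.
Qed.

Lemma coordinate_skipn (n j : nat) : coordinate_map n (n - j) (skipn j).
Proof.
split; [|split; [|split]].
- intros s <-. apply length_skipn.
- intros p q r _. apply Forall2_skipn.
- intros p q r Hp Hr Hq. exists (firstn j p ++ q). split.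
  + rewrite <- (firstn_skipn j p) at 1. apply Forall2_app; [now apply polydisc_center|easy].
  + apply polydisc_length in Hq. rewrite length_skipn in Hq.
    rewrite skipn_app, length_firstn.
    destruct (Nat.le_gt_cases j (length p)) as [H|H].
    * rewrite skipn_all2 by (rewrite length_firstn; lia).
      replace (j - Nat.min j (length p))%nat with 0%nat by lia. easy.
    * destruct q; [|simpl in Hq; lia].
      rewrite skipn_all2 by (rewrite length_firstn; lia). now rewrite skipn_nil.
- intros u z v _. destruct (Nat.le_gt_cases j (length u)) as [H|H].
  + right. exists (skipn j u), v, (fun w => w).
    split; [apply Cdiff_id|]. intros w. rewrite skipn_app.
    now replace (j - length u)%nat with 0%nat by lia.
  + left. intros w. rewrite !skipn_app.
    now replace (j - length u)%nat with (S (j - length u - 1)) by lia.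
Qed.

Definition reflect (a s : list C) : list C :=
  rev (map (fun p => fst p - snd p)%C (combine a s)).

Lemma reflect_length (a s : list C) : length a = length s -> length (reflect a s) = length s.
Proof. intros H. unfold reflect. rewrite length_rev, length_map, length_combine. lia. Qed.

Lemma combine_app {A B} (l1 l2 : list A) (m1 m2 : list B) : length l1 = length m1 ->
  combine (l1 ++ l2) (m1 ++ m2) = combine l1 m1 ++ combine l2 m2.
Proof.
revert m1. induction l1 as [|x l1 IH]; intros [|y m1] H; try discriminate; [easy|].
simpl. f_equal. apply IH. simpl in H. lia.
Qed.

Lemma combine_rev {A B} (l : list A) (m : list B) : length l = length m ->
  combine (rev l) (rev m) = rev (combine l m).
Proof.
revert m. induction l as [|x l IH]; intros [|y m] H; try discriminate; [easy|].
simpl in *. rewrite combine_app by (rewrite !length_rev; lia). rewrite IH by lia. easy.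
Qed.

(** [reflect] also reverses the order, hence the inverse subtracts from [rev a]. *)
Lemma reflect_involutive (a s : list C) : length a = length s ->
  reflect (rev a) (reflect a s) = s.
Proof.
intros H. unfold reflect. rewrite combine_rev by (rewrite length_map, length_combine; lia).
rewrite map_rev, rev_involutive. revert s H.
induction a as [|x a IH]; intros [|z s] H; try discriminate; [easy|].
simpl in *. rewrite IH by lia. f_equal. ring.
Qed.

Lemma polydisc_reflect (a p q : list C) (r : R) : length a = length p ->
  polydisc p r q -> polydisc (reflect a p) r (reflect a q).
Proof.
intros Hl H. unfold reflect, polydisc. revert a Hl.
induction H as [|z w p q Hz H IH]; intros [|x a] Hl; try discriminate; [constructor|].
simpl in *. apply Forall2_app; [apply IH; lia|]. constructor; [|constructor].
simpl. replace (x - w - (x - z))%C with (- (w - z))%C by ring. now rewrite Cmod_opp.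
Qed.

Lemma coordinate_reflect (n : nat) (a : list C) : length a = n ->
  coordinate_map n n (reflect a).
Proof.
intros Ha. split; [|split; [|split]].
- intros s Hs. rewrite reflect_length; congruence.
- intros p q r Hp. apply polydisc_reflect. congruence.
- intros p q r Hp Hr Hq. exists (reflect (rev a) q).
  assert (Hlq := polydisc_length _ _ _ Hq). rewrite reflect_length in Hlq by congruence.
  split.
  + rewrite <- (reflect_involutive a p) by congruence. apply polydisc_reflect; [|easy].
    rewrite length_rev, reflect_length; congruence.
  + rewrite <- (rev_involutive a) at 1. apply reflect_involutive. rewrite length_rev.
    congruence.
- intros u z v Hl. right. rewrite length_app in Hl. simpl in Hl.
  assert (Ea := firstn_skipn (length u) a). set (a1 := firstn (length u) a) in *.
  destruct (skipn (length u) a) as [|x a2] eqn:E2.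
  { exfalso. assert (L := length_skipn (length u) a). rewrite E2 in L. simpl in L. lia. }
  exists (reflect a2 v), (reflect a1 u), (fun w => x - w)%C. split.
  + apply Cdiff_minus; [apply Cdiff_const|apply Cdiff_id].
  + intros w. rewrite <- Ea. unfold reflect.
    rewrite combine_app by (unfold a1; rewrite length_firstn; lia). simpl.
    rewrite map_app, rev_app_distr. simpl. now rewrite <- app_assoc.
Qed.

Lemma tends_Csum (p : list C) : tends Csum (near_list p) (Csum p).
Proof.
induction p as [|z p IH].
- apply tendsE; [apply near_list_filter|]. intros eps He. exists 1. split; [lra|].
  intros q Hq. inversion Hq. replace (Csum [] - Csum [])%C with (RtoC 0) by ring.
  now rewrite Cmod_0.
- apply tendsE; [apply near_list_filter|]. intros eps He.
  destruct (proj1 (tendsE _ _ _) IH (eps / 2) ltac:(lra)) as [d [Hd D]].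
  exists (Rmin d (eps / 2)). split; [apply Rmin_glb_lt; lra|].
  intros q Hq. inversion Hq as [|? w ? q' Hw Hq']; subst. simpl.
  replace (w + Csum q' - (z + Csum p))%C with ((w - z) + (Csum q' - Csum p))%C by ring.
  eapply Rle_lt_trans; [apply Cmod_triangle|].
  assert (Cmod (Csum q' - Csum p) < eps / 2).
  { apply D. eapply polydisc_mono; [apply Rmin_l|exact Hq']. }
  generalize (Rmin_r d (eps / 2)). lra.
Qed.

Lemma Csum_app (u v : list C) : Csum (u ++ v) = (Csum u + Csum v)%C.
Proof. induction u as [|z u IH]; simpl; [ring|]. rewrite IH. ring. Qed.

Lemma meromorphic_Cexp_Csum (n : nat) (al be : C) :
  meromorphic n (fun s => Cexp (al + be * Csum s)).
Proof.
apply meromorphic_holo, holomorphic_onE. intros p _.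
assert (A : forall z, Cdiff (fun w => Cexp (al + be * w)) z).
{ intros z. apply (Cdiff_comp (fun w => al + be * w)%C Cexp); [|apply Cdiff_Cexp].
  apply Cdiff_plus; [apply Cdiff_const|].
  apply Cdiff_mult; [apply Cdiff_const|apply Cdiff_id]. }
split.
- apply (filterlim_comp _ _ _ Csum (fun w => Cexp (al + be * w)) _ (locC (Csum p))).
  + apply tends_Csum.
  + apply (Cdiff_cont (fun w => Cexp (al + be * w))), A.
- intros u z v _.
  apply Cdiff_ext with (fun w => Cexp (al + be * (Csum u + (w + Csum v)))).
  { intros w. now rewrite Csum_app. }
  apply (Cdiff_comp (fun w => Csum u + (w + Csum v))%C (fun w => Cexp (al + be * w)));
    [|apply A].
  apply Cdiff_plus; [apply Cdiff_const|].
  apply Cdiff_plus; [apply Cdiff_id|apply Cdiff_const].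
Qed.

(** * The identity theorem for meromorphic functions *)

(** The supremum m of the points where P holds has such points arbitrarily close, so P spreads to
    all points near m, which forces m = 1. *)
Lemma unit_interval_connected (P : R -> Prop) : P 0 ->
  (forall t, 0 <= t <= 1 -> exists d, 0 < d /\
     ((exists t', 0 <= t' <= 1 /\ Rabs (t' - t) < d /\ P t') ->
      forall t', 0 <= t' <= 1 -> Rabs (t' - t) < d -> P t')) ->
  P 1.
Proof.
intros P0 H.
destruct (completeness (fun t => 0 <= t <= 1 /\ P t)) as [m [Hm1 Hm2]].
{ exists 1. intros t [Ht _]. lra. }
{ exists 0. split; [lra|easy]. }
assert (Hm : 0 <= m <= 1).
{ split; [apply Hm1; split; [lra|easy]|apply Hm2; intros t [Ht _]; lra]. }
destruct (H m Hm) as [d [Hd D]].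
assert (Ex : exists t', 0 <= t' <= 1 /\ Rabs (t' - m) < d /\ P t').
{ apply NNPP. intros Hn. assert (m <= m - d); [|lra]. apply Hm2. intros t [Ht Pt].
  apply Rnot_lt_le. intros Hlt. apply Hn. exists t. split; [easy|]. split; [|easy].
  assert (t <= m) by (apply Hm1; easy). apply Rabs_def1; lra. }
specialize (D Ex).
destruct (Rlt_le_dec m 1) as [Hlt|Hge].
- exfalso. set (t := Rmin 1 (m + d / 2)).
  assert (t <= 1) by apply Rmin_l. assert (t <= m + d / 2) by apply Rmin_r.
  assert (m < t) by (apply Rmin_glb_lt; lra).
  assert (t <= m); [|lra]. apply Hm1. split; [lra|]. apply D; [lra|].
  apply Rabs_def1; lra.
- apply D; [lra|]. replace (1 - m) with 0 by lra. now rewrite Rabs_R0.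
Qed.

Definition segment (p q : list C) (t : R) : list C :=
  map (fun ab => fst ab + t * (snd ab - fst ab))%C (combine p q).

Lemma segment_length (p q : list C) (t : R) :
  length p = length q -> length (segment p q t) = length p.
Proof. intros H. unfold segment. rewrite length_map, length_combine. lia. Qed.

Lemma segment_0 (p q : list C) : length p = length q -> segment p q 0 = p.
Proof.
revert q. induction p as [|z p IH]; intros [|w q] H; try discriminate; [easy|].
unfold segment in *. simpl in *. rewrite IH by lia. f_equal. ring.
Qed.

Lemma segment_1 (p q : list C) : length p = length q -> segment p q 1 = q.
Proof.
revert q. induction p as [|z p IH]; intros [|w q] H; try discriminate; [easy|].
unfold segment in *. simpl in *. rewrite IH by lia. f_equal. ring.
Qed.

Lemma segment_continuous (p q : list C) (r : R) : length p = length q -> 0 < r ->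
  exists d, 0 < d /\ forall t t', Rabs (t' - t) < d ->
    polydisc (segment p q t) r (segment p q t').
Proof.
intros H Hr. revert q H.
induction p as [|z p IH]; intros [|w q] H; try discriminate.
- exists 1. split; [lra|]. intros; constructor.
- simpl in H. destruct (IH q ltac:(lia)) as [d [Hd D]].
  assert (Hm := Cmod_ge_0 (w - z)). set (M := Cmod (w - z)) in *.
  exists (Rmin d (r / (M + 1))). split.
  { apply Rmin_glb_lt; [easy|]. apply Rdiv_lt_0_compat; lra. }
  intros t t' Ht. unfold segment. simpl. constructor.
  + replace (z + t' * (w - z) - (z + t * (w - z)))%C with ((t' - t)%R * (w - z))%C
      by (rewrite RtoC_minus; ring).
    rewrite Cmod_mult, Cmod_R. fold M.
    assert (Ht2 : Rabs (t' - t) < r / (M + 1)) by (eapply Rlt_le_trans; [exact Ht|apply Rmin_r]).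
    apply Rmult_lt_compat_r with (r := M + 1) in Ht2; [|lra].
    replace (r / (M + 1) * (M + 1)) with r in Ht2 by (field; lra).
    assert (A := Rabs_pos (t' - t)). nra.
  + apply D. eapply Rlt_le_trans; [exact Ht|apply Rmin_l].
Qed.

(** Since values on the thin sets of poles are arbitrary, equality can only be asserted on a dense
    open set: the conclusion says that the interior of the set where F = G meets every neighbourhood
    P of q. *)
Lemma meromorphic_identity_local (n : nat) (F G : list C -> C) (p : list C) :
  meromorphic n F -> meromorphic n G -> length p = n ->
  exists r, 0 < r /\
    ((exists x, polydisc p r x /\ near_list x (fun y => F y = G y)) ->
     forall q P, polydisc p r q -> near_list q P ->
       exists x, P x /\ near_list x (fun y => F y = G y)).
Proof.
intros MF MG Hp.
destruct (meromorphic_pair n F G p MF MG Hp)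
  as [r [g1 [h1 [g2 [h2 [Hr [G1 [H1 [G2 [H2 [E V]]]]]]]]]]].
exists r. split; [easy|]. intros [x [Hx Nx]] q P Hq NP.
set (h := fun y => (h1 y * h2 y)%C).
assert (Hh : holomorphic_on (polydisc p r) h) by now apply holomorphic_on_mult.
assert (Good : forall y, polydisc p r y -> h y <> 0%C ->
  near_list y (fun t => polydisc p r t /\ h t <> 0%C)).
{ intros y Hy Hn. apply filter_and; [now apply near_list_polydisc|].
  now apply (holomorphic_nonzero_open h (polydisc p r)). }
(* Off the zeros of h, F = G means D = 0. Being holomorphic, D vanishes on the whole polydisc once
   it does so near one point. *)
set (D := fun y => (g1 y * h2 y - g2 y * h1 y)%C).
assert (HD : forall y, polydisc p r y -> D y = 0%C).
{ destruct (holomorphic_nonzero_dense h p x r _ Hh E Hx (near_list_near _ _ Nx))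
    as [x' [Hx' [Nx' Hn']]].
  destruct (filter_and _ _ Nx' (Good x' Hx' Hn')) as [e [He He']].
  apply (polydisc_identity D p x' r e); try easy.
  - apply holomorphic_on_minus; apply holomorphic_on_mult; easy.
  - intros y Hy _. destruct (He' y Hy) as [EFG [Hy' Hny]].
    destruct (V y Hy' Hny) as [N1 [N2 [E1 E2]]].
    rewrite E1, E2 in EFG. unfold D.
    replace (g1 y) with (g1 y / h1 y * h1 y)%C by (field; easy).
    rewrite EFG. field. easy. }
destruct (holomorphic_nonzero_dense h p q r P Hh E Hq NP) as [x' [Hx' [Px' Hn']]].
exists x'. split; [easy|]. generalize (Good x' Hx' Hn'). apply filter_imp.
intros y [Hy Hny]. destruct (V y Hy Hny) as [N1 [N2 [-> ->]]].
specialize (HD y Hy). unfold D in HD.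
replace (g1 y) with ((g1 y * h2 y - g2 y * h1 y + g2 y * h1 y) / h2 y)%C by (field; easy).
rewrite HD. field. easy.
Qed.

Theorem meromorphic_identity (n : nat) (F G : list C -> C) (q : list C) :
  meromorphic n F -> meromorphic n G -> length q = n ->
  near_list q (fun y => F y = G y) -> meromorphic_eq n F G.
Proof.
intros MF MG Hq Nq. split; [easy|]. split; [easy|].
exists (fun x => near_list x (fun y => F y = G y)). split.
2:{ intros s _ Hs. now apply near_list_self in Hs. }
split.
{ intros p _ Hp. now apply near_list_near in Hp. }
intros p r Hp Hr.
set (W := fun y => near_list y (fun t => F t = G t)) in *.
(* The property propagated along the segment from q to p: the interior of the set where F = G is
   dense near x. Interior membership itself could fail at a pole on the segment. *)
set (D := fun x => exists e, 0 < e /\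
  forall y P, polydisc x e y -> near_list y P -> exists t, P t /\ W t).
assert (HD : D p).
{ rewrite <- (segment_1 q p) by congruence.
  apply (unit_interval_connected (fun t => D (segment q p t))).
  - rewrite segment_0 by congruence.
    apply near_list_near in Nq. destruct Nq as [e [He Ne]].
    exists e. split; [easy|]. intros y P Hy HP. exists y.
    split; [now apply near_list_self in HP|now apply Ne].
  - intros t Ht.
    destruct (meromorphic_identity_local n F G (segment q p t) MF MG) as [r0 [Hr0 L]].
    { rewrite segment_length; congruence. }
    destruct (segment_continuous q p r0) as [d [Hd Hc]]; [congruence|easy|].
    exists d. split; [easy|]. intros [t1 [_ [Ht1 [e1 [He1 D1]]]]] t2 _ Ht2.
    assert (L' := L ltac:(
      destruct (D1 _ _ (polydisc_center _ e1 He1)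
        (near_list_polydisc _ _ _ (Hc t t1 Ht1))) as [x [Hx Wx]];
      exists x; now split)).
    destruct (polydisc_open _ _ _ (Hc t t2 Ht2)) as [e [He He']].
    exists e. split; [easy|]. intros y P Hy HP. apply (L' y P); [now apply He'|easy]. }
destruct HD as [e [He De]].
destruct (De p _ (polydisc_center p e He) (near_list_ball p r Hr)) as [x [Hx Wx]].
now exists x.
Qed.

Lemma open_dense_and (n : nat) (U V : list C -> Prop) :
  open_dense n U -> open_dense n V -> open_dense n (fun s => U s /\ V s).
Proof.
intros [OU DU] [OV DV]. split.
- intros p Hp [Up Vp]. change (near_list p (fun q => U q /\ V q)).
  apply filter_and; [now apply OU|now apply OV].
- intros p r Hp Hr. destruct (DU p r Hp Hr) as [q [Hq Uq]].
  assert (Hlq : length q = n) by now rewrite (polydisc_length _ _ _ Hq).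
  destruct (filter_and _ _ (near_list_polydisc _ _ _ Hq) (OU q Hlq Uq)) as [d [Hd HdU]].
  destruct (DV q d Hlq Hd) as [x [Hx Vx]]. exists x.
  destruct (HdU x Hx). auto.
Qed.

Lemma meromorphic_eq_refl (n : nat) (F G : list C -> C) :
  meromorphic n F -> (forall s, length s = n -> F s = G s) -> meromorphic_eq n F G.
Proof.
intros MF E. split; [easy|]. split; [now apply (meromorphic_ext n F)|].
exists (fun _ => True). split; [|auto]. split.
- intros p _ _. exists 1. split; [lra|easy].
- intros p r _ Hr. exists p. split; [now apply polydisc_center|easy].
Qed.

Lemma meromorphic_eq_op (n : nat) (op : C -> C -> C) (F1 F2 G1 G2 : list C -> C) :
  (forall F G, meromorphic n F -> meromorphic n G ->
     meromorphic n (fun s => op (F s) (G s))) ->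
  meromorphic_eq n F1 G1 -> meromorphic_eq n F2 G2 ->
  meromorphic_eq n (fun s => op (F1 s) (F2 s)) (fun s => op (G1 s) (G2 s)).
Proof.
intros Hop [MF1 [MG1 [U1 [O1 E1]]]] [MF2 [MG2 [U2 [O2 E2]]]].
split; [now apply Hop|]. split; [now apply Hop|].
exists (fun s => U1 s /\ U2 s). split; [now apply open_dense_and|].
intros s Hs [H1 H2]. now rewrite E1, E2.
Qed.

Lemma meromorphic_eq_mult (n : nat) (F1 F2 G1 G2 : list C -> C) :
  meromorphic_eq n F1 G1 -> meromorphic_eq n F2 G2 ->
  meromorphic_eq n (fun s => F1 s * F2 s)%C (fun s => G1 s * G2 s)%C.
Proof. apply (meromorphic_eq_op n Cmult), meromorphic_mult. Qed.

Lemma meromorphic_eq_Csum {I} (n : nat) (L : list I) (F G : I -> list C -> C) :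
  (forall j, In j L -> meromorphic_eq n (F j) (G j)) ->
  meromorphic_eq n (fun s => Csum (map (fun j => F j s) L))
    (fun s => Csum (map (fun j => G j s) L)).
Proof.
induction L as [|j L IH]; intros H.
- apply meromorphic_eq_refl; [exact (meromorphic_const n (RtoC 0))|easy].
- simpl. apply (meromorphic_eq_op n Cplus); [apply meromorphic_plus| |].
  + apply H. now left.
  + apply IH. intros i Hi. apply H. now right.
Qed.

Lemma meromorphic_eq_ext (n : nat) (F F' G G' : list C -> C) :
  (forall s, length s = n -> F s = F' s) -> (forall s, length s = n -> G s = G' s) ->
  meromorphic_eq n F G -> meromorphic_eq n F' G'.
Proof.
intros EF EG [MF [MG [U [O E]]]].
split; [now apply (meromorphic_ext n F)|]. split; [now apply (meromorphic_ext n G)|].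
exists U. split; [easy|]. intros s Hs HU. rewrite <- EF, <- EG by easy. auto.
Qed.

Lemma meromorphic_eq_pullback (n m : nat) (T : list C -> list C) (F G : list C -> C) :
  coordinate_map n m T -> meromorphic_eq m F G ->
  meromorphic_eq n (fun s => F (T s)) (fun s => G (T s)).
Proof.
intros HT [MF [MG [U [[OU DU] E]]]].
split; [now apply (meromorphic_pullback n m)|]. split; [now apply (meromorphic_pullback n m)|].
destruct HT as [HL [HP [HS _]]]. exists (fun s => U (T s)). split; [split|].
- intros p Hp HU. destruct (OU (T p) (HL p Hp) HU) as [r [Hr D]].
  exists r. split; [easy|]. intros q Hq. now apply D, HP.
- intros p r Hp Hr. destruct (DU (T p) r (HL p Hp) Hr) as [q [Hq Uq]].
  destruct (HS p q r Hp Hr Hq) as [q' [Hq' <-]]. now exists q'.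
- intros s Hs HU. apply E; [now apply HL|exact HU].
Qed.

(** * Meromorphic continuation under reflection *)

Lemma Csum_rev (l : list C) : Csum (rev l) = Csum l.
Proof. induction l as [|z l IH]; [easy|]. simpl. rewrite Csum_app, IH. simpl. ring. Qed.

Lemma Csum_reflect (a s : list C) : length a = length s ->
  Csum (reflect a s) = (Csum a - Csum s)%C.
Proof.
intros H. unfold reflect. rewrite Csum_rev. revert s H.
induction a as [|x a IH]; intros [|z s] H; try discriminate; simpl in *; [ring|].
rewrite IH by lia. ring.
Qed.

Lemma Csum_scal {I} (c : C) (F : I -> C) (L : list I) :
  Csum (map (fun j => c * F j)%C L) = (c * Csum (map F L))%C.
Proof. induction L as [|j L IH]; simpl; [ring|]. rewrite IH. ring. Qed.

Lemma mero_ext_meromorphic (n : nat) (D : list C -> Prop) (F0 : list C -> C) :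
  meromorphic n (mero_ext n D F0).
Proof.
unfold mero_ext. destruct excluded_middle_informative as [H|H].
- exact (proj1 (proj2_sig (constructive_indefinite_description _ H))).
- apply meromorphic_const.
Qed.

(* A continuation of one function yields one of the other, so that the
   conventional value 0 is taken on both sides or on neither. *)
Lemma mero_ext_reflect (n : nat) (a q : list C) (al be : C) (D1 D2 : list C -> Prop)
  (F1 F2 : list C -> C) :
  length a = n -> length q = n -> near_list q D1 ->
  (forall s, length s = n -> D1 s <-> D2 (reflect a s)) ->
  (forall s, length s = n -> D1 s ->
     F1 s = (Cexp (al + be * Csum s) * F2 (reflect a s))%C) ->
  meromorphic_eq n (mero_ext n D1 F1)
    (fun s => Cexp (al + be * Csum s) * mero_ext n D2 F2 (reflect a s))%C.
Proof.
intros Ha Hq Nq HD HF.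
assert (To2 : (exists F, is_mero_ext n D1 F1 F) -> exists F, is_mero_ext n D2 F2 F).
{ intros [F [MF EF]].
  (* This exponential inverts the factor in front of F2 after reflection: for s = reflect a t, Csum
     t = Csum a - Csum s. *)
  exists (fun s => Cexp (- (al + be * Csum a) + be * Csum s) * F (reflect (rev a) s))%C. split.
  - apply meromorphic_mult; [apply meromorphic_Cexp_Csum|].
    apply (meromorphic_pullback n n); [|easy]. apply coordinate_reflect.
    now rewrite length_rev.
  - intros s Hs Ds.
    set (t := reflect (rev a) s).
    assert (Ht : length t = n) by (unfold t; rewrite reflect_length; [easy|rewrite length_rev; congruence]).
    assert (Es : reflect a t = s).
    { unfold t. rewrite <- (rev_involutive a) at 1. apply reflect_involutive.
      rewrite length_rev. congruence. }
    assert (Dt : D1 t) by (apply HD; [easy|now rewrite Es]).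
    rewrite EF, HF, Es by easy. rewrite Cmult_assoc, <- Cexp_plus.
    replace (- (al + be * Csum a) + be * Csum s + (al + be * Csum t))%C with (RtoC 0).
    + rewrite Cexp_0. ring.
    + unfold t. rewrite Csum_reflect, Csum_rev by (rewrite length_rev; congruence). ring. }
assert (To1 : (exists F, is_mero_ext n D2 F2 F) -> exists F, is_mero_ext n D1 F1 F).
{ intros [F [MF EF]].
  exists (fun s => Cexp (al + be * Csum s) * F (reflect a s))%C. split.
  - apply meromorphic_mult; [apply meromorphic_Cexp_Csum|].
    apply (meromorphic_pullback n n); [|easy]. now apply coordinate_reflect.
  - intros s Hs Ds. rewrite HF, EF; try easy.
    + rewrite reflect_length; congruence.
    + now apply HD. }
assert (M2 : meromorphic n (fun s => Cexp (al + be * Csum s) * mero_ext n D2 F2 (reflect a s))%C).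
{ apply meromorphic_mult; [apply meromorphic_Cexp_Csum|].
  apply (meromorphic_pullback n n); [now apply coordinate_reflect|apply mero_ext_meromorphic]. }
assert (M1 := mero_ext_meromorphic n D1 F1).
unfold mero_ext in *.
destruct (excluded_middle_informative (exists F, is_mero_ext n D1 F1 F)) as [H1|H1];
destruct (excluded_middle_informative (exists F, is_mero_ext n D2 F2 F)) as [H2|H2].
- destruct (constructive_indefinite_description _ H1) as [G1 [MG1 E1]].
  destruct (constructive_indefinite_description _ H2) as [G2 [MG2 E2]]. simpl in *.
  apply meromorphic_identity with q; try easy.
  assert (Lq : near_list q (fun y => length y = n)).
  { exists 1. split; [lra|]. intros y Hy. now rewrite (polydisc_length _ _ _ Hy). }
  generalize (filter_and _ _ Nq Lq). apply filter_imp. intros s [Ds Hs].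
  rewrite E1, HF, E2; try easy.
  + rewrite reflect_length; congruence.
  + now apply HD.
- now elim H2; apply To2.
- now elim H1; apply To1.
- apply meromorphic_eq_refl; [easy|]. intros s _. ring.
Qed.

(** * Iterated integrals of weights on a half-line *)

Lemma is_Rder_pair (f : R -> C) (x : R) (l : C) :
  is_derive (fun t => fst (f t)) x (fst l) -> is_derive (fun t => snd (f t)) x (snd l) ->
  is_Rder f x l.
Proof.
intros H1 H2.
assert (D1 := is_derive_scal_l (V := C_R_NormedModule) (fun t => fst (f t)) x (fst l)
  (RtoC 1) H1).
assert (D2 := is_derive_scal_l (V := C_R_NormedModule) (fun t => snd (f t)) x (snd l)
  Ci H2).
assert (D := is_derive_plus (V := C_R_NormedModule) _ _ x _ _ D1 D2).
assert (E : forall z : C, plus (G := C_R_NormedModule)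
   (scal (V := C_R_NormedModule) (fst z) (RtoC 1)) (scal (V := C_R_NormedModule) (snd z) Ci) = z).
{ intros z. rewrite !scal_R_Cmult. apply injective_projections; simpl; unfold plus; simpl; ring. }
rewrite (E l) in D. revert D. apply is_derive_ext. intros t. apply E.
Qed.

Lemma is_Rder_fst (f : R -> C) (x : R) (l : C) :
  is_Rder f x l -> is_derive (fun t => fst (f t)) x (fst l).
Proof.
intros H. apply (filterdiff_comp (V := C_R_NormedModule) f (fun z : C => fst z) _ (fun z : C => fst z) H).
apply filterdiff_linear. apply (is_linear_fst (U := R_NormedModule) (V := R_NormedModule)).
Qed.

Lemma is_Rder_snd (f : R -> C) (x : R) (l : C) :
  is_Rder f x l -> is_derive (fun t => snd (f t)) x (snd l).
Proof.
intros H. apply (filterdiff_comp (V := C_R_NormedModule) f (fun z : C => snd z) _ (fun z : C => snd z) H).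
apply filterdiff_linear. apply (is_linear_snd (U := R_NormedModule) (V := R_NormedModule)).
Qed.

Lemma is_Rder_mult (f g : R -> C) (x : R) (df dg : C) :
  is_Rder f x df -> is_Rder g x dg ->
  is_Rder (fun t => f t * g t)%C x (df * g x + f x * dg)%C.
Proof.
intros Hf Hg.
assert (F1 := is_Rder_fst _ _ _ Hf). assert (F2 := is_Rder_snd _ _ _ Hf).
assert (G1 := is_Rder_fst _ _ _ Hg). assert (G2 := is_Rder_snd _ _ _ Hg).
apply is_Rder_pair; simpl.
- replace (_ + _) with ((fst df * fst (g x) + fst (f x) * fst dg)
    - (snd df * snd (g x) + snd (f x) * snd dg)) by ring.
  apply (is_derive_minus (V := R_NormedModule)
    (fun t => fst (f t) * fst (g t)) (fun t => snd (f t) * snd (g t)));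
    apply (is_derive_mult (K := R_AbsRing)); try easy; apply Rmult_comm.
- replace (_ + _) with ((fst df * snd (g x) + fst (f x) * snd dg)
    + (snd df * fst (g x) + snd (f x) * fst dg)) by ring.
  apply (is_derive_plus (V := R_NormedModule)
    (fun t => fst (f t) * snd (g t)) (fun t => snd (f t) * fst (g t)));
    apply (is_derive_mult (K := R_AbsRing)); try easy; apply Rmult_comm.
Qed.

Lemma is_Rder_eq (f : R -> C) (x : R) (l l' : C) : is_Rder f x l -> l = l' -> is_Rder f x l'.
Proof. now intros H <-. Qed.

Lemma is_Rder_const (c : C) (x : R) : is_Rder (fun _ => c) x (RtoC 0).
Proof. apply (is_derive_const (V := C_R_NormedModule)). Qed.

Lemma is_Rder_plus (f g : R -> C) (x : R) (df dg : C) :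
  is_Rder f x df -> is_Rder g x dg -> is_Rder (fun t => f t + g t)%C x (df + dg)%C.
Proof. apply (is_derive_plus (V := C_R_NormedModule)). Qed.

Lemma is_Rder_comp (f : R -> C) (h : R -> R) (x dh : R) (df : C) :
  is_Rder f (h x) df -> is_derive h x dh -> is_Rder (fun t => f (h t)) x (dh * df)%C.
Proof.
intros Hf Hh. rewrite <- scal_R_Cmult.
apply (is_derive_comp (V := C_R_NormedModule) f h x df dh Hf Hh).
Qed.

Lemma is_Rder_cont (f : R -> C) (x : R) (df : C) :
  is_Rder f x df -> tends f (locally x) (f x).
Proof.
intros H. apply (ex_derive_continuous (V := C_R_NormedModule) f x). now exists df.
Qed.

Lemma is_Rder_CInt (f : R -> C) (a x : R) (r : R) : 0 < r ->
  (forall t, Rabs (t - x) < r -> ex_CInt f a t) -> tends f (locally x) (f x) ->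
  is_Rder (CInt f a) x (f x).
Proof.
intros Hr Hex Hc. apply (is_derive_RInt (V := C_R_NormedModule) f (CInt f a) a x); [|exact Hc].
exists (mkposreal r Hr). intros t Ht. apply CInt_correct, Hex, Ht.
Qed.

Lemma Rpower_int (e u v : R) : e <> 0 -> 0 < u -> u <= v ->
  is_RInt (fun x => Rpower x (e - 1)) u v ((Rpower v e - Rpower u e) / e).
Proof.
intros He Hu Huv.
replace ((Rpower v e - Rpower u e) / e)
  with (minus (Rpower v e / e) (Rpower u e / e)) by (unfold minus, plus, opp; simpl; field; easy).
assert (D : forall c x, 0 < x -> is_derive (fun x => Rpower x c) x (c * Rpower x (c - 1))).
{ intros c x Hx. unfold Rpower. auto_derive; [easy|].
  replace ((c - 1) * ln x) with (c * ln x + - ln x) by ring.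
  rewrite exp_plus, exp_Ropp, exp_ln by easy. field. lra. }
apply (is_RInt_derive (fun x => Rpower x e / e)).
- intros x Hx. rewrite Rmin_left, Rmax_right in Hx by easy.
  replace (Rpower x (e - 1)) with (e * Rpower x (e - 1) * / e) by (field; easy).
  apply (is_derive_scal_l (V := R_NormedModule) (fun x => Rpower x e) x _ (/ e)).
  apply D. lra.
- intros x Hx. rewrite Rmin_left, Rmax_right in Hx by easy.
  apply (ex_derive_continuous (fun x => Rpower x (e - 1))). eexists. apply D. lra.
Qed.

(** As e < 0, the bound is the integral of the majorant over the whole half-line from u. It is thus
    uniform in v, and serves both for tails at infinity and for u tending to 0. *)
Lemma CInt_bound_Rpower (f : R -> C) (M e u v : R) (l : C) : e < 0 -> 0 < u -> u <= v ->
  (forall x, u <= x <= v -> Cmod (f x) <= M * Rpower x (e - 1)) -> is_CInt f u v l ->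
  Cmod l <= M / (- e) * Rpower u e.
Proof.
intros He Hu Huv HM Hl.
assert (P1 : forall x y, 0 < Rpower x y) by (intros; apply exp_pos).
assert (M0 : 0 <= M).
{ specialize (HM u ltac:(lra)). apply Rmult_le_reg_r with (Rpower u (e - 1)); [apply P1|].
  rewrite Rmult_0_l. eapply Rle_trans; [apply Cmod_ge_0|exact HM]. }
rewrite <- norm_C.
apply Rle_trans with (M * ((Rpower v e - Rpower u e) / e)).
- apply (norm_RInt_le f (fun x => M * Rpower x (e - 1)) u v l _ Huv); [|easy|].
  + intros x Hx. rewrite norm_C. now apply HM.
  + apply (is_RInt_scal (V := R_NormedModule)). apply Rpower_int; lra.
- replace (M * ((Rpower v e - Rpower u e) / e))
    with (M * ((Rpower u e - Rpower v e) * / - e)) by (field; lra).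
  replace (M / - e * Rpower u e) with (M * (Rpower u e * / - e)) by (field; lra).
  apply Rmult_le_compat_l; [easy|]. apply Rmult_le_compat_r.
  + left. apply Rinv_0_lt_compat. lra.
  + generalize (P1 v e). lra.
Qed.

Lemma Rpower_small (e : R) : e < 0 -> forall eps, 0 < eps ->
  Rbar_locally p_infty (fun x => 0 < x /\ Rpower x e < eps).
Proof.
intros He eps Heps. exists (exp (ln eps / e)). intros x Hx.
assert (Hx0 : 0 < x) by (eapply Rlt_trans; [apply exp_pos|exact Hx]).
split; [easy|]. unfold Rpower. rewrite <- (exp_ln eps) by easy. apply exp_increasing.
apply ln_increasing in Hx; [|apply exp_pos]. rewrite ln_exp in Hx.
apply Rmult_lt_gt_compat_neg_l with (r := e) in Hx; [|easy].
replace (e * (ln eps / e)) with (ln eps) in Hx by (field; lra). lra.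
Qed.

Lemma ex_CInt_pos (f : R -> C) (u v : R) : 0 < u -> 0 < v ->
  (forall x, 0 < x -> tends f (locally x) (f x)) -> ex_CInt f u v.
Proof.
intros Hu Hv Hf. apply ex_CInt_cont. intros x Hx. apply Hf.
assert (0 < Rmin u v) by now apply Rmin_glb_lt. lra.
Qed.

(** I is the improper integral from infinity to b, obtained as a Cauchy limit; splitting at b makes
    the integral to any x an ordinary primitive. The power bound is what the next layer of an
    iterated integral consumes. *)
Lemma CInt_gen_infty (f : R -> C) (M e b : R) : e < 0 -> 0 < b ->
  (forall x, 0 < x -> tends f (locally x) (f x)) ->
  (forall x, b <= x -> Cmod (f x) <= M * Rpower x (e - 1)) ->
  exists I : C,
    (forall x, 0 < x ->
       RInt_gen (V := C_R_CompleteNormedModule) f (Rbar_locally p_infty) (at_point x) =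
       (I + CInt f b x)%C) /\
    (forall x, b <= x -> Cmod (I + CInt f b x) <= M / - e * Rpower x e).
Proof.
intros He Hb Hc HM.
assert (Ex : forall u v, 0 < u -> 0 < v -> ex_CInt f u v).
{ intros. now apply ex_CInt_pos. }
assert (HB : forall u v, b <= u -> u <= v -> Cmod (CInt f u v) <= M / - e * Rpower u e).
{ intros u v Hu Huv. apply (CInt_bound_Rpower f M e u v); try lra.
  - intros x Hx. apply HM. lra.
  - apply CInt_correct, Ex; lra. }
assert (M0 : 0 <= M / - e).
{ specialize (HM b ltac:(lra)).
  assert (P : 0 < Rpower b (e - 1)) by apply exp_pos.
  apply Rmult_le_pos; [|left; apply Rinv_0_lt_compat; lra].
  apply Rmult_le_reg_r with (Rpower b (e - 1)); [easy|].
  rewrite Rmult_0_l. eapply Rle_trans; [apply Cmod_ge_0|exact HM]. }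
set (Q := M / - e) in *.
assert (HB' : forall u v, b <= u -> b <= v ->
  Cmod (CInt f u v) <= Q * Rmax (Rpower u e) (Rpower v e)).
{ intros u v Hu Hv. destruct (Rle_lt_dec u v) as [H|H].
  - eapply Rle_trans; [now apply HB|]. apply Rmult_le_compat_l; [easy|apply Rmax_l].
  - rewrite <- (opp_RInt_swap (V := C_R_CompleteNormedModule) f v u) by (apply Ex; lra).
    change (Cmod (- CInt f v u)%C <= Q * Rmax (Rpower u e) (Rpower v e)).
    rewrite Cmod_opp. eapply Rle_trans; [apply HB; lra|].
    apply Rmult_le_compat_l; [easy|apply Rmax_r]. }
set (J := fun T => CInt f T b).
assert (HJ : exists I : C, tends J (Rbar_locally p_infty) I).
{ apply (filterlim_locally_cauchy (U := C_R_CompleteNormedModule) J).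
  intros eps. exists (fun u => b <= u /\ Q * Rpower u e < eps). split.
  - assert (H1 := Rpower_small e He (eps / (Q + 1))
      ltac:(apply Rdiv_lt_0_compat; [apply cond_pos|lra])).
    assert (H2 : Rbar_locally p_infty (fun u => b <= u)) by (exists b; intros; lra).
    generalize (filter_and _ _ H1 H2). apply filter_imp. intros u [[_ Hu] Hb'].
    split; [easy|].
    apply Rmult_lt_compat_l with (r := Q + 1) in Hu; [|lra].
    replace ((Q + 1) * (eps / (Q + 1))) with (pos eps) in Hu by (field; lra).
    assert (P : 0 < Rpower u e) by apply exp_pos. lra.
  - intros u v [Hu1 Hu2] [Hv1 Hv2]. apply C_NormedModule_mixin_compat1.
    change (Cmod (J v - J u)%C < eps).
    assert (E : (J v - J u)%C = CInt f v u).
    { unfold J. rewrite <- (CInt_Chasles f v u b) by (apply Ex; lra). ring. }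
    rewrite E. eapply Rle_lt_trans; [now apply HB'|].
    unfold Rmax. destruct Rle_dec; lra. }
destruct HJ as [I HI]. exists I. split.
- intros x Hx. apply is_RInt_gen_unique.
  apply (is_RInt_gen_Chasles (V := C_R_NormedModule)) with b.
  + intros P HP. specialize (HI P HP).
    apply (Filter_prod _ _ _ (fun T => 0 < T /\ P (J T)) (fun y => y = b)).
    * apply filter_and; [exists 0; intros; lra|exact HI].
    * easy.
    * intros T y [HT HPT] ->. exists (J T). split; [|exact HPT].
      apply CInt_correct, Ex; easy.
  + apply is_RInt_gen_at_point. apply CInt_correct, Ex; easy.
- intros x Hx. apply le_epsilon. intros eps Heps.
  assert (H1 := proj1 (tendsE _ J I) HI eps Heps).
  assert (H2 : Rbar_locally p_infty (fun u => x <= u)) by (exists x; intros; lra).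
  destruct (filter_ex _ (filter_and _ _ H1 H2)) as [T [HT1 HT2]].
  assert (E : (I + CInt f b x)%C = (- (J T - I) + CInt f T x)%C).
  { unfold J. rewrite <- (CInt_Chasles f T b x) by (apply Ex; lra). ring. }
  rewrite E. eapply Rle_trans; [apply Cmod_triangle|]. rewrite Cmod_opp.
  assert (Cmod (CInt f T x) <= Q * Rpower x e); [|lra].
  rewrite <- (opp_RInt_swap (V := C_R_CompleteNormedModule) f x T) by (apply Ex; lra).
  change (Cmod (- CInt f x T)%C <= Q * Rpower x e).
  rewrite Cmod_opp. apply HB; lra.
Qed.

(** [iter_int] with the integrand of each layer, dz included, packed into one function of t, so that
    the reversal concerns arbitrary continuous weights. *)
Fixpoint iter_weights (A : (R -> Prop) -> Prop) (l : list (R -> C))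
  (B : (R -> Prop) -> Prop) : C :=
  match l with
  | [] => 1%C
  | phi :: l' =>
      RInt_gen (V := C_R_CompleteNormedModule)
        (fun t => phi t * iter_weights A l' (at_point t))%C A B
  end.

Notation from_infty l := (fun x : R => iter_weights (Rbar_locally p_infty) l (at_point x)).
Notation from_base b l := (fun t : R => iter_weights (at_point b) l (at_point t)).

Definition cont_pos (f : R -> C) : Prop := forall x, 0 < x -> tends f (locally x) (f x).

Lemma cont_pos_mult (f g : R -> C) :
  cont_pos f -> cont_pos g -> cont_pos (fun x => f x * g x)%C.
Proof.
intros Hf Hg x Hx. apply tends_mult; [apply locally_filter|now apply Hf|now apply Hg].
Qed.

Lemma is_Rder_cont_pos (f df : R -> C) :
  (forall x, 0 < x -> is_Rder f x (df x)) -> cont_pos f.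
Proof. intros H x Hx. eapply is_Rder_cont, H, Hx. Qed.

Lemma is_Rder_CInt_pos (f : R -> C) (b x : R) : 0 < b -> 0 < x -> cont_pos f ->
  is_Rder (CInt f b) x (f x).
Proof.
intros Hb Hx Hf. apply is_Rder_CInt with x; [easy| |now apply Hf].
intros t Ht. apply Rabs_def2 in Ht. apply ex_CInt_pos; [easy|lra|exact Hf].
Qed.

Lemma is_Rder_ext_pos (f g : R -> C) (x : R) (l : C) : 0 < x ->
  (forall t, 0 < t -> f t = g t) -> is_Rder f x l -> is_Rder g x l.
Proof.
intros Hx E. apply is_derive_ext_loc. exists (mkposreal x Hx). intros t Ht. apply E.
change (Rabs (t - x) < x) in Ht. apply Rabs_def2 in Ht. lra.
Qed.

Lemma Rpower_minus1 (x p q : R) : Rpower x (p - 1) * Rpower x q = Rpower x (p + q - 1).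
Proof. rewrite <- Rpower_plus. f_equal. ring. Qed.

(** Orders add up: a weight O(x^(s - 1)) times an inner integral O(x^S) integrates to O(x^(S + s))
    as long as s + S < 0. Iterating gives the partial-sum conditions of the domain of
    convergence. *)
Lemma from_infty_step (phi : R -> C) (acc : list (R -> C)) (b s S C0 K : R) :
  0 < b -> s + S < 0 -> cont_pos phi -> cont_pos (from_infty acc) ->
  (forall x, b <= x -> Cmod (phi x) <= C0 * Rpower x (s - 1)) ->
  (forall x, b <= x -> Cmod (from_infty acc x) <= K * Rpower x S) ->
  (forall x, 0 < x -> is_Rder (from_infty (phi :: acc)) x (phi x * from_infty acc x)%C) /\
  exists K', forall x, b <= x -> Cmod (from_infty (phi :: acc) x) <= K' * Rpower x (S + s).
Proof.
intros Hb Hs Hphi Hacc Bphi Bacc.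
set (f := fun t => (phi t * from_infty acc t)%C).
assert (Hf : cont_pos f) by now apply cont_pos_mult.
destruct (CInt_gen_infty f (C0 * K) (s + S) b Hs Hb Hf) as [I [H1 H2]].
{ intros x Hx. unfold f. rewrite Cmod_mult, <- Rpower_minus1.
  replace (C0 * K * (Rpower x (s - 1) * Rpower x S))
    with ((C0 * Rpower x (s - 1)) * (K * Rpower x S)) by ring.
  apply Rmult_le_compat; try apply Cmod_ge_0; [now apply Bphi|now apply Bacc]. }
split.
- intros x Hx. apply is_Rder_ext_pos with (fun x => I + CInt f b x)%C; [easy| |].
  + intros t Ht. symmetry. apply H1, Ht.
  + rewrite <- (Cplus_0_l (phi x * _)).
    apply is_Rder_plus; [apply is_Rder_const|]. now apply (is_Rder_CInt_pos f).
- exists (C0 * K / - (s + S)). intros x Hx. cbn [iter_weights]. fold f.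
  rewrite H1 by lra. rewrite (Rplus_comm S s). now apply H2.
Qed.

Lemma from_base_step (om : R -> C) (l : list (R -> C)) (b : R) :
  0 < b -> cont_pos om -> cont_pos (from_base b l) ->
  (forall t, 0 < t -> is_CInt (fun t => om t * from_base b l t)%C b t (from_base b (om :: l) t)) /\
  (forall t, 0 < t -> is_Rder (from_base b (om :: l)) t (om t * from_base b l t)%C) /\
  from_base b (om :: l) b = 0%C.
Proof.
intros Hb Hom Hl. set (f := fun t => (om t * from_base b l t)%C).
assert (Hf : cont_pos f) by now apply cont_pos_mult.
assert (E : forall t, 0 < t -> from_base b (om :: l) t = CInt f b t).
{ intros t Ht. cbn [iter_weights]. apply (RInt_gen_at_point (V := C_R_CompleteNormedModule)).
  now apply ex_CInt_pos. }
split; [|split].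
- intros t Ht. rewrite E by easy. now apply CInt_correct, ex_CInt_pos.
- intros t Ht. apply is_Rder_ext_pos with (CInt f b); [easy| |].
  + intros y Hy. symmetry. apply E, Hy.
  + now apply (is_Rder_CInt_pos f).
- rewrite E by easy. apply (RInt_point (V := C_R_CompleteNormedModule)).
Qed.

Lemma from_base_cont (b : R) (l : list (R -> C)) : 0 < b -> List.Forall cont_pos l ->
  cont_pos (from_base b l).
Proof.
intros Hb. induction 1 as [|om l Hom Hl IH].
- intros x Hx. exact (tends_const (locally x) (RtoC 1)).
- destruct (from_base_step om l b Hb Hom IH) as [_ [D _]].
  exact (is_Rder_cont_pos _ _ D).
Qed.

(** * Reversal of iterated integrals *)

(* A weight [lw] on the segment from the base point to 0 together with the
   weight [uw] into which x |-> 1/(N x) transforms it, up to the factor [ratio];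
   [uw x] is O(x^(ord - 1)) at infinity. *)
Record dual_weight : Type := DualWeight {
  lw : R -> C;
  uw : R -> C;
  ord : R;
  ratio : C
}.

(** The last clause is the substitution x |-> 1/(N x), whose derivative has absolute value 1/(N
    x^2). Its sign is supplied later, by the chain rule in the cut sum. *)
Definition dual_ok (N b : R) (d : dual_weight) : Prop :=
  cont_pos (lw d) /\ cont_pos (uw d) /\
  (exists M, forall x, b <= x -> Cmod (uw d x) <= M * Rpower x (ord d - 1)) /\
  (forall x, 0 < x -> (lw d (/ (N * x)) * RtoC (/ (N * (x * x))))%C = (ratio d * uw d x)%C).

(** The substitution x = 1/(N t) maps the interval up to b onto the half-line from b, and turns the
    order of [uw] at infinity into the opposite order of [lw] at 0. *)
Lemma dual_ok_lw_bound (N b : R) (d : dual_weight) :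
  0 < N -> 0 < b -> N * (b * b) = 1 -> dual_ok N b d ->
  exists M, forall t, 0 < t -> t <= b -> Cmod (lw d t) <= M * Rpower t (- ord d - 1).
Proof.
intros HN Hb HNb [_ [_ [[M HM] HR]]].
exists (Cmod (ratio d) * (M * Rpower N (- ord d))). intros t Ht Htb.
set (x := / (N * t)).
assert (HNt : 0 < N * t) by nra.
assert (Hx : 0 < x) by now apply Rinv_0_lt_compat.
assert (Hbx : b <= x).
{ unfold x. apply Rmult_le_reg_r with (N * t); [easy|]. rewrite Rinv_l by lra. nra. }
assert (Et : / (N * x) = t) by (unfold x; field; lra).
specialize (HR x Hx). rewrite Et in HR.
assert (Hq : 0 < / (N * (x * x))) by (apply Rinv_0_lt_compat; nra).
assert (EM : Cmod (lw d t) * / (N * (x * x)) = Cmod (ratio d) * Cmod (uw d x)).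
{ rewrite <- (Cmod_mult (ratio d)), <- HR, Cmod_mult, Cmod_R, Rabs_pos_eq; [easy|lra]. }
assert (EP : M * Rpower x (ord d - 1) =
  M * Rpower N (- ord d) * Rpower t (- ord d - 1) * / (N * (x * x))).
{ replace (/ (N * (x * x))) with (Rpower N 1 * Rpower t 2).
  2:{ rewrite Rpower_1 by easy. replace 2 with (INR 2) by (simpl; ring).
      rewrite Rpower_pow by easy. unfold x. simpl. field. lra. }
  replace (M * Rpower N (- ord d) * Rpower t (- ord d - 1) * (Rpower N 1 * Rpower t 2))
    with (M * ((Rpower N (- ord d) * Rpower N 1) * (Rpower t (- ord d - 1) * Rpower t 2))) by ring.
  rewrite <- !Rpower_plus. f_equal. unfold Rpower, x. rewrite <- exp_plus. f_equal.
  rewrite ln_Rinv, ln_mult by easy. ring. }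
apply Rmult_le_reg_r with (/ (N * (x * x))); [easy|]. rewrite EM.
replace (Cmod (ratio d) * (M * Rpower N (- ord d)) * Rpower t (- ord d - 1) * / (N * (x * x)))
  with (Cmod (ratio d) * (M * Rpower N (- ord d) * Rpower t (- ord d - 1) * / (N * (x * x))))
  by ring.
rewrite <- EP. apply Rmult_le_compat_l; [apply Cmod_ge_0|now apply HM].
Qed.

(** All of S, S + ord d_1, S + ord d_1 + ord d_2, ... stay below -dl; S is the order accumulated by
    the weights already above the cut. *)
Fixpoint orders_below (dl S : R) (l : list dual_weight) : Prop :=
  S + dl < 0 /\ match l with [] => True | d :: l' => orders_below dl (S + ord d) l' end.

Lemma orders_below_uniform (S : R) (l : list dual_weight) : orders_below 0 S l ->
  exists dl, 0 < dl /\ orders_below dl S l.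
Proof.
revert S. induction l as [|d l IH]; intros S [H1 H2].
- exists (- S / 2). split; [lra|]. split; [lra|easy].
- destruct (IH _ H2) as [dl [Hdl H]]. exists (Rmin dl (- S / 2)).
  split; [apply Rmin_glb_lt; lra|].
  assert (Mono : forall m dl dl' S, dl' <= dl -> orders_below dl S m -> orders_below dl' S m).
  { clear. induction m as [|d m IH]; intros dl dl' S Hd [H1 H2]; (split; [lra|]).
    - easy.
    - now apply IH with dl. }
  split; [generalize (Rmin_r dl (- S / 2)); lra|].
  apply Mono with dl; [apply Rmin_l|exact H].
Qed.

(** The integral may grow at 0. The exponent S + dl is tuned to its partner: against an upper factor
    O(x^S) at x = 1/(N t), it leaves O(x^(-dl)). One layer multiplies the inner bound t^(S + ord d +
    dl) by t^(- ord d - 1), and integration restores t^(S + dl). *)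
Lemma from_base_bound (N b dl S : R) (l : list dual_weight) :
  0 < N -> 0 < b -> N * (b * b) = 1 -> List.Forall (dual_ok N b) l -> orders_below dl S l ->
  exists K, forall t, 0 < t -> t <= b ->
    Cmod (from_base b (map lw l) t) <= K * Rpower t (S + dl).
Proof.
intros HN Hb HNb Hl. revert S. induction Hl as [|d l Hd Hl IH]; intros S [HS HO].
(* The exponent being negative, the power at t <= b is at least its value at b, so the constant 1 is
   dominated. *)
- exists (/ Rpower b (S + dl)). intros t Ht Htb. simpl.
  change (Cmod 1 <= / Rpower b (S + dl) * Rpower t (S + dl)). rewrite Cmod_1.
  apply Rmult_le_reg_l with (Rpower b (S + dl)); [apply exp_pos|].
  rewrite <- Rmult_assoc, Rinv_r, Rmult_1_l, Rmult_1_r by (apply Rgt_not_eq, exp_pos).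
  replace (S + dl) with (- - (S + dl)) by ring.
  rewrite !(Rpower_Ropp _ (- (S + dl))). apply Rinv_le_contravar; [apply exp_pos|].
  apply Rle_Rpower_l; lra.
- destruct (IH _ HO) as [K HK].
  destruct (dual_ok_lw_bound N b d HN Hb HNb Hd) as [M HM].
  assert (Hc : List.Forall cont_pos (map lw l)).
  { apply Forall_map. eapply Forall_impl; [|exact Hl]. intros a Ha. apply Ha. }
  destruct (from_base_step (lw d) (map lw l) b Hb (proj1 Hd) (from_base_cont b _ Hb Hc))
    as [HI [_ _]].
  exists (M * K / - (S + dl)). intros t Ht Htb.
  assert (HI' := is_RInt_swap (V := C_R_NormedModule) _ _ _ _ (HI t Ht)).
  change (is_CInt (fun t => lw d t * from_base b (map lw l) t)%C t b
    (- (from_base b (map lw (d :: l)) t))%C) in HI'.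
  rewrite <- Cmod_opp.
  apply (CInt_bound_Rpower (fun t => lw d t * from_base b (map lw l) t)%C (M * K) (S + dl) t b);
    try easy.
  intros x Hx. rewrite Cmod_mult.
  replace (S + dl - 1) with ((- ord d - 1) + (S + ord d + dl)) by ring.
  rewrite Rpower_plus.
  replace (M * K * (Rpower x (- ord d - 1) * Rpower x (S + ord d + dl)))
    with ((M * Rpower x (- ord d - 1)) * (K * Rpower x (S + ord d + dl))) by ring.
  apply Rmult_le_compat; try apply Cmod_ge_0; [apply HM|apply HK]; lra.
Qed.

Definition infty_ok (b : R) (acc : list (R -> C)) (S : R) : Prop :=
  cont_pos (from_infty acc) /\
  exists K, forall x, b <= x -> Cmod (from_infty acc x) <= K * Rpower x S.

Lemma infty_ok_step (N b S : R) (d : dual_weight) (acc : list (R -> C)) :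
  0 < b -> dual_ok N b d -> infty_ok b acc S -> S + ord d < 0 ->
  infty_ok b (uw d :: acc) (S + ord d) /\
  forall x, 0 < x -> is_Rder (from_infty (uw d :: acc)) x (uw d x * from_infty acc x)%C.
Proof.
intros Hb [_ [Hu [[M HM] _]]] [Hc [K HK]] HS.
destruct (from_infty_step (uw d) acc b (ord d) S M K Hb ltac:(lra) Hu Hc HM HK) as [H1 H2].
split; [|exact H1]. split; [exact (is_Rder_cont_pos _ _ H1)|exact H2].
Qed.

(* The sum over the ways of cutting the iterated integral at height x: the
   variables of [acc] and some of those of [l] lie above x, the others below.
   For empty [acc] it does not depend on x. *)
Fixpoint cut_sum (N b : R) (acc : list (R -> C)) (c : C) (l : list dual_weight) (x : R) : C :=
  (c * from_infty acc x * from_base b (map lw l) (/ (N * x))%R +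
   match l with
   | [] => 0
   | d :: l' => cut_sum N b (uw d :: acc) (c * ratio d) l' x
   end)%C.

(** The sum telescopes: by the substitution clause of [dual_ok], differentiating the lower integral
    of one cut gives minus what differentiating the upper integral of the next cut gives. Only the
    derivative u of the first upper integral survives, and it is 0 for empty [acc]. The order
    condition starts after the head of l, which admits S = 0 for that case. *)
Lemma is_Rder_cut_sum (N b S : R) (l : list dual_weight) (acc : list (R -> C)) (c : C)
  (x : R) (u : C) :
  0 < N -> 0 < b -> List.Forall (dual_ok N b) l -> infty_ok b acc S ->
  match l with [] => True | d :: l' => orders_below 0 (S + ord d) l' end ->
  0 < x -> is_Rder (from_infty acc) x u ->
  is_Rder (cut_sum N b acc c l) x (c * u * from_base b (map lw l) (/ (N * x))%R)%C.
Proof.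
intros HN Hb Hl. revert S acc c u.
induction Hl as [|d l Hd Hl IH]; intros S acc c u Hacc HO Hx Hu.
- replace (c * u * from_base b (map lw []) (/ (N * x))%R)%C
    with ((0 * from_infty acc x + c * u) * 1 + c * from_infty acc x * 0 + 0)%C
    by (simpl; ring).
  apply (is_Rder_plus (fun x => c * from_infty acc x * 1)%C (fun _ => 0%C));
    [|apply is_Rder_const].
  apply (is_Rder_mult (fun x => c * from_infty acc x)%C (fun _ => 1%C)); [|apply is_Rder_const].
  apply (is_Rder_mult (fun _ => c)); [apply is_Rder_const|exact Hu].
- assert (HNx : 0 < N * x) by nra.
  assert (Hix : 0 < / (N * x)) by now apply Rinv_0_lt_compat.
  assert (Hc : List.Forall cont_pos (map lw l)).
  { apply Forall_map. eapply Forall_impl; [|exact Hl]. intros a Ha. apply Ha. }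
  destruct (from_base_step (lw d) (map lw l) b Hb (proj1 Hd) (from_base_cont b _ Hb Hc))
    as [_ [HD _]].
  assert (HS : S + ord d < 0).
  { destruct l; destruct HO; lra. }
  destruct (infty_ok_step N b S d acc Hb Hd Hacc HS) as [Hacc' HU].
  assert (D1 : is_Rder (fun x => from_base b (map lw (d :: l)) (/ (N * x))%R) x
    ((- / (N * (x * x)))%R * (lw d (/ (N * x))%R * from_base b (map lw l) (/ (N * x))%R))%C).
  { apply (is_Rder_comp (from_base b (map lw (d :: l))) (fun x => / (N * x))).
    - apply HD, Hix.
    - auto_derive; [lra|]. field. lra. }
  assert (D2 := IH (S + ord d) (uw d :: acc) (c * ratio d)%C _ Hacc'
    ltac:(destruct l; [easy|apply HO]) Hx (HU x Hx)).
  assert (D3 := is_Rder_mult _ _ x _ _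
    (is_Rder_mult _ _ x _ _ (is_Rder_const c x) Hu) D1).
  assert (D := is_Rder_plus _ _ x _ _ D3 D2).
  assert (ER := proj2 (proj2 (proj2 Hd)) x Hx).
  apply (is_Rder_eq (cut_sum N b acc c (d :: l)) _ _ _ D).
  set (A := from_base b (map lw (d :: l)) (/ (N * x))%R).
  set (B := from_base b (map lw l) (/ (N * x))%R) in *.
  set (V := from_infty acc x). cbv beta. fold A B V. rewrite RtoC_opp.
  replace (c * ratio d * (uw d x * V) * B)%C with (c * (ratio d * uw d x) * V * B)%C by ring.
  rewrite <- ER. ring.
Qed.

(** At the fixed point every nonempty lower integral runs from b to b and vanishes; what remains is
    the last cut, whose weights have accumulated in reverse order. *)
Lemma cut_sum_base (N b : R) (l : list dual_weight) (acc : list (R -> C)) (c : C) :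
  0 < N -> 0 < b -> N * (b * b) = 1 -> List.Forall (dual_ok N b) l ->
  cut_sum N b acc c l b =
  (c * fold_right Cmult 1 (map ratio l) * from_infty (rev_append (map uw l) acc) b)%C.
Proof.
intros HN Hb HNb Hl. revert acc c. induction Hl as [|d l Hd Hl IH]; intros acc c.
- simpl. ring.
- assert (Hc : List.Forall cont_pos (map lw l)).
  { apply Forall_map. eapply Forall_impl; [|exact Hl]. intros a Ha. apply Ha. }
  destruct (from_base_step (lw d) (map lw l) b Hb (proj1 Hd) (from_base_cont b _ Hb Hc))
    as [_ [_ H0]].
  assert (E : / (N * b) = b) by (apply Rmult_eq_reg_l with (N * b); [rewrite Rinv_r; nra|nra]).
  cbn [cut_sum map]. rewrite E. cbv beta in H0. rewrite H0, IH. simpl. ring.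
Qed.

(** An upper factor O(x^S) meets a lower factor O((1/(N x))^(S + dl)), so each cut is O(x^(-dl)).
    Empty [acc], whose integral is the constant 1, cannot satisfy these hypotheses. *)
Lemma cut_sum_infty (N b dl S : R) (l : list dual_weight) (acc : list (R -> C)) (c : C) :
  0 < N -> 0 < b -> N * (b * b) = 1 -> 0 < dl -> List.Forall (dual_ok N b) l ->
  infty_ok b acc S -> orders_below dl S l ->
  tends (cut_sum N b acc c l) (Rbar_locally p_infty) (RtoC 0).
Proof.
intros HN Hb HNb Hdl Hl. revert S acc c.
assert (T1 : forall S l acc c, List.Forall (dual_ok N b) l -> infty_ok b acc S ->
  orders_below dl S l ->
  tends (fun x => c * from_infty acc x * from_base b (map lw l) (/ (N * x))%R)%C
    (Rbar_locally p_infty) (RtoC 0)).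
{ clear l Hl. intros S l acc c Hl [_ [K HK]] HO.
  destruct (from_base_bound N b dl S l HN Hb HNb Hl HO) as [K' HK'].
  apply tendsE; [apply Rbar_locally_filter|]. intros eps Heps.
  set (Q := Cmod c * Rabs K * Rabs K' * Rpower N (- (S + dl))).
  assert (HQ : 0 <= Q).
  { unfold Q. repeat apply Rmult_le_pos; try apply Rabs_pos; try apply Cmod_ge_0.
    left. apply exp_pos. }
  assert (H1 := Rpower_small (- dl) ltac:(lra) (eps / (Q + 1)) ltac:(apply Rdiv_lt_0_compat; lra)).
  assert (H2 : Rbar_locally p_infty (fun x => b <= x)) by (exists b; intros; lra).
  generalize (filter_and _ _ H1 H2). apply filter_imp. intros x [[Hx Hs] Hbx].
  assert (HNx : 0 < N * x) by nra.
  assert (Hix : 0 < / (N * x)) by now apply Rinv_0_lt_compat.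
  assert (Hib : / (N * x) <= b).
  { apply Rmult_le_reg_r with (N * x); [easy|]. rewrite Rinv_l by lra. nra. }
  replace (_ - 0)%C with (c * from_infty acc x * from_base b (map lw l) (/ (N * x))%R)%C by ring.
  rewrite !Cmod_mult. specialize (HK x Hbx). specialize (HK' _ Hix Hib). cbv beta in HK, HK'.
  assert (PS : 0 < Rpower x S) by apply exp_pos.
  assert (PT : 0 < Rpower (/ (N * x)) (S + dl)) by apply exp_pos.
  apply Rle_lt_trans with (Q * Rpower x (- dl)).
  - assert (E : Rpower x (- dl) * Rpower N (- (S + dl)) = Rpower x S * Rpower (/ (N * x)) (S + dl)).
    { unfold Rpower. rewrite <- !exp_plus. f_equal. rewrite ln_Rinv, ln_mult by easy. ring. }
    replace (Q * Rpower x (- dl))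
      with (Cmod c * Rabs K * Rabs K' * (Rpower x (- dl) * Rpower N (- (S + dl))))
      by (unfold Q; ring).
    rewrite E.
    replace (Cmod c * Rabs K * Rabs K' * (Rpower x S * Rpower (/ (N * x)) (S + dl)))
      with (Cmod c * (Rabs K * Rpower x S) * (Rabs K' * Rpower (/ (N * x)) (S + dl))) by ring.
    apply Rmult_le_compat; try apply Cmod_ge_0.
    + apply Rmult_le_pos; apply Cmod_ge_0.
    + apply Rmult_le_compat_l; [apply Cmod_ge_0|].
      eapply Rle_trans; [exact HK|]. apply Rmult_le_compat_r; [lra|apply Rle_abs].
    + eapply Rle_trans; [exact HK'|]. apply Rmult_le_compat_r; [lra|apply Rle_abs].
  - apply Rle_lt_trans with ((Q + 1) * Rpower x (- dl)).
    + apply Rmult_le_compat_r; [left; apply exp_pos|lra].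
    + apply Rmult_lt_reg_r with (/ (Q + 1)); [apply Rinv_0_lt_compat; lra|].
      replace ((Q + 1) * Rpower x (- dl) * / (Q + 1)) with (Rpower x (- dl)) by (field; lra).
      exact Hs. }
induction Hl as [|d l Hd Hl IH]; intros S acc c Hacc HO.
- assert (H := T1 S [] acc c (Forall_nil _) Hacc HO). revert H.
  apply filterlim_ext. intros x. simpl. ring.
- assert (H := T1 S (d :: l) acc c (Forall_cons d Hd Hl) Hacc HO).
  destruct HO as [HS HO].
  assert (HS' : S + ord d < 0) by (destruct l; destruct HO; lra).
  destruct (infty_ok_step N b S d acc Hb Hd Hacc HS') as [Hacc' _].
  assert (H2 := IH (S + ord d) (uw d :: acc) (c * ratio d)%C Hacc' HO).
  assert (H3 := tends_plus _ _ _ _ _ H H2).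
  replace (0 + 0)%C with (RtoC 0) in H3 by ring. exact H3.
Qed.

Theorem iter_weights_duality (N b : R) (l : list dual_weight) :
  0 < N -> 0 < b -> N * (b * b) = 1 -> List.Forall (dual_ok N b) l ->
  match l with [] => True | d :: l' => orders_below 0 (ord d) l' end ->
  iter_weights (at_point b) (map lw l) (at_right 0) =
  (fold_right Cmult 1 (map ratio l) *
   iter_weights (Rbar_locally p_infty) (rev (map uw l)) (at_point b))%C.
Proof.
intros HN Hb HNb Hl HO. destruct l as [|d l]; [simpl; ring|].
set (v := (fold_right Cmult 1 (map ratio (d :: l)) *
  from_infty (rev_append (map uw (d :: l)) []) b)%C).
assert (Hok0 : infty_ok b [] 0).
{ split.
  - intros x Hx. exact (tends_const (locally x) (RtoC 1)).
  - exists 1. intros x Hx. simpl. change (Cmod 1 <= 1 * Rpower x 0). rewrite Cmod_1.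
    rewrite Rpower_O by lra. lra. }
assert (HO' : orders_below 0 (0 + ord d) l) by now rewrite Rplus_0_l.
assert (Cst : forall x, b < x -> cut_sum N b [] 1 (d :: l) x = v).
{ intros x Hx. transitivity (cut_sum N b [] 1 (d :: l) b).
  - symmetry. apply (eq_is_derive (V := C_R_NormedModule)); [|easy].
    intros t Ht.
    assert (D := is_Rder_cut_sum N b 0 (d :: l) [] 1%C t 0%C HN Hb Hl Hok0 HO' ltac:(lra)
      (is_Rder_const (RtoC 1) t)).
    apply (is_Rder_eq _ _ _ _ D). rewrite Cmult_1_l. apply Cmult_0_l.
  - rewrite cut_sum_base by easy. unfold v. ring. }
assert (Hd := Forall_inv Hl). assert (Hl' := Forall_inv_tail Hl).
destruct (orders_below_uniform _ _ HO') as [dl [Hdl HOd]].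
assert (HS : 0 + ord d < 0) by (destruct l; destruct HO'; lra).
destruct (infty_ok_step N b 0 d [] Hb Hd Hok0 HS) as [Hok1 _].
(* The cut with everything below x is split off: it is the lower integral itself, of which the limit
   is sought. The other cuts tend to 0 while the whole sum keeps the value v. *)
assert (Tail := cut_sum_infty N b dl (0 + ord d) l [uw d] (1 * ratio d)%C HN Hb HNb Hdl Hl' Hok1 HOd).
assert (Lim : tends (from_base b (map lw (d :: l))) (at_right 0) v).
{ apply tendsE; [apply within_filter, locally_filter|]. intros eps Heps.
  assert (H1 := proj1 (tendsE _ _ _) Tail eps Heps).
  assert (H2 : Rbar_locally p_infty (fun x => b < x)) by (exists b; intros; lra).
  destruct (filter_and _ _ H1 H2) as [X HX].
  assert (HX' : 0 < Rabs X + 1) by (generalize (Rabs_pos X); lra).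
  assert (Hr : 0 < / (N * (Rabs X + 1))) by (apply Rinv_0_lt_compat; nra).
  exists (mkposreal _ Hr). intros t Ht Ht0.
  change (Rabs (t - 0) < / (N * (Rabs X + 1))) in Ht.
  rewrite Rminus_0_r, Rabs_pos_eq in Ht by lra.
  set (x := / (N * t)). assert (HNt : 0 < N * t) by nra.
  assert (Hx : X < x).
  { apply Rle_lt_trans with (Rabs X); [apply Rle_abs|].
    apply Rlt_trans with (Rabs X + 1); [lra|]. unfold x.
    rewrite <- (Rinv_inv (Rabs X + 1)). apply Rinv_lt_contravar.
    - apply Rmult_lt_0_compat; [easy|]. now apply Rinv_0_lt_compat.
    - apply Rmult_lt_compat_l with (r := N) in Ht; [|easy].
      replace (N * / (N * (Rabs X + 1))) with (/ (Rabs X + 1)) in Ht by (field; lra). easy. }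
  destruct (HX x Hx) as [A B]. assert (E := Cst x B).
  assert (Et : / (N * x) = t) by (unfold x; field; lra).
  cbn [cut_sum] in E. rewrite Et in E.
  set (L := from_base b (map lw (d :: l)) t) in *.
  set (Tl := cut_sum N b [uw d] (1 * ratio d) l x) in *.
  replace (L - v)%C with (- (Tl - 0))%C; [now rewrite Cmod_opp|].
  rewrite <- E. simpl. ring. }
assert (Ev : v = (fold_right Cmult 1 (map ratio (d :: l)) *
   iter_weights (Rbar_locally p_infty) (rev (map uw (d :: l))) (at_point b))%C).
{ unfold v. now rewrite <- rev_alt. }
rewrite <- Ev. cbn [map iter_weights].
apply (is_RInt_gen_unique (V := C_R_CompleteNormedModule)).
assert (Hc : List.Forall cont_pos (map lw l)).
{ apply Forall_map. eapply Forall_impl; [|exact Hl']. intros a Ha. apply Ha. }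
destruct (from_base_step (lw d) (map lw l) b Hb (proj1 Hd) (from_base_cont b _ Hb Hc))
  as [HI _].
(* The generalised integral from b to 0 is by definition the limit of the integrals from b to t, so
   its convergence is a consequence of [Lim]. *)
intros P HP. specialize (Lim P HP).
apply (Filter_prod _ _ _ (fun y => y = b)
  (fun t => 0 < t /\ P (from_base b (map lw (d :: l)) t))).
- easy.
- apply filter_and; [|exact Lim]. exists (mkposreal 1 Rlt_0_1). intros; lra.
- intros y t -> [Ht HPt]. eexists. split; [exact (HI t Ht)|exact HPt].
Qed.

(** * Duality of the two half-integrals *)

Definition weight (f : C -> C) (s : C) (t : R) : C :=
  (f (Ci * t) * Cpower (Ci * t) s / (Ci * t) * Ci)%C.

Lemma iter_int_weights (A B : (R -> Prop) -> Prop) (l : list ((C -> C) * C)) :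
  iter_int A l B = iter_weights A (map (fun p => weight (fst p) (snd p)) l) B.
Proof.
revert B. induction l as [|[f s] l IH]; intros B; [easy|].
cbn [iter_int map iter_weights fst snd]. f_equal. apply functional_extensionality. intros t.
rewrite IH. easy.
Qed.

Lemma Clog_imag (t : R) : 0 < t -> Clog (Ci * t) = (ln t, PI / 2).
Proof.
intros Ht. unfold Clog.
assert (Em : Cmod (Ci * t) = t).
{ rewrite Cmod_mult, Cmod_Ci, Cmod_R, Rabs_pos_eq by lra. ring. }
rewrite Em. f_equal.
replace (Re (Ci * t) / t) with 0 by (unfold Re; simpl; field; lra).
apply acos_0.
Qed.

Definition log_imag (t : R) : C := (ln t, PI / 2).

Lemma Cpower_imag (t : R) (s : C) : 0 < t -> Cpower (Ci * t) s = Cexp (s * log_imag t).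
Proof. intros Ht. unfold Cpower. now rewrite Clog_imag. Qed.

Lemma Cexp_log_imag (t : R) : 0 < t -> Cexp (log_imag t) = (Ci * t)%C.
Proof.
intros Ht. unfold Cexp, log_imag, Re, Im. simpl. rewrite cos_PI2, sin_PI2, exp_ln by easy.
apply injective_projections; simpl; ring.
Qed.

Lemma imag_nz (t : R) : 0 < t -> (Ci * t)%C <> 0%C.
Proof.
intros Ht. apply Cmult_neq_0; [apply Ci_nz|]. intros E. apply RtoC_inj in E. lra.
Qed.

Lemma Cpowz_imag (t : R) (k : Z) : 0 < t ->
  Cpowz (Ci * t) k = Cexp (IZR k * log_imag t).
Proof.
intros Ht. rewrite <- (Cexp_log_imag t Ht).
assert (hp : forall p, IZR (Zpos p) = INR (Pos.to_nat p)).
{ intros p; rewrite INR_IZR_INZ, positive_nat_Z; reflexivity. }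
destruct k as [|p|p]; cbn [Cpowz].
- now rewrite Cmult_0_l, Cexp_0.
- now rewrite hp, Cexp_INR.
- change (Zneg p) with (- Zpos p)%Z. rewrite opp_IZR, hp, RtoC_opp.
  replace (- INR (Pos.to_nat p) * log_imag t)%C with (- (INR (Pos.to_nat p) * log_imag t))%C
    by ring.
  now rewrite Cexp_opp, Cexp_INR.
Qed.

(** The involution sends i t to i/(N t) and the product of the two points is -1/N; both arguments
    being pi/2, the principal logarithms add up to pi i - ln N without ambiguity. *)
Lemma log_imag_inversion (N t : R) : 0 < N -> 0 < t ->
  log_imag (/ (N * t)) = (PI * Ci - ln N - log_imag t)%C.
Proof.
intros HN Ht. unfold log_imag. rewrite ln_Rinv, ln_mult by nra.
apply injective_projections; simpl; field.
Qed.

Lemma cont_pos_ext (f g : R -> C) : (forall t, 0 < t -> f t = g t) -> cont_pos f -> cont_pos g.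
Proof.
intros E Hf x Hx. rewrite <- E by easy.
apply (filterlim_ext_loc f); [|now apply Hf].
exists (mkposreal x Hx). intros t Ht. apply E.
change (Rabs (t - x) < x) in Ht. apply Rabs_def2 in Ht. lra.
Qed.

Lemma cont_pos_const (c : C) : cont_pos (fun _ => c).
Proof. intros x _. apply tends_const, locally_filter. Qed.

Lemma cont_pos_imag (f : C -> C) : (forall z, in_H z -> Cdiff f z) ->
  cont_pos (fun t => f (Ci * t)%C).
Proof.
intros Hf t Ht.
apply (filterlim_comp _ _ _ (fun t : R => (Ci * t)%C) f _ (locC (Ci * t)%C)).
- apply tends_mult; [apply locally_filter|apply tends_const, locally_filter|].
  apply tends_RtoC; [apply locally_filter|apply filterlim_id].
- apply Cdiff_cont, Hf. unfold in_H, Im. simpl. lra.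
Qed.

Lemma cont_pos_Cexp_log (s : C) : cont_pos (fun t => Cexp (s * log_imag t)).
Proof.
intros t Ht.
apply (filterlim_comp _ _ _ log_imag (fun w => Cexp (s * w)) _ (locC (log_imag t))).
- apply tends_pair; [apply locally_filter| |apply filterlim_const].
  apply (ex_derive_continuous ln). now auto_derive.
- apply (Cdiff_cont (fun w => Cexp (s * w))).
  apply (Cdiff_comp (fun w => s * w)%C Cexp); [|apply Cdiff_Cexp].
  apply Cdiff_mult; [apply Cdiff_const|apply Cdiff_id].
Qed.

Lemma cont_pos_inv : cont_pos (fun t => RtoC (/ t)).
Proof.
intros t Ht. apply tends_RtoC; [apply locally_filter|].
apply (ex_derive_continuous (fun t => / t)). auto_derive. lra.
Qed.

Lemma weightE (f : C -> C) (s : C) (t : R) : 0 < t ->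
  weight f s t = (f (Ci * t) * (Cexp (s * log_imag t) * RtoC (/ t)))%C.
Proof.
intros Ht. unfold weight. rewrite Cpower_imag, RtoC_inv by lra. field.
split; [intros E; apply RtoC_inj in E; lra|apply Ci_nz].
Qed.

Lemma cont_pos_weight (f : C -> C) (s : C) :
  cont_pos (fun t => f (Ci * t)%C) -> cont_pos (weight f s).
Proof.
intros Hf. eapply cont_pos_ext; [intros t Ht; symmetry; now apply weightE|].
apply cont_pos_mult; [exact Hf|].
apply cont_pos_mult; [apply cont_pos_Cexp_log|apply cont_pos_inv].
Qed.

Lemma Cmod_Cexp_log (s : C) (t : R) : 0 < t ->
  Cmod (Cexp (s * log_imag t)) = exp (- (Im s * (PI / 2))) * Rpower t (Re s).
Proof.
intros Ht. rewrite Cmod_Cexp. unfold Rpower. rewrite <- exp_plus. f_equal.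
rewrite re_mult. unfold log_imag, Re, Im. simpl. ring.
Qed.

Definition log_factor (N : nat) : C := (PI * Ci - ln (INR N))%C.

(* [g] and [h] are exchanged by z |-> -1/(N z), up to the factor
   exp(al + (pi i - log N) s) once they are multiplied by z^s and z^(k-s). *)
Definition partners (N : nat) (al : C) (k : Z) (g h : C -> C) : Prop :=
  cont_pos (fun t => g (Ci * t)%C) /\ cont_pos (fun t => h (Ci * t)%C) /\
  (exists M, forall t, / sqrt (INR N) <= t -> Cmod (h (Ci * t)%C) <= M) /\
  forall s t, 0 < t ->
    (g (Ci * RtoC (/ (INR N * t))%R) * Cexp (s * log_imag (/ (INR N * t))))%C =
    (Cexp (al + log_factor N * s) * (h (Ci * t) * Cexp ((IZR k - s) * log_imag t)))%C.

(** One list of such records carries the forms, weights and factors together through cutting and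
    reversal. *)
Record partner_data : Type := PartnerData {
  p_al : C;
  p_k : Z;
  p_g : C -> C;
  p_h : C -> C
}.

Definition partner_ok (N : nat) (p : partner_data) : Prop :=
  partners N (p_al p) (p_k p) (p_g p) (p_h p).

Definition dual_of (N : nat) (ps : partner_data * C) : dual_weight :=
  let (p, s) := ps in
  DualWeight (weight (p_g p) s) (weight (p_h p) (IZR (p_k p) - s)%C)
    (Re (IZR (p_k p) - s)%C) (Cexp (p_al p + log_factor N * s)).

Section Base.
Context (N : nat) (hN : (0 < N)%nat).

Lemma INR_N_pos : 0 < INR N.
Proof. now apply lt_0_INR. Qed.

Lemma base_pos : 0 < / sqrt (INR N).
Proof. apply Rinv_0_lt_compat, sqrt_lt_R0, INR_N_pos. Qed.

Lemma base_fixed : INR N * (/ sqrt (INR N) * / sqrt (INR N)) = 1.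
Proof.
assert (H := INR_N_pos). rewrite <- Rinv_mult, sqrt_sqrt by lra. field. lra.
Qed.

Lemma dual_of_ok (p : partner_data) (s : C) : partner_ok N p ->
  dual_ok (INR N) (/ sqrt (INR N)) (dual_of N (p, s)).
Proof.
intros [Hg [Hh [[M HM] HR]]]. assert (HN := INR_N_pos). assert (Hb := base_pos).
split; [|split; [|split]]; cbn [dual_of lw uw ord ratio].
- now apply cont_pos_weight.
- now apply cont_pos_weight.
- set (w := (IZR (p_k p) - s)%C). exists (M * exp (- (Im w * (PI / 2)))).
  intros x Hx. assert (Hx0 : 0 < x) by lra.
  rewrite weightE, !Cmod_mult, Cmod_Cexp_log, Cmod_R by easy.
  rewrite Rabs_pos_eq by (left; now apply Rinv_0_lt_compat).
  unfold Rminus. rewrite Rpower_plus, Rpower_Ropp, Rpower_1 by easy.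
  rewrite (Rmult_assoc M), <- (Rmult_assoc (exp _)).
  apply Rmult_le_compat_r; [|now apply HM].
  repeat apply Rmult_le_pos; try (left; apply exp_pos).
  left. now apply Rinv_0_lt_compat.
- intros x Hx. assert (Hi : 0 < / (INR N * x)) by (apply Rinv_0_lt_compat; nra).
  rewrite !weightE by easy.
  rewrite !(Cmult_assoc (p_g p _)), !(Cmult_assoc (p_h p _)), HR by easy.
  (* The measure dt/t is invariant under the inversion up to sign: one factor of the Jacobian
     cancels the 1/t taken at 1/(N x), the other is the 1/x of the dual weight. *)
  replace (/ (INR N * (x * x))) with (/ (INR N * x) * / x) by (field; lra).
  rewrite Rinv_inv, !RtoC_mult, !RtoC_inv, RtoC_mult; try nra.
  field. split; intros E; apply RtoC_inj in E; lra.
Qed.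

End Base.

Definition lower_forms (ps : list partner_data) : forms := map (fun p => (p_k p, p_g p)) ps.
Definition upper_forms (ps : list partner_data) : forms :=
  rev (map (fun p => (p_k p, p_h p)) ps).
Definition weights_of (ps : list partner_data) : list C := map (fun p => RtoC (IZR (p_k p))) ps.

Lemma Re_Csum_weights (ks : list Z) : Re (Csum (map (fun k => RtoC (IZR k)) ks)) = IZR (Zsum ks).
Proof.
induction ks as [|k ks IH]; [easy|]. cbn [map Csum fold_right Zsum].
fold (Csum (map (fun k => RtoC (IZR k)) ks)). fold (Zsum ks).
now rewrite re_plus, IH, plus_IZR, re_RtoC.
Qed.

(** Since the order of a dual weight is Re (k - s), negative partial sums of orders express the
    domain of convergence at 0. S stands for the coordinates already passed in the induction. *)
Lemma orders_below_partial_sums (N : nat) (ps : list partner_data) (s : list C) (S : R) :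
  length ps = length s ->
  (forall j, (1 <= j <= length ps)%nat ->
     S + IZR (Zsum (firstn j (map p_k ps))) < Re (Csum (firstn j s))) ->
  match map (dual_of N) (combine ps s) with
  | [] => True
  | d :: l => orders_below 0 (S + ord d) l
  end.
Proof.
revert s S. induction ps as [|p ps IH]; intros [|z s] S Hl H; try discriminate; [easy|].
simpl in Hl. injection Hl as Hl. cbn [combine map].
assert (H1 : S + ord (dual_of N (p, z)) < 0).
{ specialize (H 1%nat ltac:(simpl; lia)). 
  cbn [firstn map Csum Zsum fold_right] in H. rewrite Z.add_0_r, Cplus_0_r in H.
  cbn [dual_of ord]. unfold Re in *. simpl. lra. }
specialize (IH s (S + ord (dual_of N (p, z))) Hl).
assert (IH' := IH ltac:(
  intros j Hj; specialize (H (Datatypes.S j) ltac:(simpl; lia));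
  cbn [firstn map Csum Zsum fold_right] in H; fold (Csum (firstn j s)) in H;
  fold (Zsum (firstn j (map p_k ps))) in H;
  rewrite plus_IZR, re_plus in H; simpl ord; unfold Re in *; simpl in *; lra)).
destruct (map (dual_of N) (combine ps s)) as [|d l]; split; try easy; lra.
Qed.

Lemma iter_int_duality (N : nat) (ps : list partner_data) (s : list C) : (0 < N)%nat ->
  List.Forall (partner_ok N) ps -> length s = length ps ->
  (forall j, (1 <= j <= length ps)%nat ->
     IZR (Zsum (firstn j (map p_k ps))) < Re (Csum (firstn j s))) ->
  iter_int (at_point (/ sqrt (INR N))) (combine (map snd (lower_forms ps)) s) (at_right 0) =
  (Cexp (Csum (map p_al ps) + log_factor N * Csum s) *
   iter_int (Rbar_locally p_infty)
     (combine (map snd (upper_forms ps)) (reflect (weights_of ps) s))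
     (at_point (/ sqrt (INR N))%R))%C.
Proof.
intros hN Hps Hl HD. set (ds := map (dual_of N) (combine ps s)).
assert (E := iter_weights_duality (INR N) (/ sqrt (INR N)) ds (INR_N_pos N hN)
  (base_pos N hN) (base_fixed N hN)).
rewrite !iter_int_weights.
assert (E1 : map (fun p => weight (fst p) (snd p)) (combine (map snd (lower_forms ps)) s)
  = map lw ds).
{ unfold ds, lower_forms. clear - Hl. revert s Hl.
  induction ps as [|p ps IH]; intros [|z s] Hl; try discriminate; [easy|].
  simpl in *. f_equal. apply IH. lia. }
assert (E2 : map (fun p => weight (fst p) (snd p))
    (combine (map snd (upper_forms ps)) (reflect (weights_of ps) s)) = rev (map uw ds)).
{ unfold ds, upper_forms, reflect, weights_of. rewrite map_rev, combine_rev.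
  2:{ rewrite !length_map, length_combine, length_map. lia. }
  rewrite map_rev. f_equal. clear - Hl. revert s Hl.
  induction ps as [|p ps IH]; intros [|z s] Hl; try discriminate; [easy|].
  simpl in *. f_equal. apply IH. lia. }
assert (E3 : fold_right Cmult 1%C (map ratio ds) =
  Cexp (Csum (map p_al ps) + log_factor N * Csum s)).
{ unfold ds. clear - Hl. revert s Hl.
  induction ps as [|p ps IH]; intros [|z s] Hl; try discriminate.
  - simpl. replace (0 + _ * 0)%C with (RtoC 0) by ring. now rewrite Cexp_0.
  - simpl in *. rewrite IH by lia. rewrite <- Cexp_plus. f_equal. ring. }
rewrite E1, E2, <- E3. apply E.
- unfold ds. apply Forall_map, Forall_forall. intros [p z] Hpz.
  apply dual_of_ok; [easy|]. apply in_combine_l in Hpz.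
  rewrite Forall_forall in Hps. now apply Hps.
- assert (O := orders_below_partial_sums N ps s 0 (eq_sym Hl)).
  assert (O' := O ltac:(intros j Hj; rewrite Rplus_0_l; now apply HD)).
  fold ds in O'. destruct ds as [|d l]; [easy|]. now rewrite Rplus_0_l in O'.
Qed.

Lemma skipn_reflect (j : nat) (a s : list C) : length a = length s ->
  skipn (length s - j) (reflect a s) = reflect (firstn j a) (firstn j s).
Proof.
intros H. unfold reflect. rewrite skipn_rev, length_map, length_combine, H, Nat.min_id.
rewrite firstn_map, combine_firstn.
destruct (Nat.le_gt_cases j (length s)) as [Hj|Hj].
- do 4 f_equal; lia.
- replace (length s - (length s - j))%nat with (length s) by lia.
  now rewrite !firstn_all2 by lia.
Qed.

Lemma firstn_reflect (j : nat) (a s : list C) : length a = length s -> (j <= length s)%nat ->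
  firstn (length s - j) (reflect a s) = reflect (skipn j a) (skipn j s).
Proof.
intros H Hj. unfold reflect. rewrite firstn_rev, length_map, length_combine, H, Nat.min_id.
replace (length s - (length s - j))%nat with j by lia.
rewrite skipn_map. do 2 f_equal. clear Hj. revert a s H.
induction j as [|j IH]; intros [|x a] [|z s] H; try discriminate; try easy.
simpl. apply IH. simpl in H. lia.
Qed.

(** Uniqueness of the continuation needs an open set on which both sides are known to agree. *)
Lemma domain_nonempty (ks : list Z) :
  exists q, length q = length ks /\
    near_list q (fun s => forall j, (1 <= j <= length ks)%nat ->
      IZR (Zsum (firstn j ks)) < Re (Csum (firstn j s))).
Proof.
(* Within distance 1 of k + 1 each coordinate has real part above k, and the strict inequalities add
   up. *)
exists (map (fun k => RtoC (IZR k + 1)) ks). split; [apply length_map|].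
exists 1. split; [lra|].
assert (Hsum : forall ks s, Forall2 (fun k z => IZR k < Re z) ks s ->
  IZR (Zsum ks) <= Re (Csum s) /\ (ks <> [] -> IZR (Zsum ks) < Re (Csum s))).
{ induction 1 as [|k z ks' s H1 H2 [IH _]].
  - split; [unfold Re; simpl; lra|easy].
  - cbn [Csum Zsum fold_right]. fold (Csum s). fold (Zsum ks').
    rewrite plus_IZR, re_plus. split; intros; lra. }
intros s Hs j Hj.
assert (HF : Forall2 (fun k z => IZR k < Re z) ks s).
{ clear Hj. revert s Hs. induction ks as [|k ks IH]; intros s Hs; inversion Hs; subst; constructor.
  - match goal with H : Cmod _ < 1 |- _ => rename H into Hm end.
    assert (A := abs_fst_le (y - RtoC (IZR k + 1))%C).
    apply (Rle_lt_trans _ _ _ A) in Hm. apply Rabs_def2 in Hm.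
    unfold Re. simpl in Hm. lra.
  - now apply IH. }
apply (Forall2_firstn _ j), Hsum in HF. apply HF.
destruct j; [lia|]. destruct ks; [simpl in Hj; lia|]. easy.
Qed.

Theorem lower_upper_duality (N : nat) (ps : list partner_data) : (0 < N)%nat ->
  List.Forall (partner_ok N) ps ->
  meromorphic_eq (length ps) (I_lower N (lower_forms ps))
    (fun s => Cexp (Csum (map p_al ps) + log_factor N * Csum s) *
      I_upper N (upper_forms ps) (reflect (weights_of ps) s))%C.
Proof.
intros hN Hps. unfold I_lower, I_upper.
assert (L1 : length (lower_forms ps) = length ps) by apply length_map.
assert (L2 : length (upper_forms ps) = length ps)
  by (unfold upper_forms; rewrite length_rev; apply length_map).
assert (L3 : length (weights_of ps) = length ps) by apply length_map.
assert (K1 : map fst (lower_forms ps) = map p_k ps)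
  by (unfold lower_forms; rewrite map_map; easy).
rewrite L1, L2, K1.
destruct (domain_nonempty (map p_k ps)) as [q [Hq Nq]]. rewrite length_map in Hq, Nq.
apply mero_ext_reflect with q; try easy.
- intros s Hs.
  (* Reflection turns a head of s into a tail: the condition at 0 for the first j variables is the
     condition at infinity for the last j reflected ones. *)
  assert (Key : forall j, (j <= length ps)%nat ->
    Re (Csum (skipn (length ps - j) (reflect (weights_of ps) s))) =
    IZR (Zsum (firstn j (map p_k ps))) - Re (Csum (firstn j s))).
  { intros j Hj. rewrite <- Hs, skipn_reflect by congruence.
    rewrite Csum_reflect by (rewrite !length_firstn; congruence).
    unfold Cminus. rewrite re_plus, re_opp. unfold Rminus. f_equal.
    rewrite <- Re_Csum_weights. do 2 f_equal.
    unfold weights_of. now rewrite !firstn_map, map_map. }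
  split; intros H j Hj.
  + assert (E := Key (length ps - j)%nat ltac:(lia)).
    replace (length ps - (length ps - j))%nat with j in E by lia.
    rewrite E. specialize (H (length ps - j)%nat ltac:(lia)). lra.
  + assert (E := Key j ltac:(lia)). specialize (H (length ps - j)%nat ltac:(lia)). lra.
- intros s Hs HD. now apply iter_int_duality.
Qed.

(** * Modular forms on the imaginary axis *)

Lemma eventually_bounded (a : nat -> C) (B : R) (n0 : nat) :
  (forall n, (n0 <= n)%nat -> Cmod (a n) <= B) -> exists M, forall n, Cmod (a n) <= M.
Proof.
revert B. induction n0 as [|n0 IH]; intros B H.
- exists B. intros n. apply H. lia.
- apply (IH (Rmax B (Cmod (a n0)))). intros n Hn.
  destruct (Nat.eq_dec n n0) as [->|E]; [apply Rmax_r|].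
  eapply Rle_trans; [apply H; lia|apply Rmax_l].
Qed.

Lemma series_terms_bounded (a : nat -> C) (l : C) :
  is_series (K := C_AbsRing) (V := C_NormedModule) a l -> exists M, forall n, Cmod (a n) <= M.
Proof.
intros H. destruct (proj1 (tendsE _ (sum_n a) l) H 1 Rlt_0_1) as [n0 Hn0].
apply (eventually_bounded a 2 (S n0)). intros [|n] Hn; [lia|].
assert (E : a (S n) = ((sum_n a (S n) - l) - (sum_n a n - l))%C).
{ rewrite sum_Sn. change (plus (sum_n a n) (a (S n))) with (sum_n a n + a (S n))%C. ring. }
rewrite E. eapply Rle_trans; [apply Cmod_triangle|]. rewrite Cmod_opp.
generalize (Hn0 (S n) ltac:(lia)) (Hn0 n ltac:(lia)). lra.
Qed.

Lemma series_geometric_bound (a : nat -> C) (l : C) (M r : R) : 0 <= r < 1 -> 0 <= M ->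
  (forall n, Cmod (a n) <= M * r ^ n) ->
  is_series (K := C_AbsRing) (V := C_NormedModule) a l -> Cmod l <= M / (1 - r).
Proof.
intros Hr HM Ha H.
assert (HS : forall n, Cmod (sum_n a n) <= M * (1 - r ^ S n) / (1 - r)).
{ induction n as [|n IH].
  - rewrite sum_O. eapply Rle_trans; [apply Ha|]. right. simpl. field. lra.
  - rewrite sum_Sn. eapply Rle_trans; [apply Cmod_triangle|].
    generalize (Ha (S n)). intros.
    replace (M * (1 - r ^ S (S n)) / (1 - r))
      with (M * (1 - r ^ S n) / (1 - r) + M * r ^ S n) by (simpl; field; lra).
    lra. }
apply le_epsilon. intros eps Heps.
destruct (proj1 (tendsE _ (sum_n a) l) H eps Heps) as [n Hn].
specialize (Hn n (le_n n)). specialize (HS n).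
assert (M * (1 - r ^ S n) / (1 - r) <= M / (1 - r)).
{ apply Rmult_le_compat_r; [left; apply Rinv_0_lt_compat; lra|].
  assert (0 <= r ^ S n) by (apply pow_le; lra). nra. }
assert (T := Cmod_triangle (sum_n a n) (- (sum_n a n - l))).
rewrite Cmod_opp in T.
replace (sum_n a n + - (sum_n a n - l))%C with l in T by ring. lra.
Qed.

Lemma fourier_bounded (N : nat) (q : nat -> C) (g : C -> C) (y0 : R) : (0 < N)%nat -> 0 < y0 ->
  (forall z, in_H z -> is_series (K := C_AbsRing) (V := C_NormedModule)
     (fun m : nat => (q m * Cexp (2 * PI * Ci * INR m * z / INR N))%C) (g z)) ->
  exists M, forall y, y0 <= y -> Cmod (g (Ci * y)%C) <= M.
Proof.
intros hN Hy0 H. assert (HN := INR_N_pos N hN).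
assert (HI : forall y, 0 < y -> in_H (Ci * y)%C) by (intros y Hy; unfold in_H, Im; simpl; lra).
assert (ET : forall (m : nat) (y : R), Cmod (q m * Cexp (2 * PI * Ci * INR m * (Ci * y) / INR N))%C =
  Cmod (q m) * exp (- (2 * PI / INR N * y)) ^ m).
{ intros m y. rewrite Cmod_mult, Cmod_Cexp. f_equal.
  rewrite <- Rpower_pow by apply exp_pos. unfold Rpower. rewrite ln_exp. f_equal.
  replace (2 * PI * Ci * INR m * (Ci * y) / INR N)%C
    with (RtoC (INR m * - (2 * PI / INR N * y))); [easy|].
  unfold Rdiv. rewrite RtoC_mult, RtoC_opp, !RtoC_mult, RtoC_inv by lra.
  transitivity (2 * PI * INR m * y / INR N * (Ci * Ci))%C; [|field; intros E; apply RtoC_inj in E; lra].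
  replace (Ci * Ci)%C with (- (1))%C by (apply injective_projections; simpl; ring).
  field. intros E; apply RtoC_inj in E; lra. }
(* Convergence at height y0 / 2 bounds |q_m| r^m. From height y0 on the m-th term is at most |q_m|
   (r r)^m, which leaves a geometric factor r^m. *)
destruct (series_terms_bounded _ _ (H _ (HI (y0 / 2) ltac:(lra)))) as [M HM].
assert (M0 : 0 <= M) by (eapply Rle_trans; [apply Cmod_ge_0|apply (HM 0%nat)]).
set (r := exp (- (2 * PI / INR N * (y0 / 2)))).
assert (Hc : 0 < 2 * PI / INR N) by (apply Rdiv_lt_0_compat; generalize PI_RGT_0; lra).
assert (Hr : 0 < r < 1).
{ split; [apply exp_pos|]. unfold r. rewrite <- exp_0. apply exp_increasing. nra. }
exists (M / (1 - r)). intros y Hy.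
apply (series_geometric_bound _ _ M r) with (4 := H _ (HI y ltac:(lra))); [lra|easy|].
intros m. specialize (HM m). rewrite ET in HM |- *.
fold r in HM.
assert (Ee : exp (- (2 * PI / INR N * y)) <= r * r).
{ unfold r. rewrite <- exp_plus. destruct (Rle_lt_or_eq_dec _ _ Hy) as [Hlt|<-].
  - left. apply exp_increasing. nra.
  - right. f_equal. field. lra. }
apply Rle_trans with (Cmod (q m) * (r * r) ^ m).
- apply Rmult_le_compat_l; [apply Cmod_ge_0|]. apply pow_incr.
  split; [left; apply exp_pos|exact Ee].
- rewrite Rpow_mult_distr, <- Rmult_assoc. apply Rmult_le_compat_r; [apply pow_le; lra|].
  exact HM.
Qed.

Lemma Cpowz_1 (k : Z) : Cpowz 1 k = 1%C.
Proof.
destruct k; cbn [Cpowz]; rewrite ?Cpow_1_l; try easy. field.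
Qed.

Lemma slash_identity (k : Z) (f : C -> C) (z : C) : slash k 1 0 0 1 f z = f z.
Proof.
unfold slash. simpl (_ - _)%Z. unfold Rpower. rewrite ln_1, Rmult_0_r, exp_0.
replace (0 * z + 1)%C with (RtoC 1) by ring. rewrite Cpowz_1.
replace ((1 * z + 0) / 1)%C with z by field. ring.
Qed.

Lemma slash_inversion_imag (k : Z) (f : C -> C) (t : R) : 0 < t ->
  slash k 0 (-1) 1 0 f (Ci * t) = (Cexp (- IZR k * log_imag t) * f (Ci * RtoC (/ t)))%C.
Proof.
intros Ht. assert (Hz := imag_nz t Ht).
assert (Ht0 : RtoC t <> 0%C) by (intros E; apply RtoC_inj in E; lra).
unfold slash. simpl (_ - _)%Z. unfold Rpower. rewrite ln_1, Rmult_0_r, exp_0.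
replace (1 * (Ci * t) + 0)%C with (Ci * t)%C by ring.
rewrite Cpowz_imag, opp_IZR, RtoC_opp by easy.
replace ((0 * (Ci * t) + (-1)%R) / (Ci * t))%C with (Ci * RtoC (/ t))%C.
- ring.
- rewrite RtoC_inv by lra.
  replace (0 * (Ci * t) + (-1)%R)%C with (Ci * Ci)%C by (apply injective_projections; simpl; ring).
  field. split; [easy|apply Ci_nz].
Qed.

Lemma tilde_imag (N : nat) (k : Z) (f : C -> C) (t : R) : (0 < N)%nat -> 0 < t ->
  tilde N k f (Ci * t) =
  (Cexp (- IZR k / 2 * ln (INR N) - IZR k * log_imag t) * f (Ci * RtoC (/ (INR N * t))%R))%C.
Proof.
intros hN Ht. assert (HN := INR_N_pos N hN).
assert (Ht0 : RtoC t <> 0%C) by (intros E; apply RtoC_inj in E; lra).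
assert (HN0 : RtoC (INR N) <> 0%C) by (intros E; apply RtoC_inj in E; lra).
rewrite tildeE by (try easy; unfold in_H, Im; simpl; lra).
rewrite Cpowz_imag by easy. f_equal.
- unfold Rpower. rewrite <- Cexp_RtoC, <- Cexp_plus. f_equal.
  rewrite opp_IZR, RtoC_opp, RtoC_mult. unfold Rdiv.
  rewrite RtoC_mult, RtoC_opp, RtoC_inv by lra. unfold Cdiv. ring.
- f_equal. rewrite RtoC_inv, RtoC_mult by nra.
  replace (- (1))%C with (Ci * Ci)%C by (apply injective_projections; simpl; ring).
  field. repeat split; try easy. apply Ci_nz.
Qed.

Section Partners.
Context (N : nat) (hN : (0 < N)%nat) (k : Z) (chi : Z -> C) (f : C -> C)
  (hf : modular_form N k chi f).

Lemma modular_form_cont : cont_pos (fun t => f (Ci * t)%C).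
Proof.
apply cont_pos_imag. intros z Hz. apply ex_derive_Cdiff. now apply hf.
Qed.

Lemma tilde_cont : cont_pos (fun t => tilde N k f (Ci * t)%C).
Proof.
assert (HN := INR_N_pos N hN).
eapply cont_pos_ext; [intros t Ht; symmetry; now apply tilde_imag|].
apply cont_pos_mult.
- apply cont_pos_ext with
    (fun t => Cexp (- IZR k / 2 * ln (INR N)) * Cexp (- IZR k * log_imag t))%C.
  + intros t Ht. rewrite <- Cexp_plus. f_equal. ring.
  + apply cont_pos_mult; [apply cont_pos_const|apply cont_pos_Cexp_log].
- intros t Ht.
  apply (filterlim_comp _ _ _ (fun t => / (INR N * t)) (fun t => f (Ci * t)%C) _
    (locally (/ (INR N * t)))).
  + apply (ex_derive_continuous (fun t => / (INR N * t))). auto_derive. nra.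
  + apply modular_form_cont. apply Rinv_0_lt_compat. nra.
Qed.

Lemma modular_form_bounded (y0 : R) : 0 < y0 ->
  exists M, forall y, y0 <= y -> Cmod (f (Ci * y)%C) <= M.
Proof.
intros Hy0. destruct hf as [_ [_ Hq]].
destruct (Hq 1%Z 0%Z 0%Z 1%Z ltac:(lia)) as [q H].
destruct (fourier_bounded N q (slash k 1 0 0 1 f) y0 hN Hy0 H) as [M HM].
exists M. intros y Hy. specialize (HM y Hy). now rewrite slash_identity in HM.
Qed.

(** At infinity the tilde sees f at the cusp 0: its value at i y is N^(k/2) times that of f slashed
    by (0 -1; 1 0) at i N y. This explains the height N y0 and the constant. *)
Lemma tilde_bounded (y0 : R) : 0 < y0 ->
  exists M, forall y, y0 <= y -> Cmod (tilde N k f (Ci * y)%C) <= M.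
Proof.
intros Hy0. assert (HN := INR_N_pos N hN). destruct hf as [_ [_ Hq]].
destruct (Hq 0%Z (-1)%Z 1%Z 0%Z ltac:(lia)) as [q H].
destruct (fourier_bounded N q (slash k 0 (-1) 1 0 f) (INR N * y0) hN ltac:(nra) H) as [M HM].
exists (Cmod (Cexp (IZR k / 2 * ln (INR N))) * M). intros y Hy.
specialize (HM (INR N * y) ltac:(nra)).
rewrite slash_inversion_imag in HM by nra. rewrite tilde_imag by (try easy; lra).
eapply Rle_trans; [|apply Rmult_le_compat_l; [apply Cmod_ge_0|exact HM]].
rewrite <- Cmod_mult, Cmult_assoc, <- Cexp_plus. right. do 3 f_equal.
replace (log_imag (INR N * y)) with (ln (INR N) + log_imag y)%C.
- field.
- unfold log_imag. rewrite ln_mult by lra. apply injective_projections; simpl; ring.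
Qed.

(** Solving the definition of the tilde for f (i/(N t)) gives N^(k/2) (i t)^k tilde f (i t); the
    power of i t supplies the k in the exponent k - s. *)
Lemma partners_tilde :
  partners N (IZR k / 2 * ln (INR N)) k f (tilde N k f).
Proof.
assert (HN := INR_N_pos N hN).
split; [apply modular_form_cont|]. split; [apply tilde_cont|].
split; [apply tilde_bounded, base_pos, hN|]. intros s t Ht.
rewrite tilde_imag, log_imag_inversion by easy.
rewrite (Cmult_comm (f _)).
match goal with |- (?a * ?b)%C = (?c * (?d * ?e * ?g))%C =>
  transitivity ((c * (d * g)) * e)%C; [|ring] end.
f_equal. rewrite <- !Cexp_plus. f_equal. unfold log_factor.
field.
Qed.

(** With the roles exchanged, the double tilde (-1)^k f appears; exp(-pi i k) is this sign. *)
Lemma partners_tilde_sym :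
  partners N (IZR k / 2 * ln (INR N) - IZR k * (PI * Ci)) k (tilde N k f) f.
Proof.
assert (HN := INR_N_pos N hN).
split; [apply tilde_cont|]. split; [apply modular_form_cont|].
split; [apply modular_form_bounded, base_pos, hN|]. intros s t Ht.
assert (Hi : 0 < / (INR N * t)) by (apply Rinv_0_lt_compat; nra).
rewrite tilde_imag by easy.
replace (/ (INR N * / (INR N * t))) with t by (field; lra).
rewrite log_imag_inversion by easy.
match goal with |- (?a * ?b * ?c)%C = (?d * (?e * ?g))%C =>
  transitivity ((a * c) * b)%C; [ring|]; transitivity ((d * g) * b)%C; [|ring] end.
f_equal. rewrite <- !Cexp_plus. f_equal. unfold log_factor.
field.
Qed.

End Partners.

(** * The functional equation *)

Lemma Csum_map_rev {I} (F : I -> C) (L : list I) : Csum (map F (rev L)) = Csum (map F L).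
Proof. now rewrite map_rev, Csum_rev. Qed.

Lemma Csum_firstn_skipn (j : nat) (s : list C) :
  (Csum (firstn j s) + Csum (skipn j s))%C = Csum s.
Proof. now rewrite <- Csum_app, firstn_skipn. Qed.

Lemma Csum_seq_reverse (F : nat -> C) (n : nat) :
  Csum (map F (seq 0 (S n))) = Csum (map (fun j => F (n - j)%nat) (seq 0 (S n))).
Proof.
rewrite <- Csum_map_rev. f_equal.
apply nth_ext with (d := RtoC 0) (d' := RtoC 0).
{ now rewrite !length_map, length_rev. }
intros i Hi. rewrite length_map, length_rev, length_seq in Hi.
rewrite !(nth_indep _ (RtoC 0) (F 0%nat)) by (rewrite ?length_map, ?length_rev, length_seq; lia).
rewrite map_nth, rev_nth, length_seq, seq_nth by (rewrite ?length_seq; lia).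
rewrite (nth_indep _ (F 0%nat) (F (n - 0)%nat)) by (rewrite ?length_map, length_seq; lia).
rewrite (map_nth (fun j => F (n - j)%nat)), seq_nth by lia. easy.
Qed.

Theorem corollary3p5 (N n : nat) (hN : (0 < N)%nat) (hn : (0 < n)%nat)
  (k : nat -> Z) (chi : nat -> Z -> C) (f : nat -> C -> C)
  (hchi : forall j, (1 <= j <= n)%nat -> dirichlet_character N (chi j))
  (hf : forall j, (1 <= j <= n)%nat -> modular_form N (k j) (chi j) (f j)) :
  meromorphic_eq n
    (fun s => modular_Z N (map (fun j => (k j, f j)) (seq 1 n)) s)
    (fun s =>
       (Cexp (PI * Ci * Csum s) *
        modular_Z N
          (map (fun j => (k j, tilde N (k j) (f j))) (rev (seq 1 n)))
          (map (fun j => IZR (k j) - nth (j - 1) s 0)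
               (rev (seq 1 n))))%C).
Proof.
assert (HN := INR_N_pos N hN).
set (L := seq 1 n). assert (HL : length L = n) by apply length_seq.
assert (HLin : forall j, In j L -> (1 <= j <= n)%nat) by (intros j Hj; apply in_seq in Hj; lia).
set (al := fun j => (IZR (k j) / 2 * ln (INR N))%C).
set (kz := fun j => RtoC (IZR (k j))).
set (P1 := fun j => PartnerData (al j) (k j) (f j) (tilde N (k j) (f j))).
set (P2 := fun j => PartnerData (al j - kz j * (PI * Ci))%C (k j) (tilde N (k j) (f j)) (f j)).
set (l := map (fun j => (k j, f j)) L).
set (l' := map (fun j => (k j, tilde N (k j) (f j))) (rev L)).
set (a := map kz L).
assert (Ha : length a = n) by (unfold a; now rewrite length_map).
assert (Hl : length l = n) by (unfold l; now rewrite length_map).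
assert (Hl' : length l' = n) by (unfold l'; now rewrite length_map, length_rev).
assert (Refl : forall s : list C, length s = n ->
  map (fun j => IZR (k j) - nth (j - 1) s 0)%C (rev L) = reflect a s).
{ intros s Hs. unfold reflect, a. rewrite map_rev. f_equal. unfold L, kz. clear - Hs.
  (* The index j starts at 1; carrying the prefix [s0] of coordinates already consumed keeps j - 1
     at the head of the remaining ones. *)
  subst n. assert (G : forall s0 s : list C, map (fun j => IZR (k j) - nth (j - 1) (s0 ++ s) 0)%C
      (seq (S (length s0)) (length s)) =
    map (fun p => fst p - snd p)%C
      (combine (map (fun j => RtoC (IZR (k j))) (seq (S (length s0)) (length s))) s)).
  { intros s0 s'. revert s0. induction s' as [|z s' IH]; intros s0; [easy|].
    cbn [length seq map combine fst snd]. f_equal.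
    - rewrite app_nth2 by lia. replace (S (length s0) - 1 - length s0)%nat with 0%nat by lia.
      easy.
    - specialize (IH (s0 ++ [z])). rewrite length_app in IH. simpl in IH.
      rewrite Nat.add_1_r in IH. rewrite <- app_assoc in IH. exact IH. }
  exact (G [] s). }
set (be := log_factor N).
(* This makes the factor for (tilde f, f) at the reflected arguments inverse to the factor for (f,
   tilde f) at the original ones. *)
assert (al_sym : forall M, Csum (map (fun j => al j - kz j * (PI * Ci))%C M) =
  (- Csum (map al M) - be * Csum (map kz M))%C).
{ induction M as [|i M IH]; simpl; [ring|]. rewrite IH.
  unfold al, kz, be, log_factor. field. }
assert (al_sum : forall M, Csum (map al M) = (Csum (map kz M) / 2 * ln (INR N))%C).
{ induction M as [|i M IH]; simpl; [field|]. rewrite IH. unfold al, kz. field. }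
assert (Lower : forall j, (j <= n)%nat ->
  meromorphic_eq n (fun s => I_lower N (firstn j l) (firstn j s))
    (fun s => Cexp (Csum (map al (firstn j L)) + be * Csum (firstn j s)) *
       I_upper N (skipn (n - j) l') (skipn (n - j) (reflect a s)))%C).
{ intros j Hj. set (ps := map P1 (firstn j L)).
  assert (Lps : length ps = j) by (unfold ps; rewrite length_map, length_firstn; lia).
  assert (D := lower_upper_duality N ps hN). rewrite Lps in D.
  assert (Hps : List.Forall (partner_ok N) ps).
  { apply Forall_map, Forall_forall. intros i Hi. apply (partners_tilde N hN (k i) (chi i)).
    apply hf, HLin. rewrite <- (firstn_skipn j L). apply in_or_app. now left. }
  specialize (D Hps).
  apply (meromorphic_eq_pullback n j (firstn j) _ _ (coordinate_firstn n j Hj)) in D.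
  revert D. apply meromorphic_eq_ext; intros s Hs.
  - f_equal. unfold ps, lower_forms, l. now rewrite map_map, firstn_map.
  - unfold ps. rewrite map_map. f_equal.
    rewrite <- Hs at 2. rewrite skipn_reflect by congruence. f_equal.
    + unfold upper_forms, l'. rewrite map_map, map_rev, skipn_rev, length_map, HL.
      rewrite firstn_map. do 3 f_equal. lia.
    + unfold weights_of, a. now rewrite map_map, firstn_map. }
assert (Upper : forall j, (j <= n)%nat ->
  meromorphic_eq n (fun s => I_upper N (skipn j l) (skipn j s))
    (fun s => Cexp (Csum (map al (skipn j L)) + be * Csum (skipn j s)) *
       I_lower N (firstn (n - j) l') (firstn (n - j) (reflect a s)))%C).
(* Duality expresses lower integrals through upper ones. It is applied to the tilded forms in
   reverse order at the reflected arguments: reflecting twice returns the original forms and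
   arguments in the upper integral, for which the relation is then solved. *)
{ intros j Hj. set (ps := map P2 (rev (skipn j L))).
  assert (Lps : length ps = (n - j)%nat)
    by (unfold ps; rewrite length_map, length_rev, length_skipn; lia).
  assert (D := lower_upper_duality N ps hN). rewrite Lps in D.
  assert (Hps : List.Forall (partner_ok N) ps).
  { apply Forall_map, Forall_forall. intros i Hi.
    apply (partners_tilde_sym N hN (k i) (chi i)).
    apply hf, HLin. apply in_rev in Hi. rewrite <- (firstn_skipn j L). apply in_or_app. now right. }
  specialize (D Hps). set (aj := map kz (skipn j L)).
  assert (Haj : length aj = (n - j)%nat) by (unfold aj; rewrite length_map, length_skipn; lia).
  assert (Ew : weights_of ps = rev aj).
  { unfold weights_of, ps, aj. rewrite map_map, <- map_rev. easy. }
  apply (meromorphic_eq_pullback (n - j) (n - j) (reflect aj) _ _ (coordinate_reflect _ _ Haj)) in D.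
  apply (meromorphic_eq_pullback n (n - j) (skipn j) _ _ (coordinate_skipn n j)) in D.
  (* Multiplying by this exponential cancels the factor that duality puts in front of the upper
     integral. *)
  assert (ML : meromorphic_eq n
    (fun s => Cexp (Csum (map al (skipn j L)) + be * Csum (skipn j s)))
    (fun s => Cexp (Csum (map al (skipn j L)) + be * Csum (skipn j s)))).
  { apply meromorphic_eq_refl; [|easy].
    apply (meromorphic_pullback n (n - j) (skipn j)
      (fun s => Cexp (Csum (map al (skipn j L)) + be * Csum s)) (coordinate_skipn n j)).
    apply meromorphic_Cexp_Csum. }
  assert (D' := meromorphic_eq_mult _ _ _ _ _ ML D).
  assert (Sym : forall F G, meromorphic_eq n F G -> meromorphic_eq n G F).
  { intros F G [MF [MG [U [OU E]]]]. split; [easy|]. split; [easy|].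
    exists U. split; [easy|]. intros s Hs HU. symmetry. auto. }
  apply Sym. revert D'. apply meromorphic_eq_ext; intros s Hs.
  - f_equal. rewrite <- Hs at 2. rewrite firstn_reflect by (rewrite ?Hs; congruence || lia).
    f_equal.
    + unfold lower_forms, ps, l'. rewrite map_map, !map_rev, firstn_rev, length_map, HL.
      replace (n - (n - j))%nat with j by lia. now rewrite skipn_map.
    + f_equal. unfold a. now rewrite skipn_map.
  - cbv beta. rewrite Cmult_assoc, <- Cexp_plus.
    assert (Hsj : length (skipn j s) = (n - j)%nat) by (rewrite length_skipn; lia).
    rewrite Ew, reflect_involutive, Csum_reflect by congruence.
    replace (upper_forms ps) with (skipn j l).
    2:{ unfold upper_forms, ps, l. now rewrite map_map, map_rev, rev_involutive, skipn_map. }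
    replace (_ + _)%C with (RtoC 0); [rewrite Cexp_0; ring|].
    unfold ps, aj. rewrite map_map, Csum_map_rev.
    unfold P2. simpl. rewrite al_sym. fold be. ring. }
assert (MT : meromorphic n (fun s => Cexp (Csum s / 2 * ln (INR N)))).
{ apply (meromorphic_ext n (fun s => Cexp (0 + ln (INR N) / 2 * Csum s)));
    [|apply meromorphic_Cexp_Csum].
  intros s _. f_equal. field. }
assert (Sum := meromorphic_eq_Csum n (seq 0 (S n))
  (fun j s => I_lower N (firstn j l) (firstn j s) * I_upper N (skipn j l) (skipn j s))%C
  (fun j s =>
    (Cexp (Csum (map al (firstn j L)) + be * Csum (firstn j s)) *
       I_upper N (skipn (n - j) l') (skipn (n - j) (reflect a s))) *
    (Cexp (Csum (map al (skipn j L)) + be * Csum (skipn j s)) *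
       I_lower N (firstn (n - j) l') (firstn (n - j) (reflect a s))))%C).
assert (Sum' := Sum ltac:(intros j Hj; apply in_seq in Hj;
  apply meromorphic_eq_mult; [apply Lower; lia|apply Upper; lia])).
assert (Tot := meromorphic_eq_mult n _ _ _ _
  (meromorphic_eq_refl n _ _ MT (fun s _ => eq_refl)) Sum').
revert Tot. apply meromorphic_eq_ext; intros s Hs.
- unfold modular_Z, I_full. now rewrite Hl.
- unfold modular_Z, I_full. rewrite Refl, Hl' by easy.
  (* Cut j on the left corresponds to cut n - j on the right, the roles of the lower and upper parts
     being exchanged. *)
  rewrite (Csum_seq_reverse (fun j => I_lower N (firstn j l') (firstn j (reflect a s)) *
    I_upper N (skipn j l') (skipn j (reflect a s)))%C).
  (* The sums over the head and over the tail of each cut recombine into full sums, so the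
     exponential is the same for all j. *)
  rewrite (map_ext _ (fun j => Cexp (Csum (map al L) + be * Csum s) *
    (I_lower N (firstn (n - j) l') (firstn (n - j) (reflect a s)) *
     I_upper N (skipn (n - j) l') (skipn (n - j) (reflect a s))))%C).
  2:{ intros j.
      assert (E : (Csum (map al L) + be * Csum s)%C =
        ((Csum (map al (firstn j L)) + be * Csum (firstn j s)) +
         (Csum (map al (skipn j L)) + be * Csum (skipn j s)))%C).
      { rewrite <- (Csum_firstn_skipn j s), <- (Csum_firstn_skipn j (map al L)).
        rewrite firstn_map, skipn_map. ring. }
      rewrite E, (Cexp_plus (_ + _) (_ + _)). ring. }
  rewrite Csum_scal, !Cmult_assoc, <- !Cexp_plus. f_equal. f_equal.
  rewrite Csum_reflect by congruence.
  (* With A the sum of the weights and S that of the s_j, the claim is the identity S/2 ln N + A/2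
     ln N + (pi i - ln N) S = pi i S + (A - S)/2 ln N. *)
  rewrite al_sum. fold a. unfold be, log_factor. field.
Qed.
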